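(* Let $\alpha\in(0,1]$, $b_1,b_2>0$, $c\in(0,1)$ and let $f:[0,1]\to[0,1]$ be a map such that: (1) $0$ and $1$ are neutral fixed points: $f(0)=0$, $f(1)=1$, $f'(0)=f'(1)=1$; (2) $f|_{(0,c)}$ and $f|_{(c,1)}$ are $C^2$ diffeomorphisms onto $(0,1)$ that admit $C^2$ extensions to the closed intervals $[0,c]$ and $[c,1]$ respectively, with image $[0,1]$; (3) $f'(x)>1$ for all $x\in(0,1)$ (at $x=c$: for both one-sided derivatives of the extensions in (2)), $f$ is convex on a neighbourhood of $0$ and $f$ is concave on a neighbourhood of $1$; (4) $f(x)-x\sim b_1x^{1+1/\alpha}$ as $x\to0$ and $x-f(x)\sim b_2(1-x)^{1+1/\alpha}$ as $x\to1$. Suppose that $\varphi:[0,1]\to\mathbb R$ is bounded, measurable, and continuous at $0$ and $1$. Then $$\lim_{n\to\infty}\int\psi\cdot\varphi\circ f^n\,d\mathrm{Leb}=\int\psi\,d\mathrm{Leb}\int\varphi\,d\nu_{\bar p}\qquad\text{for all }\psi\in L^1([0,1],\mathrm{Leb}).$$ Equivalently, $$\lim_{n\to\infty}\int\psi\cdot\varphi\circ f^n\,d\mu=\int\psi\,d\mu\int\varphi\,d\nu_{\bar p}\qquad\text{for all }\psi\in L^1([0,1],\mu).$$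
   Context: $\mathrm{Leb}$ is Lebesgue measure on $[0,1]$. For such $f$ it is known (Thaler) that there is a unique (up to scaling) $\sigma$-finite $f$-invariant measure $\mu$ absolutely continuous with respect to Lebesgue; $\mu([0,1])=\infty$, and its density $h=d\mu/d\mathrm{Leb}$ has a version that is continuous and positive on $(0,1)$. Let $g_1:[0,1]\to[0,c]$ and $g_2:[0,1]\to[c,1]$ be the inverses of the (extended) branches of $f$ on $[0,c]$ and $[c,1]$. Set $$c_1=b_1^{-\alpha}\alpha^\alpha h(g_2(0))\,g_2'(0),\qquad c_2=b_2^{-\alpha}\alpha^\alpha h(g_1(1))\,g_1'(1),\qquad \bar p=\frac{c_1}{c_1+c_2}\in(0,1),$$ and $\nu_{\bar p}=\bar p\,\delta_0+(1-\bar p)\,\delta_1$. $a(x)\sim b(x)$ means $a(x)/b(x)\to1$. *)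

(* Defs.v *)
From HB Require Import structures.
From mathcomp Require Import all_boot all_order all_algebra.
From mathcomp Require Import all_classical all_reals all_analysis.

Set Implicit Arguments.
Unset Strict Implicit.
Unset Printing Implicit Defensive.

Import Order.TTheory GRing.Theory Num.Theory.
Import numFieldNormedType.Exports.

Local Open Scope classical_set_scope.
Local Open Scope ring_scope.

Section Calculus.
Context {R : realType}.
Implicit Types (A B : set R) (f g : R -> R).

(* Derivative relative to A: the two-sided derivative at an interior point of A,
   the one-sided derivative at an endpoint when A is an interval. *)
Definition has_deriv_within A g (x l : R) : Prop :=
  (g y - g x) / (y - x) @[y --> within A x^'] --> l.

Definition deriv_within A g (x : R) : R :=
  lim ((g y - g x) / (y - x) @[y --> within A x^']).

Definition C2_on A g : Prop :=
  exists g' g'' : R -> R,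
    [/\ (forall x, A x -> has_deriv_within A g x (g' x)),
        (forall x, A x -> has_deriv_within A g' x (g'' x)) &
        {within A, continuous g''}].

Definition inverse_on A B f g : Prop :=
  [/\ set_fun A B f, set_fun B A g,
      (forall x, A x -> g (f x) = x) & (forall y, B y -> f (g y) = y)].

Definition C2_diffeo A B f : Prop :=
  exists g, [/\ inverse_on A B f g, C2_on A f & C2_on B g].

Definition C2_extension A B f g : Prop :=
  (forall x, A x -> g x = f x) /\ C2_on B g.

End Calculus.

(* A self-map f of [0,1] is represented by a function R -> R preserving [0,1];
   its values outside [0,1] play no role. The functions f1 and f2 are the C^2
   extensions of the two open branches of f to [0,c] and [c,1]; they are
   determined there by f, whereas f c is an arbitrary point of [0,1]. *)
Record doubly_intermittent (R : realType) (alpha b1 b2 c : R)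
    (f f1 f2 : R -> R) : Prop := {
  di_self_map : set_fun `[0, 1] `[0, 1] f;
  di_fix0 : f 0 = 0;
  di_fix1 : f 1 = 1;
  di_neutral0 : has_deriv_within `[0, 1] f 0 1;
  di_neutral1 : has_deriv_within `[0, 1] f 1 1;
  di_diffeo1 : C2_diffeo `]0, c[ `]0, 1[ f;
  di_diffeo2 : C2_diffeo `]c, 1[ `]0, 1[ f;
  di_ext1 : C2_extension `]0, c[ `[0, c] f f1;
  di_ext2 : C2_extension `]c, 1[ `[c, 1] f f2;
  di_image1 : f1 @` `[0, c] = `[0, 1]%classic;
  di_image2 : f2 @` `[c, 1] = `[0, 1]%classic;
  di_expanding : forall x, 0 < x < 1 -> x != c -> 1 < derive1 f x;
  di_expanding_c1 : 1 < deriv_within `[0, c] f1 c;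
  di_expanding_c2 : 1 < deriv_within `[c, 1] f2 c;
  di_convex0 : exists2 e : R, 0 < e &
    convex_function (`[0, e[%classic : set R^o) f;
  di_concave1 : exists2 e : R, 0 < e &
    convex_function (`]1 - e, 1]%classic : set R^o) (\- f);
  di_asymp0 :
    (f x - x) / (b1 * x `^ (1 + alpha^-1)) @[x --> 0^'+] --> (1 : R);
  di_asymp1 :
    (x - f x) / (b2 * (1 - x) `^ (1 + alpha^-1)) @[x --> 1^'-] --> (1 : R)
}.

(* A measure on [0,1] is represented by a Borel measure on R that is null
   outside [0,1]. The values of the density h at 0 and 1 play no role. *)
Record acim_with_density (R : realType) (f : R -> R)
    (mu : {measure set (measurableTypeR R) -> \bar R}) (h : R -> R) : Prop := {
  acim_support : mu (~` `[0, 1]) = 0%E;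
  acim_sigma_finite : sigma_finite setT mu;
  acim_invariant : forall A : set (measurableTypeR R),
    measurable A -> A `<=` `[0, 1] -> mu (`[0, 1] `&` f @^-1` A) = mu A;
  acim_abs_continuous : mu `<< @lebesgue_measure R;
  acim_density : forall A : set (measurableTypeR R),
    measurable A -> A `<=` `[0, 1] ->
    mu A = (\int[@lebesgue_measure R]_(x in A) (h x)%:E)%E;
  acim_continuous : {in `]0, 1[, continuous h};
  acim_positive : forall x, 0 < x < 1 -> 0 < h x
}.

Section Constants.
Context {R : realType}.
Variables (alpha b1 b2 : R) (h g1 g2 : R -> R).

Definition const1 : R :=
  b1 `^ (- alpha) * alpha `^ alpha * h (g2 0) * deriv_within `[0, 1] g2 0.

Definition const2 : R :=
  b2 `^ (- alpha) * alpha `^ alpha * h (g1 1) * deriv_within `[0, 1] g1 1.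

Definition pbar : R := const1 / (const1 + const2).

End Constants.

(* A set function for arbitrary real p; a (probability) measure when
   0 <= p <= 1, which is the case for p = pbar. *)
Definition two_point (R : realType) (p : R) (A : set (measurableTypeR R)) :
    \bar R :=
  (p%:E * \d_(0%R : R) A + (1 - p)%:E * \d_(1%R : R) A)%E.

(* Main.v *)
Require Import Defs.
From HB Require Import structures.
From mathcomp Require Import all_boot all_order all_algebra.
From mathcomp Require Import all_classical all_reals all_analysis.
From mathcomp Require Import measurable_realfun.
From mathcomp Require Import ring lra zify.

Set Implicit Arguments.
Unset Strict Implicit.
Unset Printing Implicit Defensive.

Import Order.TTheory GRing.Theory Num.Theory.
Import numFieldNormedType.Exports.

Local Open Scope classical_set_scope.
Local Open Scope ring_scope.

(** Both limits say that the measures psi dLeb and psi dmu, pushed forward by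
    [f], lose all their mass to the two neutral fixed points, a proportion
    [pbar] of it ending at 0. As [phi] is bounded and continuous at 0 and 1, it
    suffices to show that the distribution function of the pushed measure tends,
    at each point of ]0, 1[, to [pbar] times the total mass. A point [x] other
    than the cut satisfies [f x <= t] exactly when it lies in
    [[0, g1 t]] or in [[c, g2 t]], so that distribution functions evolve by
    [push c g1 g2], and densities by [transfer]. Pushing forward is a contraction
    of L^1, so it is enough to treat a dense class of densities. The argument
    is elementary renewal theory.

    Regeneration. There is a weight [K], bounded on compact subsets of ]0, 1[
    but unbounded near the neutral points, such that the densities [p] with
    [|p'| <= K p] are preserved by [transfer], even after a fixed proportion of
    their value at the cut is subtracted ([exists_weight],
    [exists_regular_step]). By iteration, such a density is a superposition of
    uniform densities started at successive times, plus a residual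
    ([mass_decomposition]). The residual vanishes in the limit: its mass
    returns to the cut less and less, and what stays near a neutral point has
    entered there at one of the previous times ([residual_mass_cvg0]). So only
    the iterates [V n] of the uniform distribution matter, and they satisfy a
    renewal equation themselves.

    Renewal. The increments [V n.+1 t - V n t] tend to 0
    ([renewal_increment_cvg0]). The mass on the left of the cut at time [n] is
    the sum, over the times of the last entry from the right, of the mass
    carried by [[c, g2 x_j]], where the [x_j] are the iterates of the cut under
    [g1]; this mass is close to [u_(n-j-1) (g2 x_j - c)], where [u_n] is the
    density at the cut. Near 0 the asymptotics of [f] give [x_j] of order
    [j^(- alpha)] ([neutral_orbit_asymptotics]), whose sum diverges because
    [alpha <= 1]: a slowly varying [u] whose convolution with it stays bounded
    must vanish ([density_at_cut_cvg0]). This is where the infinite mass of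
    [mu] is felt. The same formula on the right of the cut involves the gaps
    [c - g1 y_j], where the [y_j] are the iterates of the cut under [g2]. Since
    the ratio of the left gap to the right gap tends to a
    number [rho], the ratio of the two masses does too, and the mass on the
    left tends to [rho / (1 + rho)] ([uniform_mass_at_cut_cvg]).

    Constant. As [x_j] is equivalent to [(b1 / alpha)^(- alpha) j^(- alpha)]
    and [g2 x_j - c] to [g2'(0) x_j], and symmetrically on the right, [rho] is
    the quotient of the two constants entering [pbar]; the factor [h c] is
    common to both and cancels ([iterated_push_cvg]).

    Conclusion. Difference quotients of primitives of continuous functions
    are smooth and dense in L^1, which gives the limit of distribution
    functions for all integrable [psi] ([integrable_cdf_cvg]); then [phi] is
    compared with a combination of two step functions ([observable_cvg]). The
    second limit is the first one for the density [psi h]. *)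

(** * Real sequences and a renewal equation *)

Section RealSequences.
Context {R : realType}.

Lemma cvg_sum_nat0 (u : nat -> R^nat) (J : nat) :
  (forall j, u j @ \oo --> 0) -> \sum_(0 <= j < J) u j n @[n --> \oo] --> 0.
Proof.
move=> u0; elim: J => [|J IH].
  rewrite (_ : (fun n => _) = fun=> 0); first exact: cvg_cst.
  by apply/funext => n; rewrite big_geq.
rewrite (_ : (fun n => _) = fun n => \sum_(0 <= j < J) u j n + u J n); last first.
  by apply/funext => n; rewrite big_nat_recr.
rewrite -[X in _ --> X]addr0; apply: cvgD; [exact: IH|exact: u0].
Qed.

(** The terms with small [j] die with the weights, the others with [e]; the
    bounded total weight keeps both effects uniform. *)
Lemma toeplitz (w : nat -> nat -> R) (e : R^nat) (C : R) :
  (forall n j, 0 <= w n j) ->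
  (forall n, \sum_(0 <= j < n) w n j <= C) ->
  (forall j, w n j @[n --> \oo] --> 0) ->
  e @ \oo --> 0 ->
  \sum_(0 <= j < n) w n j * e j @[n --> \oo] --> 0.
Proof.
move=> w0 wC wj e0.
have C0 : 0 <= C by apply: le_trans (wC 0%N); rewrite big_geq.
apply/cvgr0Pnorm_le => eps eps0.
have d0 : 0 < eps / 2 / (C + 1) by rewrite !divr_gt0// ltr_wpDl.
have [J _ HJ] : \forall j \near \oo, `|e j| <= eps / 2 / (C + 1).
  by move/cvgr0Pnorm_le : e0; apply.
have head0 : \sum_(0 <= j < J) w n j * `|e j| @[n --> \oo] --> 0.
  apply: cvg_sum_nat0 => j.
  by rewrite -[0](mul0r `|e j|); apply: cvgMl; exact: wj.
near=> n.
have Jn : (J <= n)%N by near: n; exists J.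
rewrite (big_cat_nat (leq0n J) Jn)//= (le_trans (ler_normD _ _))//.
rewrite [leRHS]splitr lerD//.
  rewrite (le_trans (ler_norm_sum _ _ _))//.
  under eq_bigr do rewrite normrM ger0_norm//.
  rewrite (le_trans (ler_norm _))//.
  near: n; move/cvgr0Pnorm_le : head0; apply; exact: divr_gt0.
rewrite (le_trans (ler_norm_sum _ _ _))//.
apply: (@le_trans _ _ (\sum_(J <= j < n) w n j * (eps / 2 / (C + 1)))).
  apply: ler_sum_nat => j /andP[Jj _].
  rewrite normrM ger0_norm// ler_wpM2l//.
  by apply: HJ.
rewrite -mulr_suml.
have : \sum_(J <= j < n) w n j <= C.
  apply: le_trans (wC n); rewrite [leRHS](big_cat_nat (leq0n J) Jn)//= lerDr.
  by apply: sumr_ge0.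
move=> /(ler_wpM2r (ltW d0))/le_trans; apply.
rewrite mulrCA ler_piMr//; first by rewrite divr_ge0// ltW.
by rewrite ler_pdivrMr ?mul1r ?lerDl// ltr_wpDl.
Unshelve. all: by end_near. Qed.

Lemma bounded_series_cvg0 (a : R^nat) (C : R) :
  (forall n, 0 <= a n) -> (forall n, \sum_(0 <= k < n) a k <= C) ->
  a @ \oo --> 0.
Proof.
move=> a0 aC; apply: cvg_series_cvg_0.
apply: nondecreasing_is_cvgn.
  by apply/nondecreasing_seqP => n; rewrite /series /= big_nat_recr//= lerDl.
by exists C => _ [n _ <-]; exact: aC.
Qed.

Lemma convolution_cvg0 (a b : R^nat) (C : R) :
  (forall n, 0 <= a n) -> (forall n, \sum_(0 <= k < n) a k <= C) ->
  b @ \oo --> 0 ->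
  \sum_(0 <= j < n) a (n - j.+1)%N * b j @[n --> \oo] --> 0.
Proof.
move=> a0 aC b0.
apply: (@toeplitz (fun n j => a (n - j.+1)%N) b C) => //.
- by move=> n; rewrite big_nat_rev/= add0n (le_trans _ (aC n))//;
    apply: ler_sum_nat => i /andP[_ ni]; rewrite subnSK ?subKn// ltnW.
- move=> j; have /cvgrPdist_le a_0 := bounded_series_cvg0 a0 aC.
  apply/cvgrPdist_le => e /a_0[N _ HN]; exists (N + j.+1)%N => // n /= Nn.
  apply: HN => /=; lia.
Qed.

(** The increments [d] of [v] satisfy the renewal equation of [v] up to a null
    sequence. Were their upper limit [D] positive, a near-maximal increment
    would force the preceding one to be near-maximal, as it enters with weight
    [q 0 > 0]; a long run of increments of size about [D] contradicts the
    boundedness of [v]. *)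
Lemma renewal_increment_lt (q v r : R^nat) :
  (forall k, 0 <= q k) -> 0 < q 0%N ->
  (forall n, \sum_(0 <= k < n) q k <= 1) ->
  (forall n, `|v n| <= 1) ->
  (forall n, v n = \sum_(0 <= k < n) q k * v (n - k.+1)%N + r n) ->
  r @ \oo --> 0 ->
  forall e, 0 < e -> \forall n \near \oo, v n.+1 - v n < e.
Proof.
move=> q_ge0 q0 q1 v1 vE r0.
pose d n := v n.+1 - v n.
have d2 n : `|d n| <= 2.
  by rewrite /d (le_trans (ler_normB _ _))// (le_trans (lerD (v1 _) (v1 _))).
pose s n := q n * v 0%N + (r n.+1 - r n).
have s0 : s @ \oo --> 0.
  have qn0 := bounded_series_cvg0 q_ge0 q1.
  have -> : (0 : R) = 0 * v 0%N + (0 - 0) by rewrite mul0r subr0 addr0.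
  apply: cvgD; first exact: cvgMl.
  by apply: cvgB => //; rewrite (cvg_shiftS r).
have dE n : d n = \sum_(0 <= k < n) q k * d (n - k.+1)%N + s n.
  rewrite /d {1}vE {1}(vE n) big_nat_recr//= subnn /s.
  rewrite [RHS]addrC.
  have -> : \sum_(0 <= k < n) q k * (v (n - k.+1).+1 - v (n - k.+1)%N) =
    \sum_(0 <= k < n) q k * v (n.+1 - k.+1)%N -
    \sum_(0 <= k < n) q k * v (n - k.+1)%N.
    rewrite -sumrB; apply: eq_big_nat => k /andP[_ kn].
    by rewrite mulrBr subnSK// subSS.
  ring.
pose S := [set x : R | exists N, forall n, (N <= n)%N -> d n <= x].
have S2 : S 2 by exists 0%N => n _; rewrite (le_trans (ler_norm _)).
have lbS : lbound S (-2).
  move=> x [N /(_ _ (leqnn N))]; apply: le_trans.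
  by have := d2 N; rewrite ler_norml => /andP[].
have hiS : has_inf S by split; [exists 2 | exists (-2)].
pose D := inf S.
have upper eta : 0 < eta -> exists N, forall n, (N <= n)%N -> d n <= D + eta.
  move=> eta0; have [x [N HN] xD] := inf_adherent eta0 hiS.
  by exists N => n /HN /le_trans; apply; exact: ltW.
have lower eta N : 0 < eta -> exists2 n, (N <= n)%N & D - eta < d n.
  move=> eta0; apply: contrapT => H.
  have : S (D - eta).
    exists N => n Nn; rewrite leNgt; apply/negP => dn; apply: H.
    by exists n.
  by move=> /(ge_inf (ex_intro _ _ lbS)); rewrite -/D; lra.
suff D0 : D <= 0.
  move=> e e0; have [N HN] := upper (e / 2) ltac:(by rewrite divr_gt0).
  by exists N => // n /= /HN; rewrite -/(d n); lra.
rewrite leNgt; apply/negP => D0.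
(* With [q 0 * eps = 4 * eta], the bound [d <= D + eta] on the other terms
   leaves no room for [d n <= D - eps] once [d n.+1 > D - eta]. *)
have back eps : 0 < eps -> exists2 eta, 0 < eta &
    exists N, forall n, (N <= n)%N -> D - eta < d n.+1 -> D - eps < d n.
  move=> eps0; pose eta := q 0%N * eps / 4.
  have eta0 : 0 < eta by rewrite /eta !mulr_gt0.
  exists eta => //.
  have [M HM] := upper eta eta0.
  have s_small : \forall n \near \oo, `|s n.+1| <= eta / 2.
    have /cvgr0Pnorm_le : s n.+1 @[n --> \oo] --> 0 by rewrite (cvg_shiftS s).
    by apply; exact: divr_gt0.
  have [M' _ HM'] := s_small.
  have q_small : \sum_(0 <= j < M) q (n - j)%N @[n --> \oo] --> 0.
    apply: (@cvg_sum_nat0 (fun j n => q (n - j)%N)) => j.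
    have /cvgrPdist_le qn0 := bounded_series_cvg0 q_ge0 q1.
    apply/cvgrPdist_le => e /qn0[N _ HN]; exists (N + j)%N => // n /= Nn.
    apply: HN => /=; lia.
  have [M'' _ HM''] : \forall n \near \oo,
      `|\sum_(0 <= j < M) q (n - j)%N| <= eta / 6.
    by move/cvgr0Pnorm_le : q_small; apply; exact: divr_gt0.
  exists (M + M' + M'').+1 => n nN; rewrite dE.
  rewrite big_ltn//= subSS subn0.
  have sn : s n.+1 <= eta / 2.
    by rewrite (le_trans (ler_norm _))// HM'//=; lia.
  have : \sum_(1 <= k < n.+1) q k * d (n.+1 - k.+1)%N <=
      (1 - q 0%N) * (D + eta) + 3 * (eta / 6).
    have Mn : (1 <= n.+1 - M)%N by lia.
    have Mn' : (n.+1 - M <= n.+1)%N by lia.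
    rewrite (big_cat_nat Mn Mn')//=; apply: lerD.
      apply: (@le_trans _ _ (\sum_(1 <= k < n.+1 - M) q k * (D + eta))).
        apply: ler_sum_nat => k /andP[k1 kn].
        by rewrite ler_wpM2l// HM//; lia.
      rewrite -mulr_suml ler_wpM2r//; first by rewrite addr_ge0// ltW.
      rewrite lerBrDl.
      have := q1 (n.+1 - M)%N; rewrite (@big_ltn _ _ _ 0)//; lia.
    apply: (@le_trans _ _ (\sum_(n.+1 - M <= k < n.+1) q k * 2)).
      apply: ler_sum_nat => k /andP[k1 kn].
      by rewrite ler_wpM2l// (le_trans (ler_norm _)).
    rewrite -mulr_suml mulrC.
    have -> : \sum_(n.+1 - M <= k < n.+1) q k = \sum_(0 <= j < M) q (n - j)%N.
      rewrite -{1}[(n.+1 - M)%N]add0n big_addn subKn//; last lia.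
      rewrite big_nat_rev/= add0n; apply: eq_big_nat => j /andP[_ jM].
      congr q; lia.
    have := HM'' n; rewrite /= => /(_ ltac:(lia)).
    by move=> /(le_trans (ler_norm _)); lra.
  move=> H1 H2.
  have H3 : q 0%N * d n > q 0%N * (D - eps).
    have : q 0%N * eps = 4 * eta by rewrite /eta; field.
    have : 0 <= q 0%N * eta by rewrite mulr_ge0// ltW.
    by move: H1 H2 sn; clearbody eta; lra.
  by rewrite ltr_pM2l in H3.
have backs K : forall eps, 0 < eps -> exists2 eta, 0 < eta &
    exists N, forall n, (N <= n)%N -> D - eta < d (n + K)%N ->
      forall i, (i <= K)%N -> D - eps < d (n + i)%N.
  elim: K => [|K IH] eps eps0.
    exists eps => //; exists 0%N => n _; rewrite addn0 => dn i.
    by rewrite leqn0 => /eqP ->; rewrite addn0.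
  have [eta1 eta10 [N1 H1]] := IH eps eps0.
  have [eta2 eta20 [N2 H2]] := back eta1 eta10.
  exists (Num.min eta2 eps); first by rewrite lt_min eta20.
  exists (N1 + N2)%N => n nN dn i; rewrite leq_eqVlt => /predU1P[->|iK].
    by apply: le_lt_trans dn; rewrite lerB// ge_min lexx orbT.
  apply: H1 => //; first lia.
  apply: H2; first lia.
  by rewrite -addnS; apply: le_lt_trans dn; rewrite lerB// ge_min lexx.
(* [K] increments above [D / 2] add up to more than 2, the width of the range of [v]. *)
pose K := (Num.trunc (4 / D)).+1.
have KD : 4 < D * K%:R.
  by rewrite mulrC -ltr_pdivrMr// truncnS_gt.
have [eta eta0 [N HN]] := backs K (D / 2) ltac:(by rewrite divr_gt0).
have [n nNK dn] := lower eta (N + K)%N eta0.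
have nE : (n = (n - K) + K)%N by lia.
rewrite nE in dn.
have {}HN := HN (n - K)%N ltac:(lia) dn.
have : v (n - K + K)%N - v (n - K)%N = \sum_(0 <= i < K) d (n - K + i)%N.
  rewrite (telescope_sumr_eq (fun i => v (n - K + i)%N))// ?addn0//.
  by move=> i _; rewrite /d addnS.
have : \sum_(0 <= i < K) d (n - K + i)%N >= \sum_(0 <= i < K) (D / 2).
  apply: ler_sum_nat => i /andP[_ iK]; have := HN i (ltnW iK); lra.
rewrite sumr_const_nat subn0 -mulr_natr.
have := v1 (n - K + K)%N; have := v1 (n - K)%N.
rewrite !ler_norml => /andP[? ?] /andP[? ?] ? ?.
lra.
Qed.

(** The hypotheses are invariant under [v |-> - v], so the one-sided bound
    gives the two-sided one. *)
Lemma renewal_increment_cvg0 (q v r : R^nat) :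
  (forall k, 0 <= q k) -> 0 < q 0%N ->
  (forall n, \sum_(0 <= k < n) q k <= 1) ->
  (forall n, `|v n| <= 1) ->
  (forall n, v n = \sum_(0 <= k < n) q k * v (n - k.+1)%N + r n) ->
  r @ \oo --> 0 ->
  v n.+1 - v n @[n --> \oo] --> 0.
Proof.
move=> q_ge0 q0 q1 v1 vE r0.
apply/cvgr0Pnorm_lt => e e0.
have H1 := renewal_increment_lt q_ge0 q0 q1 v1 vE r0 e0.
have H2 : \forall n \near \oo, (- v n.+1) - (- v n) < e.
  apply: (@renewal_increment_lt q (fun n => - v n) (fun n => - r n)) => //.
  - by move=> n; rewrite normrN.
  - move=> n; rewrite {1}vE opprD; congr (_ + _); rewrite -sumrN.
    by apply: eq_bigr => k _; rewrite mulrN.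
  - by rewrite -[0]oppr0; exact: cvgN.
near=> n.
rewrite ltr_norml; apply/andP; split; last by near: n.
suff : - v n.+1 - - v n < e by lra.
by near: n.
Unshelve. all: by end_near. Qed.

End RealSequences.

(** * Continuity and mean values on the unit interval *)

Section WithinContinuity.
Context {R : realType}.
Implicit Types (A B : set R) (f g : R -> R).

Lemma within_continuousP A f :
  {within A, continuous f} <->
  forall x, A x -> forall e : R, 0 < e -> exists2 d : R, 0 < d &
    forall y, A y -> `|y - x| < d -> `|f y - f x| < e.
Proof.
rewrite subspace_continuousP; split => H x Ax.
  move=> e e0; have /cvgrPdist_lt/(_ _ e0) := H x Ax.
  rewrite near_withinE => -[d /= d0 Hd]; exists d => // y Ay xy.
  by rewrite distrC; apply: Hd => //=; rewrite distrC.
apply/cvgrPdist_lt => e e0; have [d d0 Hd] := H x Ax e e0.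
rewrite near_withinE; exists d => // y /= xy Ay.
by rewrite distrC; apply: Hd => //; rewrite distrC.
Qed.

Lemma within_continuous_comp A B f g :
  (forall x, A x -> B (g x)) ->
  {within A, continuous g} -> {within B, continuous f} ->
  {within A, continuous (f \o g)}.
Proof.
move=> AB /within_continuousP cg /within_continuousP cf.
apply/within_continuousP => x Ax e e0.
have [d d0 Hd] := cf _ (AB _ Ax) e e0.
have [d' d'0 Hd'] := cg _ Ax d d0.
by exists d' => // y Ay /(Hd' _ Ay); apply: Hd; exact: AB.
Qed.

Lemma mvt01 f df (x y : R) : {within `[0, 1], continuous f} ->
  (forall z : R, 0 < z < 1 -> is_derive z 1 f (df z)) ->
  0 <= x -> x < y -> y <= 1 ->
  exists2 z : R, x < z < y & f y - f x = df z * (y - x).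
Proof.
move=> cf dff x0 xy y1.
have [||z] := @MVT R f df x y xy.
- move=> z; rewrite in_itv/= => /andP[xz zy].
  by apply: dff; rewrite (le_lt_trans x0)//= (lt_le_trans zy).
- apply: continuous_subspaceW cf => z /=; rewrite !in_itv/= => /andP[xz zy].
  by rewrite (le_trans x0)//= (le_trans zy).
- by rewrite in_itv/= => ? ->; exists z.
Qed.

End WithinContinuity.

(** * The inverse branch at a neutral fixed point *)

Section NeutralBranch.
Context {R : realType}.

(** The inverse branch that fixes the neutral point 0. [D] bounds its
    distortion, [gam] its contraction from below; [nb_contr] is contraction
    away from 0, uniform on every [[e, 1[], and [nb_conc] is concavity near 0,
    the counterpart of the convexity of the map. *)
Record neutral_branch (c D gam : R) (g dg ddg : R -> R) : Prop := {
  nb_c : 0 < c < 1;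
  nb_D : 0 <= D;
  nb_0 : g 0 = 0;
  nb_1 : g 1 = c;
  nb_cont : {within `[0, 1], continuous g};
  nb_der : forall x : R, 0 < x < 1 -> is_derive x 1 g (dg x);
  nb_der2 : forall x : R, 0 < x < 1 -> is_derive x 1 dg (ddg x);
  nb_dist : forall x : R, 0 < x < 1 -> `|ddg x| <= D * dg x;
  nb_gam : 0 < gam;
  nb_dgam : forall x : R, 0 < x < 1 -> gam <= dg x;
  nb_contr : forall e : R, 0 < e -> exists2 l : R, 0 <= l < 1 &
    forall x : R, e <= x < 1 -> dg x <= l;
  nb_conc : exists2 e : R, 0 < e &
    forall x y : R, 0 < x -> x <= y -> y < e -> y < 1 -> dg y <= dg x }.

Variables (c D gam : R) (g dg ddg : R -> R).
Hypothesis nb : neutral_branch c D gam g dg ddg.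

Lemma nb_dg_gt0 (x : R) : 0 < x < 1 -> 0 < dg x.
Proof. by move=> x01; rewrite (lt_le_trans (nb_gam nb))// (nb_dgam nb). Qed.

Lemma nb_dg_lt1 (x : R) : 0 < x < 1 -> dg x < 1.
Proof.
move=> /andP[x0 x1]; have [l /andP[_ l1] H] := nb_contr nb x0.
by rewrite (le_lt_trans _ l1)// H// lexx.
Qed.

Lemma nb_mvt (x y : R) : 0 <= x -> x < y -> y <= 1 ->
  exists2 z : R, x < z < y & g y - g x = dg z * (y - x).
Proof. exact: (mvt01 (nb_cont nb) (nb_der nb)). Qed.

Lemma nb_incr (x y : R) : 0 <= x -> x < y -> y <= 1 -> g x < g y.
Proof.
move=> x0 xy y1; have [z /andP[xz zy] E] := nb_mvt x0 xy y1.
rewrite -subr_gt0 E mulr_gt0 ?subr_gt0//; apply: nb_dg_gt0.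
by rewrite (le_lt_trans x0)//= (lt_le_trans zy).
Qed.

Lemma nb_gt0 (x : R) : 0 < x -> x <= 1 -> 0 < g x.
Proof. by move=> x0 x1; rewrite -{1}(nb_0 nb) nb_incr. Qed.

Lemma nb_lec (x : R) : 0 <= x -> x <= 1 -> g x <= c.
Proof.
move=> x0; rewrite le_eqVlt => /predU1P[->|x1]; first by rewrite (nb_1 nb).
by rewrite -(nb_1 nb) ltW// nb_incr.
Qed.

Lemma nb_gap_le (x y : R) : 0 <= x -> x <= y -> y <= 1 -> x - g x <= y - g y.
Proof.
move=> x0; rewrite le_eqVlt => /predU1P[->//|xy] y1.
have [z /andP[xz zy] E] := nb_mvt x0 xy y1.
have z01 : 0 < z < 1 by rewrite (le_lt_trans x0)//= (lt_le_trans zy).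
have : dg z * (y - x) <= 1 * (y - x).
  by rewrite ler_wpM2r ?subr_ge0 ?ltW// nb_dg_lt1.
rewrite -E; lra.
Qed.

Lemma nb_gap_gt0 (x : R) : 0 < x -> x <= 1 -> 0 < x - g x.
Proof.
move=> x0 x1; have [z /andP[xz zy] E] := nb_mvt (lexx 0) x0 x1.
have z01 : 0 < z < 1 by rewrite xz/= (lt_le_trans zy).
have : dg z * (x - 0) < 1 * (x - 0) by rewrite ltr_pM2r ?subr0// nb_dg_lt1.
rewrite -E (nb_0 nb); lra.
Qed.

Lemma nb_gx01 (x : R) : 0 < x <= 1 -> 0 < g x < 1.
Proof.
move=> /andP[x0 x1]; rewrite nb_gt0//= (le_lt_trans (nb_lec (ltW x0) x1))//.
by have /andP[] := nb_c nb.
Qed.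

(** One application of [g] decreases [x / (x - g x)] by at least 1, when its
    value at [g x] is discounted by the derivative. By concavity, the next gap
    [g x - g (g x)] is at least [dg x] times the gap [x - g x]. *)
Lemma nb_gap_step : exists2 e : R, 0 < e & forall x : R, 0 < x -> x < e -> x < 1 ->
  dg x * (g x / (g x - g (g x))) <= x / (x - g x) - 1.
Proof.
have [e e0 He] := nb_conc nb; exists e => // x x0 xe x1.
have gx0 := nb_gt0 x0 (ltW x1).
have w0 := nb_gap_gt0 x0 (ltW x1).
have gxx : g x < x by rewrite -subr_gt0.
have [z /andP[gxz zx] E] := nb_mvt (ltW gx0) gxx (ltW x1).
have z01 : 0 < z < 1 by rewrite (lt_trans gx0)//= (lt_trans zx).
have dz := nb_dg_gt0 z01.
have dxz : dg x <= dg z by apply: He => //; [lra|exact: ltW].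
have -> : x / (x - g x) - 1 = g x / (x - g x).
  by field; rewrite gt_eqF.
rewrite E mulrA ler_pdivrMr ?mulr_gt0//.
have -> : g x / (x - g x) * (dg z * (x - g x)) = dg z * g x.
  by field; rewrite gt_eqF.
by rewrite ler_wpM2r// ltW.
Qed.

(** For a power law, [x / (x - g x)] is of the order of the number of steps
    that the map needs to leave the neighbourhood of 0 from [x]; the distortion
    accumulated meanwhile is at most [D] per step. *)
Definition side_weight (d x : R) : R := if x < d then D * (x / (x - g x)) else 0.

Lemma side_weight_ge0 (d x : R) : 0 < x -> x <= 1 -> 0 <= side_weight d x.
Proof.
move=> x0 x1; rewrite /side_weight; case: ifP => // _.
by rewrite mulr_ge0 ?(nb_D nb)// divr_ge0 ?ltW ?nb_gap_gt0.
Qed.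

Lemma side_weight_bounded (d a x : R) : 0 < a -> a <= x -> x <= 1 ->
  side_weight d x <= D / (a - g a).
Proof.
move=> a0 ax x1; have w0 := nb_gap_gt0 a0 (le_trans ax x1).
rewrite /side_weight; case: ifP => _; last first.
  by rewrite divr_ge0 ?(nb_D nb)// ltW.
rewrite ler_wpM2l ?(nb_D nb)//.
have ww : a - g a <= x - g x by apply: nb_gap_le => //; exact: ltW.
have wx := lt_le_trans w0 ww.
rewrite ler_pdivrMr// ler_pdivlMl// (le_trans _ ww)//.
by rewrite ler_piMr// ltW.
Qed.

(** The weight [M + side_weight d] absorbs the distortion [D] of one step. In
    the neutral zone [x < d] the gain of 1 of [nb_gap_step] pays exactly for it;
    outside, the branch contracts by a factor [l < 1], and a large [M] makes the
    loss [(1 - l) * M] exceed everything else, with a margin that is kept as the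
    factor [t < 1]. *)
Lemma branch_weight : exists2 e : R, 0 < e & forall d : R, 0 < d -> d <= e -> d < 1 ->
  exists2 t : R, 0 <= t < 1 & exists2 M0 : R, 0 <= M0 &
  forall M x : R, M0 <= M -> 0 < x < 1 ->
    (M + side_weight d (g x)) * dg x + D <=
    (if x < d then 1 else t) * (M + side_weight d x).
Proof.
have [e e0 He] := nb_gap_step; exists e => // d d0 de d1.
have [l /andP[l0 l1] Hl] := nb_contr nb d0.
exists ((1 + l) / 2); first by apply/andP; split; lra.
have gd := nb_gx01 (introT andP (conj d0 (ltW d1))).
have /andP[gd0 gd1] := gd.
pose B := D / (g d - g (g d)).
have B0 : 0 <= B by rewrite divr_ge0 ?(nb_D nb)// ltW// nb_gap_gt0// ltW.
(* Half of the loss [(1 - l) * M] pays for [B + D], the other half gives [t]. *)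
exists (2 * (B + D) / (1 - l)).
  apply: divr_ge0; last lra.
  by apply: mulr_ge0 => //; apply: addr_ge0 => //; exact: (nb_D nb).
move=> M x MM /andP[x0 x1].
have x01 : 0 < x < 1 by rewrite x0.
have M0 : 0 <= M.
  apply: le_trans MM; apply: divr_ge0; last lra.
  by apply: mulr_ge0 => //; apply: addr_ge0 => //; exact: (nb_D nb).
have dg1 := nb_dg_lt1 x01; have dg0 := nb_dg_gt0 x01.
have /andP[gx0 gx1] : 0 < g x < 1 by apply: nb_gx01; rewrite x0 ltW.
case: ltP => [xd|dx].
  have gxd : g x < d.
    by apply: lt_trans xd; rewrite -subr_gt0 nb_gap_gt0// ltW.
  rewrite /side_weight xd gxd mul1r.
  have := He x x0 (lt_le_trans xd de) x1.
  move=> /(ler_wpM2l (nb_D nb)).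
  have : M * dg x <= M by rewrite ler_piMr// ltW.
  set a := g x / _; set b := x / _ => H1 H2.
  have -> : (M + D * a) * dg x = M * dg x + D * (dg x * a) by ring.
  lra.
rewrite [side_weight d x]/side_weight ltNge dx/= addr0.
have sB : side_weight d (g x) <= B.
  apply: side_weight_bounded => //; last exact: ltW.
  move: dx; rewrite le_eqVlt => /predU1P[->//|dx].
  by apply/ltW/nb_incr => //; exact: ltW.
have dgl : dg x <= l by apply: Hl; rewrite dx.
have s0 : 0 <= side_weight d (g x) by apply: side_weight_ge0 => //; exact: ltW.
have H1 : (M + side_weight d (g x)) * dg x <= (M + B) * l.
  by apply: ler_pM => //; [exact: addr_ge0|exact: ltW|exact: lerD].
have H2 : 2 * (B + D) <= M * (1 - l).
  by rewrite -ler_pdivrMr// subr_gt0.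
have H3 : B * l <= B by rewrite ler_piMr// ltW.
have DD := nb_D nb.
lra.
Qed.

End NeutralBranch.

Section Reflection.
Context {R : realType}.

(** Conjugation by [x |-> 1 - x] exchanges the two fixed points, so that
    everything proved at 0 applies at 1. *)
Definition reflect01 (g : R -> R) (x : R) : R := 1 - g (1 - x).

Lemma reflect01K : involutive reflect01.
Proof. by move=> g; apply/funext => x; rewrite /reflect01 !subKr. Qed.

Lemma is_derive_comp_onem (f : R -> R) (x l : R) :
  is_derive (1 - x) 1 f l -> is_derive x 1 (fun y => f (1 - y)) (- l).
Proof.
move=> H.
have H1 : is_derive x 1 (fun y : R => 1 - y) (-1).
  rewrite -[-1]sub0r.
  exact: (is_deriveB (is_derive_cst (1 : R) x 1) (is_derive_id x 1)).
have := @is_derive1_comp _ f (fun y => 1 - y) x _ _ H H1.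
by rewrite mulrN1.
Qed.

Lemma is_derive_reflect01 (f : R -> R) (x l : R) :
  is_derive (1 - x) 1 f l -> is_derive x 1 (reflect01 f) l.
Proof.
move=> /is_derive_comp_onem H.
rewrite -[l]opprK -[- - l]sub0r.
exact: (is_deriveB (is_derive_cst (1 : R) x 1) H).
Qed.

Lemma within_continuous_reflect01 (f : R -> R) :
  {within `[0, 1], continuous f} -> {within `[0, 1], continuous (reflect01 f)}.
Proof.
move=> cf.
apply/within_continuousP => x x01 e e0.
have x01' : `[0, 1]%classic (1 - x) by move: x01; rewrite /= !in_itv/=; lra.
have [d d0 Hd] := (iffLR (within_continuousP _ _) cf) _ x01' e e0.
exists d => // y y01 yx.
have -> : reflect01 f y - reflect01 f x = - (f (1 - y) - f (1 - x)).
  by rewrite /reflect01; ring.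
rewrite normrN; apply: Hd; first by move: y01; rewrite /= !in_itv/=; lra.
by rewrite (_ : 1 - y - (1 - x) = - (y - x)) ?normrN//; ring.
Qed.

End Reflection.

(** * The transfer operator and its invariant cone of densities *)

Section TwoBranches.
Context {R : realType}.
Variables (c D gam : R) (g1 dg1 ddg1 g2 dg2 ddg2 : R -> R).

Record two_neutral_branches : Prop := {
  tb_left : neutral_branch c D gam g1 dg1 ddg1;
  tb_right : neutral_branch (1 - c) D gam (reflect01 g2)
    (fun x => dg2 (1 - x)) (fun x => - ddg2 (1 - x)) }.

Hypothesis tb : two_neutral_branches.

Let nb1 := tb_left tb.
Let nb2 := tb_right tb.

Lemma tb_g2E (x : R) : g2 x = 1 - reflect01 g2 (1 - x).
Proof. by rewrite /reflect01 !subKr. Qed.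

Lemma tb_c : 0 < c < 1. Proof. exact: nb_c nb1. Qed.

Lemma tb_g20 : g2 0 = c.
Proof. by rewrite tb_g2E subr0 (nb_1 nb2) subKr. Qed.

Lemma tb_g21 : g2 1 = 1.
Proof. by rewrite tb_g2E subrr (nb_0 nb2) subr0. Qed.

Lemma tb_g2_cont : {within `[0, 1], continuous g2}.
Proof. by rewrite -(reflect01K g2); apply/within_continuous_reflect01/(nb_cont nb2). Qed.

Lemma onem01 (x : R) : 0 < x < 1 -> 0 < 1 - x < 1.
Proof. by lra. Qed.

Lemma tb_g2_der (x : R) : 0 < x < 1 -> is_derive x 1 g2 (dg2 x).
Proof.
move=> /onem01/(nb_der nb2); rewrite subKr => /is_derive_reflect01.
by rewrite reflect01K.
Qed.

Lemma tb_g2_der2 (x : R) : 0 < x < 1 -> is_derive x 1 dg2 (ddg2 x).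
Proof.
move=> /onem01/(nb_der2 nb2); rewrite subKr => /is_derive_comp_onem.
rewrite opprK; under [X in is_derive _ _ X _]eq_fun do rewrite subKr.
by [].
Qed.

Lemma tb_g2_incr (x y : R) : 0 <= x -> x < y -> y <= 1 -> g2 x < g2 y.
Proof.
move=> x0 xy y1; rewrite !tb_g2E ltrD2l ltrN2.
by apply: (nb_incr nb2); lra.
Qed.

Lemma tb_g2_ge (x : R) : 0 <= x -> x <= 1 -> c <= g2 x.
Proof.
move=> x0 x1; rewrite tb_g2E.
have := @nb_lec _ _ _ _ _ _ _ nb2 (1 - x); lra.
Qed.

Lemma tb_g2_01 (x : R) : 0 <= x < 1 -> 0 < g2 x < 1.
Proof.
move=> /andP[x0 x1]; rewrite tb_g2E.
have := @nb_gx01 _ _ _ _ _ _ _ nb2 (1 - x); lra.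
Qed.

Lemma tb_dg2_gam (x : R) : 0 < x < 1 -> gam <= dg2 x.
Proof. by move=> /onem01/(nb_dgam nb2); rewrite subKr. Qed.

Lemma tb_g2_dist (x : R) : 0 < x < 1 -> `|ddg2 x| <= D * dg2 x.
Proof. by move=> /onem01/(nb_dist nb2); rewrite subKr normrN. Qed.

(** The distribution function of the image by [f] of a measure with
    distribution function [F]: the preimage of [[0, t]] is the union of
    [[0, g1 t]] and [[c, g2 t]]. *)
Definition push (F : R -> R) (t : R) : R := F (g1 t) + F (g2 t) - F c.

Definition transfer (p : R -> R) (x : R) : R :=
  p (g1 x) * dg1 x + p (g2 x) * dg2 x.

(** The distribution functions whose density [p] has a logarithmic derivative
    bounded by [K]; a weight [K] that is unbounded near 0 and 1 allows their
    mass to concentrate there. *)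
Record regular (K F p dp : R -> R) : Prop := {
  rg_0 : F 0 = 0;
  rg_cont : {within `[0, 1], continuous F};
  rg_der : forall x : R, 0 < x < 1 -> is_derive x 1 F (p x);
  rg_der2 : forall x : R, 0 < x < 1 -> is_derive x 1 p (dp x);
  rg_ge0 : forall x : R, 0 < x < 1 -> 0 <= p x;
  rg_K : forall x : R, 0 < x < 1 -> `|dp x| <= K x * p x }.

(** Both [p * exp (B x)] and [p * exp (- B x)] are monotone on [[a, b]]. *)
Lemma regular_gronwall (K : R -> R) (a b B : R) : 0 < a -> b < 1 ->
  (forall x : R, a <= x <= b -> K x <= B) ->
  forall F p dp, regular K F p dp ->
  forall x y : R, a <= x <= b -> a <= y <= b ->
    p y <= expR (B * `|y - x|) * p x.
Proof.
move=> a0 b1 KB F p dp rg.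
have main (s x y : R) : a <= x -> x <= y -> y <= b -> (forall z : R, a <= z <= b ->
    0 <= s * (dp z + s * B * p z)) -> (s == 1) || (s == -1) ->
    s * (p x * expR (s * B * x)) <= s * (p y * expR (s * B * y)).
  move=> ax; rewrite le_eqVlt => /predU1P[->//|xy] yb Hs s1.
  have der (z : R) : a <= z <= b -> is_derive z 1 (fun u => p u * expR (s * B * u))
      ((dp z + s * B * p z) * expR (s * B * z)).
    move=> /andP[az zb].
    have Hp : is_derive z 1 p (dp z) by apply: (rg_der2 rg); lra.
    have He : is_derive z 1 (fun u : R => expR (s * B * u))
        (expR (s * B * z) * (s * B)).
      apply: is_derive1_comp.
      rewrite -[X in is_derive _ _ _ X]mulr1.
      exact: (is_deriveZ (s * B) (is_derive_id z 1)).
    have := is_deriveM Hp He.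
    rewrite /= => H; apply: is_derive_eq; rewrite /GRing.scale/=; ring.
  have [||z] := @MVT R (fun u => p u * expR (s * B * u))
      (fun z => (dp z + s * B * p z) * expR (s * B * z)) x y xy.
    by move=> z; rewrite in_itv/= => xzy; apply: der; lra.
    apply: derivable_within_continuous => z; rewrite in_itv/= => xzy.
    by have [] : is_derive z 1 _ _ := der z ltac:(lra).
  rewrite in_itv/= => /andP[xz zy] E.
  rewrite -subr_ge0 -mulrBr E !mulrA -[s * _ * _ * _]mulrA mulr_ge0//.
    by apply: Hs; lra.
  by rewrite mulr_ge0 ?expR_ge0//; lra.
have pB (z : R) : a <= z <= b -> `|dp z| <= B * p z.
  move=> zab; have z01 : 0 < z < 1 by lra.
  apply: le_trans (rg_K rg z01) _; rewrite ler_wpM2r ?KB//.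
  exact: (rg_ge0 rg).
move=> x y /andP[ax xb] /andP[ay yb].
have [xy|/ltW yx] := leP x y.
  have := main (-1) x y ax xy yb.
  rewrite eqxx orbT => /(_ _ isT); rewrite !mulN1r => H.
  have {}H : p y * expR (- (B * y)) <= p x * expR (- (B * x)).
    rewrite -lerN2 -!(mulNr B); apply: H => z zab.
    by have := pB z zab; rewrite ler_norml; lra.
  rewrite ger0_norm ?subr_ge0//.
  have -> : expR (B * (y - x)) * p x = expR (B * y) * (p x * expR (- (B * x))).
    by rewrite mulrBr expRD; ring.
  have -> : p y = expR (B * y) * (p y * expR (- (B * y))).
    by rewrite mulrCA expRxMexpNx_1 mulr1.
  by rewrite ler_wpM2l ?expR_ge0.
have := main 1 y x ay yx xb; rewrite eqxx => /(_ _ isT); rewrite !mul1r => H.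
have {}H : p y * expR (B * y) <= p x * expR (B * x).
  by apply: H => z zab; have := pB z zab; rewrite ler_norml; lra.
rewrite distrC ger0_norm ?subr_ge0//.
have -> : expR (B * (x - y)) * p x = expR (- (B * y)) * (p x * expR (B * x)).
  by rewrite mulrBr expRD; ring.
have -> : p y = expR (- (B * y)) * (p y * expR (B * y)).
  by rewrite mulrCA [X in _ * X]mulrC expRxMexpNx_1 mulr1.
by rewrite ler_wpM2l ?expR_ge0.
Qed.

(** The sum of the weights of the two ends. Each branch maps into a
    region where the weight of the other end vanishes, so that [branch_weight]
    applies to it. The factor [t < 1] appears for each branch on the half away
    from its own neutral point; at every [x] at least one of the two branches
    thus has a margin. *)
Lemma exists_weight : exists K : R -> R, exists t : R,
  [/\ 0 <= t < 1,
      forall x : R, 0 < x < 1 -> 1 <= K x,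
      forall a b : R, 0 < a -> b < 1 -> exists2 B : R, 0 <= B &
        forall x : R, a <= x <= b -> K x <= B,
      forall x : R, 0 < x < 1 -> K (g1 x) * dg1 x + D <=
        (if x < 1 / 2 then 1 else t) * K x &
      forall x : R, 0 < x < 1 -> K (g2 x) * dg2 x + D <=
        (if x <= 1 / 2 then t else 1) * K x].
Proof.
have [e1 e10 He1] := branch_weight nb1.
have [e2 e20 He2] := branch_weight nb2.
have /andP[c0 c1] := tb_c.
have [d [d0 de1 de2 [d12 dc dc']]] : exists d : R, [/\ 0 < d, d <= e1, d <= e2 &
    [/\ d <= 1 / 2, d <= c & d <= 1 - c]].
  exists (Num.min (Num.min e1 e2) (Num.min (1 / 2) (Num.min c (1 - c)))).
  rewrite !lt_min !ge_min !lexx ?orbT e10 e20 c0 subr_gt0 c1.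
  by split => //; rewrite divr_gt0.
have d1 : d < 1 by lra.
have [t1 /andP[t10 t11] [M1 M10 H1]] := He1 d d0 de1 d1.
have [t2 /andP[t20 t21] [M2 M20 H2]] := He2 d d0 de2 d1.
have [t [t1t t2t tlt1]] : exists t : R, [/\ t1 <= t, t2 <= t & t < 1].
  by exists (Num.max t1 t2); rewrite !le_max gt_max !lexx orbT t11 t21.
have t0 : 0 <= t by exact: le_trans t1t.
have [M [M1M M2M M1']] : exists M : R, [/\ M1 <= M, M2 <= M & 1 <= M].
  by exists (Num.max 1 (Num.max M1 M2)); rewrite !le_max !lexx !orbT.
pose K x := M + side_weight D g1 d x + side_weight D (reflect01 g2) d (1 - x).
have s1 (x : R) : 0 < x < 1 -> 0 <= side_weight D g1 d x.
  by move=> /andP[x0 x1]; apply: (side_weight_ge0 nb1) => //; exact: ltW.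
have s2 (x : R) : 0 < x < 1 -> 0 <= side_weight D (reflect01 g2) d (1 - x).
  by move=> x01; apply: (side_weight_ge0 nb2) => //; lra.
have KM (x : R) : 0 < x < 1 -> M <= K x.
  by move=> x01; rewrite /K -addrA lerDl addr_ge0 ?s1 ?s2.
have g1_01 (x : R) : 0 < x < 1 -> 0 < g1 x < 1.
  by move=> x01; apply: (nb_gx01 nb1); lra.
have g2_01 (x : R) : 0 < x < 1 -> 0 < g2 x < 1.
  by move=> x01; apply: tb_g2_01; lra.
have W1 (x : R) : 0 < x < 1 ->
    K (g1 x) * dg1 x + D <= (if x < d then 1 else t) * K x.
  move=> x01; have := H1 M x M1M x01.
  have -> : K (g1 x) = M + side_weight D g1 d (g1 x).
    rewrite /K /side_weight [1 - g1 x < d]ltNge.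
    rewrite (_ : d <= 1 - g1 x) ?addr0//.
    by have := @nb_lec _ _ _ _ _ _ _ nb1 x; lra.
  move=> /le_trans; apply.
  apply: ler_pM; [by case: ifP|by rewrite addr_ge0 ?s1//; lra| |].
    by case: ifP.
  by rewrite /K lerDl s2.
have W2 (x : R) : 0 < x < 1 ->
    K (g2 x) * dg2 x + D <= (if 1 - x < d then 1 else t) * K x.
  move=> x01; have := H2 M (1 - x) M2M (onem01 x01).
  have -> : K (g2 x) = M + side_weight D (reflect01 g2) d (reflect01 g2 (1 - x)).
    rewrite /K [reflect01 g2 (1 - x)]/reflect01 subKr.
    rewrite {1}/side_weight [g2 x < d]ltNge (_ : d <= g2 x) ?addr0//.
    by have := @tb_g2_ge x; lra.
  rewrite subKr => /le_trans; apply.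
  apply: ler_pM; [by case: ifP|by rewrite addr_ge0 ?s2//; lra| |].
    by case: ifP.
  by rewrite /K addrAC lerDl s1.
have Kbnd (a b : R) : 0 < a -> b < 1 -> exists2 B : R, 0 <= B &
    forall x : R, a <= x <= b -> K x <= B.
  move=> a0 b1; have [a' [a'0 a'1 a'a]] : exists r : R, [/\ 0 < r, r <= 1 & r <= a].
    by exists (Num.min a 1); rewrite lt_min !ge_min !lexx a0 orbT ltr01.
  have [b' [b'0 b'1 b'b]] : exists r : R, [/\ 0 < r, r <= 1 & r <= 1 - b].
    exists (Num.min (1 - b) 1).
    by rewrite lt_min !ge_min !lexx subr_gt0 b1 orbT ltr01.
  exists (M + D / (a' - g1 a') + D / (b' - reflect01 g2 b')).
    have DD := nb_D nb1.
    apply: addr_ge0; first apply: addr_ge0; first lra.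
      by rewrite divr_ge0// ltW// (nb_gap_gt0 nb1).
    by rewrite divr_ge0// ltW// (nb_gap_gt0 nb2).
  move=> x /andP[ax xb]; rewrite /K lerD//; last first.
    by apply: (side_weight_bounded nb2) => //; lra.
  by rewrite lerD2l; apply: (side_weight_bounded nb1) => //; lra.
exists K, t; split => //.
- by rewrite t0.
- by move=> x x01; apply: le_trans (KM x x01).
- move=> x x01; apply: le_trans (W1 x x01) _.
  rewrite ler_wpM2r//; first by have := KM x x01; lra.
  case: (ltP x (1 / 2)) => x12; first by case: ifP => // _; exact: ltW.
  by rewrite ifF//; apply/negbTE; rewrite -leNgt; lra.
- move=> x x01; apply: le_trans (W2 x x01) _.
  rewrite ler_wpM2r//; first by have := KM x x01; lra.
  case: (leP x (1 / 2)) => x12; last by case: ifP => // _; exact: ltW.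
  by rewrite ifF//; apply/negbTE; rewrite -leNgt; lra.
Qed.

Lemma regular_image (K F p dp : R -> R) (a : R) : regular K F p dp ->
  [/\ push F 0 - a * 0 = 0,
      {within `[0, 1], continuous (fun t => push F t - a * t : R)},
      forall x : R, 0 < x < 1 ->
        is_derive x 1 (fun t => push F t - a * t : R) (transfer p x - a) &
      forall x : R, 0 < x < 1 ->
        is_derive x 1 (fun x => transfer p x - a)
          ((dp (g1 x) * dg1 x * dg1 x + p (g1 x) * ddg1 x) +
           (dp (g2 x) * dg2 x * dg2 x + p (g2 x) * ddg2 x))].
Proof.
move=> rg; have /andP[c0 c1] := tb_c.
have g1_01 (x : R) : 0 < x < 1 -> 0 < g1 x < 1.
  by move=> x01; apply: (nb_gx01 nb1); lra.
have g2_01 (x : R) : 0 < x < 1 -> 0 < g2 x < 1.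
  by move=> x01; apply: tb_g2_01; lra.
split.
- by rewrite /push (nb_0 nb1) tb_g20 (rg_0 rg) mulr0 subr0 add0r subrr.
- have cF := rg_cont rg.
  have c1' : {within `[0, 1], continuous (F \o g1)}.
    apply: within_continuous_comp cF; last exact: (nb_cont nb1).
    move=> x /=; rewrite !in_itv/= => /andP[x0 x1]; apply/andP; split.
      move: x0; rewrite le_eqVlt => /predU1P[<-|x0]; first by rewrite (nb_0 nb1).
      exact/ltW/(nb_gt0 nb1).
    by apply: le_trans (ltW c1); apply: (nb_lec nb1).
  have c2' : {within `[0, 1], continuous (F \o g2)}.
    apply: within_continuous_comp cF; last exact: tb_g2_cont.
    move=> x /=; rewrite !in_itv/= => /andP[x0 x1]; apply/andP; split.
      by apply: le_trans (ltW c0) _; exact: tb_g2_ge.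
    move: x1; rewrite le_eqVlt => /predU1P[->|x1]; first by rewrite tb_g21.
    by have := @tb_g2_01 x; lra.
  move=> x; apply: cvgB; last first.
    by apply: continuous_subspaceT => y; apply: cvgM; [exact: cvg_cst|exact: cvg_id].
  apply: cvgB; last exact: cvg_cst.
  by apply: cvgD; [exact: c1'|exact: c2'].
- move=> x x01.
  have D1 := is_derive1_comp (rg_der rg (g1_01 x x01)) (nb_der nb1 x01).
  have D2 := is_derive1_comp (rg_der rg (g2_01 x x01)) (tb_g2_der x01).
  have D3 : is_derive x 1 (fun t : R => a * t) a.
    rewrite -[X in is_derive _ _ _ X]mulr1.
    exact: (is_deriveZ a (is_derive_id x 1)).
  have := is_deriveB (is_deriveB (is_deriveD D1 D2) (is_derive_cst (F c) x 1)) D3.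
  by rewrite subr0.
- move=> x x01.
  have D1 := is_derive1_comp (rg_der2 rg (g1_01 x x01)) (nb_der nb1 x01).
  have D2 := is_derive1_comp (rg_der2 rg (g2_01 x x01)) (tb_g2_der x01).
  have D3 := is_deriveM D1 (nb_der2 nb1 x01).
  have D4 := is_deriveM D2 (tb_g2_der2 x01).
  have := is_deriveB (is_deriveD D3 D4) (is_derive_cst a x 1).
  move=> H; apply: is_derive_eq; rewrite /GRing.scale/=; ring.
Qed.

(** The derivative of the transferred density is bounded by [K] times that
    density, with a margin [(1 - t)] on one of the two terms. This margin lets
    one subtract a constant: the term with the margin comes from a point
    between [g1 (1/2)] and [g2 (1/2)], where [p] is comparable to [p c]. *)
Lemma exists_regular_step : exists K : R -> R, exists kappa : R,
  [/\ 0 < kappa,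
      forall x : R, 0 < x < 1 -> 1 <= K x,
      forall a b : R, 0 < a -> b < 1 -> exists2 B : R, 0 <= B &
        forall x : R, a <= x <= b -> K x <= B &
      forall (F p dp : R -> R) (a : R), regular K F p dp -> 0 <= a <= kappa * p c ->
        exists dp' : R -> R, regular K (fun t => push F t - a * t : R)
          (fun x => transfer p x - a) dp'].
Proof.
have /andP[c0 c1] := tb_c.
have g1_01 (x : R) : 0 < x < 1 -> 0 < g1 x < 1.
  by move=> x01; apply: (nb_gx01 nb1); lra.
have g2_01 (x : R) : 0 < x < 1 -> 0 < g2 x < 1.
  by move=> x01; apply: tb_g2_01; lra.
have [K [t [/andP[t0 tlt1] K1 Kbnd W1 W2]]] := exists_weight.
have gam0 := nb_gam nb1.
have a0 : 0 < g1 (1 / 2) by apply: (nb_gt0 nb1); lra.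
have b1 : g2 (1 / 2) < 1 by have := @tb_g2_01 (1 / 2); lra.
have ac : g1 (1 / 2) <= c by apply: (nb_lec nb1); lra.
have cb : c <= g2 (1 / 2) by apply: tb_g2_ge; lra.
have [B B0 KB] := Kbnd _ _ a0 b1.
pose E := expR (- B).
have E0 : 0 < E by exact: expR_gt0.
(* On the central zone [E * p c] is a lower bound of [p], [gam] bounds the
   derivatives of the branches from below, and [1 - t] is the margin. *)
exists K, ((1 - t) * (gam * E)); split.
- by rewrite !mulr_gt0//; lra.
- exact: K1.
- exact: Kbnd.
move=> F p dp a rg /andP[a_ge0 aE].
have pc (y : R) : g1 (1 / 2) <= y <= g2 (1 / 2) -> E * p c <= p y.
  move=> yab; have py0 : 0 <= p y by apply: (rg_ge0 rg); lra.
  have cab : g1 (1 / 2) <= c <= g2 (1 / 2) by lra.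
  have := regular_gronwall a0 b1 KB rg yab cab.
  move=> H; rewrite /E -(ler_pM2l (expR_gt0 B)) mulrA expRxMexpNx_1 mul1r.
  apply: le_trans H _; rewrite ler_wpM2r// ler_expR ler_piMr// ler_norml; lra.
have pc0 : 0 <= p c by apply: (rg_ge0 rg); exact: tb_c.
pose P1 x := p (g1 x) * dg1 x; pose P2 x := p (g2 x) * dg2 x.
have P1_ge0 (x : R) : 0 < x < 1 -> 0 <= P1 x.
  move=> x01; rewrite mulr_ge0 ?(rg_ge0 rg) ?g1_01//.
  by apply/ltW/(nb_dg_gt0 nb1).
have dg2_gt0 (x : R) : 0 < x < 1 -> 0 < dg2 x.
  by move=> x01; apply: lt_le_trans gam0 _; exact: tb_dg2_gam.
have P2_ge0 (x : R) : 0 < x < 1 -> 0 <= P2 x.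
  by move=> x01; rewrite mulr_ge0 ?(rg_ge0 rg) ?g2_01// ltW// dg2_gt0.
have P1_ge (x : R) : 1 / 2 <= x -> x < 1 -> a <= (1 - t) * P1 x.
  move=> x12 x1; apply: le_trans aE _; rewrite -mulrA ler_wpM2l//; first lra.
  rewrite -mulrA mulrC ler_pM//; [by rewrite mulr_ge0// ltW|exact: ltW| |].
    apply: pc; apply/andP; split.
      move: x12; rewrite le_eqVlt => /predU1P[->//|x12].
      by apply/ltW/(nb_incr nb1) => //; lra.
    by apply: le_trans cb; apply: (nb_lec nb1); lra.
  by apply: (nb_dgam nb1); lra.
have P2_ge (x : R) : 0 < x -> x <= 1 / 2 -> a <= (1 - t) * P2 x.
  move=> x0 x12; apply: le_trans aE _; rewrite -mulrA ler_wpM2l//; first lra.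
  rewrite -mulrA mulrC ler_pM//; [by rewrite mulr_ge0// ltW|exact: ltW| |].
    apply: pc; apply/andP; split.
      by apply: le_trans ac _; apply: tb_g2_ge; lra.
    move: x12; rewrite le_eqVlt => /predU1P[->//|x12].
    by apply/ltW/tb_g2_incr => //; lra.
  by apply: tb_dg2_gam; lra.
pose q1 x := dp (g1 x) * dg1 x * dg1 x + p (g1 x) * ddg1 x.
pose q2 x := dp (g2 x) * dg2 x * dg2 x + p (g2 x) * ddg2 x.
have q1_le (x : R) : 0 < x < 1 -> `|q1 x| <= P1 x * (K (g1 x) * dg1 x + D).
  move=> x01; rewrite /q1 (le_trans (ler_normD _ _))//.
  have g01 := g1_01 x x01; have dg0 := nb_dg_gt0 nb1 x01.
  rewrite !normrM (gtr0_norm dg0) (ger0_norm (rg_ge0 rg g01)).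
  have -> : P1 x * (K (g1 x) * dg1 x + D) =
      (K (g1 x) * p (g1 x)) * dg1 x * dg1 x + p (g1 x) * (D * dg1 x).
    by rewrite /P1; ring.
  rewrite lerD// ?ler_wpM2r ?(ltW dg0)//; first exact: (rg_K rg).
  by rewrite ler_wpM2l ?(rg_ge0 rg)// (nb_dist nb1).
have q2_le (x : R) : 0 < x < 1 -> `|q2 x| <= P2 x * (K (g2 x) * dg2 x + D).
  move=> x01; rewrite /q2 (le_trans (ler_normD _ _))//.
  have g01 := g2_01 x x01; have dg0 := dg2_gt0 x x01.
  rewrite !normrM (gtr0_norm dg0) (ger0_norm (rg_ge0 rg g01)).
  have -> : P2 x * (K (g2 x) * dg2 x + D) =
      (K (g2 x) * p (g2 x)) * dg2 x * dg2 x + p (g2 x) * (D * dg2 x).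
    by rewrite /P2; ring.
  rewrite lerD// ?ler_wpM2r ?(ltW dg0)//; first exact: (rg_K rg).
  by rewrite ler_wpM2l ?(rg_ge0 rg)// tb_g2_dist.
have [I0 Ic Id Id2] := regular_image a rg.
exists (fun x => q1 x + q2 x); split; [exact: I0|exact: Ic|exact: Id|exact: Id2| |].
- move=> x x01; rewrite /transfer -/(P1 x) -/(P2 x).
  have [x12|x12] := leP x (1 / 2).
    rewrite -addrA addr_ge0 ?P1_ge0// subr_ge0.
    apply: le_trans (P2_ge x _ x12) _; first by case/andP: x01.
    by rewrite ler_piMl ?P2_ge0// gerBl.
  rewrite addrAC addr_ge0 ?P2_ge0// subr_ge0.
  apply: le_trans (P1_ge x (ltW x12) _) _; first by case/andP: x01.
  by rewrite ler_piMl ?P1_ge0// gerBl.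
- move=> x x01; rewrite /transfer -/(P1 x) -/(P2 x).
  have K0 : 0 <= K x by have := K1 x x01; lra.
  have P10 := P1_ge0 x x01; have P20 := P2_ge0 x x01.
  have q1K s : K (g1 x) * dg1 x + D <= s * K x -> `|q1 x| <= P1 x * (s * K x).
    by move=> H; rewrite (le_trans (q1_le x x01))// ler_wpM2l.
  have q2K s : K (g2 x) * dg2 x + D <= s * K x -> `|q2 x| <= P2 x * (s * K x).
    by move=> H; rewrite (le_trans (q2_le x x01))// ler_wpM2l.
  apply: le_trans (ler_normD _ _) _.
  have := W1 x x01; have := W2 x x01.
  have [x12|x12] := leP x (1 / 2).
    move=> /q2K H2'.
    move=> W1x; have /q1K H1' : K (g1 x) * dg1 x + D <= 1 * K x.
      by apply: le_trans W1x _; rewrite ler_wpM2r//; case: ifP => // _; exact: ltW.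
    apply: le_trans (lerD H1' H2') _.
    have -> : K x * (P1 x + P2 x - a) = P1 x * (1 * K x) + P2 x * (t * K x)
        + (K x * ((1 - t) * P2 x) - K x * a) by ring.
    by rewrite lerDl subr_ge0 ler_wpM2l// P2_ge//; case/andP: x01.
  move=> /q2K H2'; rewrite ltNge (ltW x12)/= => /q1K H1'.
  apply: le_trans (lerD H1' H2') _.
  have -> : K x * (P1 x + P2 x - a) = P1 x * (t * K x) + P2 x * (1 * K x)
      + (K x * ((1 - t) * P1 x) - K x * a) by ring.
  by rewrite lerDl subr_ge0 ler_wpM2l// P1_ge//; [exact: ltW|case/andP: x01].
Qed.

End TwoBranches.

(** * Convolutions, slow variation and neutral orbits *)

Section MoreSequences.
Context {R : realType}.

Lemma convolution_rev (a b : R^nat) n :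
  \sum_(0 <= j < n) a j * b (n - j.+1)%N = \sum_(0 <= j < n) a (n - j.+1)%N * b j.
Proof.
rewrite big_nat_rev/= add0n; apply: eq_big_nat => j /andP[_ jn].
by rewrite subnSK// subKn// ltnW.
Qed.

(** If [w n >= e], then by slow variation [w >= e / 2] on a long window before
    [n], where the convolution with [s] is at least [e / 2] times a large
    partial sum of [s]. *)
Lemma slowly_varying_cvg0 (w s : R^nat) (C : R) :
  (forall n, 0 <= w n) -> (forall j, 0 <= s j) ->
  w n.+1 - w n @[n --> \oo] --> 0 ->
  (forall n, \sum_(0 <= j < n) w (n - j.+1)%N * s j <= C) ->
  (forall M : R, exists J, M < \sum_(0 <= j < J) s j) ->
  w @ \oo --> 0.
Proof.
move=> w0 s0 dw wC sdiv; apply/cvgr0Pnorm_le => e e0.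
have [J HJ] := sdiv (2 * C / e).
have d0 : 0 < e / 2 / J.+1%:R by rewrite !divr_gt0.
have /cvgr0Pnorm_le/(_ _ d0)[N _ HN] := dw.
exists (N + J)%N => // n /= nNJ; rewrite ger0_norm// leNgt; apply/negP => ew.
have near j : (j <= J)%N -> e - e / 2 / J.+1%:R * j%:R <= w (n - j)%N.
  elim: j => [_|j IH jJ]; first by rewrite mulr0 subr0 subn0 ltW.
  have := HN (n - j.+1)%N; rewrite /= => /(_ ltac:(lia)).
  have -> : (n - j.+1).+1 = (n - j)%N by lia.
  rewrite ler_norml => /andP[_]; have := IH (ltnW jJ).
  move: (e / 2 / J.+1%:R) => d; rewrite -[j.+1]addn1 natrD mulrDr mulr1; lra.
have half j : (j < J)%N -> e / 2 <= w (n - j)%N.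
  move=> jJ; apply: le_trans (near j (ltnW jJ)).
  have : e / 2 / J.+1%:R * j%:R <= e / 2.
    rewrite mulrAC ler_pdivrMr// ler_wpM2l//; first by rewrite divr_ge0// ltW.
    by rewrite ler_nat; lia.
  by move: (e / 2 / J.+1%:R * j%:R) => d; lra.
have : \sum_(0 <= j < J) e / 2 * s j <= C.
  apply: le_trans (wC n.+1); rewrite [leRHS](big_cat_nat (leq0n J))/=; last lia.
  rewrite -[leLHS]addr0 lerD//.
    by apply: ler_sum_nat => j /andP[_ jJ]; rewrite subSS ler_wpM2r// half.
  by apply: sumr_ge0 => j _; exact: mulr_ge0.
rewrite -mulr_sumr leNgt => /negP; apply.
by rewrite mulrC -ltr_pdivrMr ?divr_gt0// invf_div mulrA [C * _]mulrC.
Qed.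

Lemma sum_shift (A : nat -> nat -> R) n i :
  \sum_(0 <= j < n.+1) A (n.+1 - j.+1)%N (i + j)%N =
  A n i + \sum_(0 <= j < n) A (n - j.+1)%N (i.+1 + j)%N.
Proof.
rewrite big_nat_recl// subSS subn0 addn0; congr (_ + _).
by apply: eq_bigr => j _; rewrite subSS addnS addSn.
Qed.

Lemma within_cvg_seq (A : set R) (f : R -> R) (u : R^nat) (l : R) :
  {within A, continuous f} -> A l -> (forall n, A (u n)) ->
  u @ \oo --> l -> f (u n) @[n --> \oo] --> f l.
Proof.
move=> /within_continuousP cf Al Au ul; apply/cvgrPdist_lt => e e0.
have [d d0 Hd] := cf l Al e e0.
have /cvgrPdist_lt/(_ d d0)[N _ HN] := ul.
exists N => // n /HN /= H; rewrite distrC; apply: Hd => //.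
by rewrite distrC.
Qed.

Lemma nb_iter_bounds (c D gam : R) (g dg ddg : R -> R) (x : R) n :
  neutral_branch c D gam g dg ddg -> 0 < x -> x <= 1 ->
  0 < iter n g x <= x.
Proof.
move=> nb x0 x1; elim: n => [|n /andP[IH0 IH1]]/=; first by rewrite x0/=.
have n1 := le_trans IH1 x1.
rewrite (nb_gt0 nb)//= (le_trans _ IH1)// -subr_ge0 ltW//.
exact: (nb_gap_gt0 nb).
Qed.

(** As long as an iterate stays above [e], each step decreases it by at least
    the gap [e - g e]. *)
Lemma nb_iter_cvg0 (c D gam : R) (g dg ddg : R -> R) (x : R) :
  neutral_branch c D gam g dg ddg -> 0 < x -> x <= 1 ->
  iter n g x @[n --> \oo] --> 0.
Proof.
move=> nb x0 x1; pose u n := iter n g x.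
have u01 n : 0 < u n <= x by exact: (nb_iter_bounds _ nb).
have u1 n : u n <= 1 by have /andP[_ H] := u01 n; exact: le_trans x1.
have uS n : u n.+1 <= u n.
  rewrite -subr_ge0 ltW// -[u n.+1]/(g (u n)); apply: (nb_gap_gt0 nb) => //.
  by have /andP[] := u01 n.
apply/cvgr0Pnorm_le => e e0.
have [e1|e1] := leP 1 e.
  exists 0%N => // n _ /=; rewrite ger0_norm; first exact: le_trans (u1 n) e1.
  by have /andP[/ltW] := u01 n.
have d0 := nb_gap_gt0 nb e0 (ltW e1).
have dn n : u n <= e \/ u n <= x - n%:R * (e - g e).
  elim: n => [|n [IH|IH]]; first by right; rewrite mul0r subr0.
    by left; exact: le_trans IH.
  have [ue|/ltW eu] := leP (u n) e; first by left; exact: le_trans ue.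
  right; have := nb_gap_le nb (ltW e0) eu (u1 n).
  have -> : g (u n) = u n.+1 by [].
  rewrite -[n.+1]addn1 natrD mulrDl mul1r; lra.
pose N := (Num.trunc (1 / (e - g e))).+1.
have Nd : 1 < N%:R * (e - g e) by rewrite -ltr_pdivrMr// truncnS_gt.
exists N => // n /= Nn; have /andP[un0 _] := u01 n; rewrite gtr0_norm//.
have [//|H] := dn n; exfalso.
have : N%:R * (e - g e) <= n%:R * (e - g e) by rewrite ler_wpM2r ?ler_nat// ltW.
lra.
Qed.

End MoreSequences.

(** * Regeneration and the limit of distribution functions *)

Section Evolution.
Context {R : realType}.
Variables (c D gam : R) (g1 dg1 ddg1 g2 dg2 ddg2 : R -> R).
Hypothesis tb : two_neutral_branches c D gam g1 dg1 ddg1 g2 dg2 ddg2.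
Variables (K : R -> R) (kappa : R).
Hypothesis kappa0 : 0 < kappa.
Hypothesis K_ge1 : forall x : R, 0 < x < 1 -> 1 <= K x.
Hypothesis K_bnd : forall a b : R, 0 < a -> b < 1 -> exists2 B : R, 0 <= B &
  forall x : R, a <= x <= b -> K x <= B.
Hypothesis step : forall (F p dp : R -> R) (a : R),
  regular K F p dp -> 0 <= a <= kappa * p c ->
  exists dp' : R -> R, regular K (fun t => push c g1 g2 F t - a * t : R)
    (fun x => transfer g1 dg1 g2 dg2 p x - a) dp'.

Let nb1 := tb_left tb.
Let nb2 := tb_right tb.

(** The pair of a distribution function and its density after [n] steps, where
    each step transfers and then removes [k] times the density at the cut, as a
    multiple of the uniform density. The true evolution is [k = 0]; for
    [k = kappa] one gets the residual of the regeneration scheme. *)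
Fixpoint evolve (k : R) (F p : R -> R) (n : nat) : (R -> R) * (R -> R) :=
  if n is m.+1 then
    let: (G, q) := evolve k F p m in
    (fun t => push c g1 g2 G t - k * q c * t,
     fun x => transfer g1 dg1 g2 dg2 q x - k * q c)
  else (F, p).

Definition mass k F p n := (evolve k F p n).1.
Definition dens k F p n := (evolve k F p n).2.

Lemma massS k F p n t : mass k F p n.+1 t =
  push c g1 g2 (mass k F p n) t - k * dens k F p n c * t.
Proof. by rewrite /mass /dens /=; case: evolve. Qed.

Lemma evolve_regular (k : R) F p n : 0 <= k <= kappa ->
  (exists dp, regular K F p dp) ->
  exists dp, regular K (mass k F p n) (dens k F p n) dp.
Proof.
move=> /andP[k0 kk] Fp; elim: n => [//|n [dp rg]].
have pc0 : 0 <= dens k F p n c by apply: (rg_ge0 rg); exact: (tb_c tb).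
have [|dp' rg'] := @step _ _ _ (k * dens k F p n c) rg.
  by rewrite mulr_ge0//= ler_wpM2r.
by exists dp'; move: rg'; rewrite /mass /dens /=; case: evolve.
Qed.

Lemma regular_id : exists dp : R -> R, regular K id (fun=> 1) dp.
Proof.
exists (fun=> 0); split => [//||x _|x _|//|x x01].
- by apply: continuous_subspaceT => x; exact: cvg_id.
- exact: is_derive_id.
- exact: is_derive_cst.
- by rewrite normr0 mulr1 (le_trans _ (K_ge1 x01)).
Qed.

Lemma regular_le (F p dp : R -> R) (x y : R) : regular K F p dp ->
  0 <= x -> x <= y -> y <= 1 -> F x <= F y.
Proof.
move=> rg x0; rewrite le_eqVlt => /predU1P[->//|xy] y1.
have [z xzy E] := mvt01 (rg_cont rg) (rg_der rg) x0 xy y1.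
rewrite -subr_ge0 E mulr_ge0//; last lra.
by apply: (rg_ge0 rg); lra.
Qed.

(** On a compact subset of ]0, 1[ the density is comparable to its value at
    the cut, by Gronwall. *)
Lemma regular_mass_le (x y : R) : 0 < x -> x <= y -> y < 1 ->
  exists2 C : R, 0 <= C & forall F p dp, regular K F p dp ->
    F y - F x <= C * p c.
Proof.
move=> x0 xy y1; have /andP[c0 c1] := tb_c tb.
have a0 : 0 < Num.min x c by rewrite lt_min x0.
have b1 : Num.max y c < 1 by rewrite gt_max y1.
have [B B0 KB] := K_bnd a0 b1.
have bnd (z : R) : x <= z <= y -> Num.min x c <= z <= Num.max y c.
  by move=> /andP[xz zy]; rewrite ge_min le_max xz zy.
have bndc : Num.min x c <= c <= Num.max y c.
  by rewrite ge_min le_max lexx !orbT.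
exists (expR B); first exact: expR_ge0.
move=> F p dp rg.
have pc0 : 0 <= p c by apply: (rg_ge0 rg); rewrite c0.
move: xy; rewrite le_eqVlt => /predU1P[->|xy].
  by rewrite subrr mulr_ge0// expR_ge0.
have [z xzy ->] := mvt01 (rg_cont rg) (rg_der rg) (ltW x0) xy (ltW y1).
have pz0 : 0 <= p z by apply: (rg_ge0 rg); lra.
have pz : p z <= expR B * p c.
  apply: le_trans (regular_gronwall a0 b1 KB rg bndc (bnd z _)) _; first lra.
  rewrite ler_wpM2r// ler_expR ler_piMr// ler_norml; lra.
by apply: le_trans pz; rewrite ler_piMr//; lra.
Qed.

(** The mass of an interval containing the cut is its length times the density
    at the cut, up to a factor that tends to 1 with the length. The bound is
    uniform over the whole class, hence over all times. *)
Lemma regular_entry : exists2 B : R, 0 <= B & forall F p dp (x y : R),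
  regular K F p dp -> g1 c <= x -> x <= c -> c <= y -> y <= g2 c ->
  expR (- (B * (y - x))) * (p c * (y - x)) <= F y - F x <=
  expR (B * (y - x)) * (p c * (y - x)).
Proof.
have /andP[c0 c1] := tb_c tb.
have a0 : 0 < g1 c by apply: (nb_gt0 nb1) => //; exact: ltW.
have b1 : g2 c < 1 by have := @tb_g2_01 _ _ _ _ _ _ _ _ _ _ tb c; lra.
have [B B0 KB] := K_bnd a0 b1; exists B => // F p dp x y rg gx xc cy yg.
have := le_trans xc cy; rewrite le_eqVlt => /predU1P[->|xy].
  by rewrite !subrr !mulr0 lexx.
have [z xzy ->] := mvt01 (rg_cont rg) (rg_der rg)
  (ltW (lt_le_trans a0 gx)) xy (ltW (le_lt_trans yg b1)).
have pc0 : 0 <= p c by apply: (rg_ge0 rg); rewrite c0.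
have pz0 : 0 <= p z by apply: (rg_ge0 rg); lra.
have zab : g1 c <= z <= g2 c by lra.
have cab : g1 c <= c <= g2 c by lra.
have d1 : B * `|z - c| <= B * (y - x) by rewrite ler_wpM2l// ler_norml; lra.
have d2 : B * `|c - z| <= B * (y - x) by rewrite ler_wpM2l// ler_norml; lra.
have yx0 : 0 <= y - x by lra.
rewrite !mulrA; apply/andP; split; rewrite ler_wpM2r//.
  rewrite -(ler_pM2l (expR_gt0 (B * (y - x)))) mulrA expRxMexpNx_1 mul1r.
  apply: le_trans (regular_gronwall a0 b1 KB rg zab cab) _.
  by rewrite ler_wpM2r// ler_expR.
apply: le_trans (regular_gronwall a0 b1 KB rg cab zab) _.
by rewrite ler_wpM2r// ler_expR.
Qed.

(** Points of ]left_orbit j.+1, left_orbit j] cross the cut in exactly [j.+1]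
    steps. *)
Definition left_orbit j : R := iter j g1 c.
Definition right_orbit j : R := iter j g2 c.

Lemma right_orbitE j : right_orbit j = 1 - iter j (reflect01 g2) (1 - c).
Proof.
elim: j => [|j IH]; first by rewrite /= subKr.
by rewrite /right_orbit !iterS -/(right_orbit j) IH /reflect01 subKr.
Qed.

Lemma left_orbit_bounds j : 0 < left_orbit j <= c.
Proof.
have /andP[c0 c1] := tb_c tb.
by apply: (nb_iter_bounds _ nb1) => //; exact: ltW.
Qed.

Lemma right_orbit_bounds j : c <= right_orbit j < 1.
Proof.
have /andP[c0 c1] := tb_c tb; rewrite right_orbitE.
have := @nb_iter_bounds _ _ _ _ _ _ _ (1 - c) j nb2; lra.
Qed.

Lemma left_orbit_cvg : left_orbit @ \oo --> 0.
Proof.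
have /andP[c0 c1] := tb_c tb.
by apply: (nb_iter_cvg0 nb1) => //; exact: ltW.
Qed.

Lemma right_orbit_cvg : right_orbit @ \oo --> (1 : R).
Proof.
have /andP[c0 c1] := tb_c tb.
rewrite (_ : right_orbit = fun j => 1 - iter j (reflect01 g2) (1 - c)).
  rewrite -[X in _ --> X]subr0; apply: cvgB; first exact: cvg_cst.
  by apply: (nb_iter_cvg0 nb2); lra.
by apply/funext => j; exact: right_orbitE.
Qed.

(** The interval [[c, c + left_gap j]] is what the right branch sends to
    [[0, left_orbit j]]: mass entering there stays on the left for more than
    [j] steps. *)
Definition left_gap j : R := g2 (left_orbit j) - c.
Definition right_gap j : R := c - g1 (right_orbit j).

Lemma left_gap_bounds j : 0 < left_gap j <= g2 c - c.
Proof.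
have /andP[c0 c1] := tb_c tb; have /andP[x0 xc] := left_orbit_bounds j.
rewrite /left_gap lerD2r subr_gt0 -{1}(tb_g20 tb) (tb_g2_incr tb)//=; last lra.
move: xc; rewrite le_eqVlt => /predU1P[->//|xc].
by apply/ltW/(tb_g2_incr tb) => //; exact: ltW.
Qed.

Lemma right_gap_bounds j : 0 < right_gap j <= c - g1 c.
Proof.
have /andP[c0 c1] := tb_c tb; have /andP[cy y1] := right_orbit_bounds j.
have H1 : g1 (right_orbit j) < c.
  by rewrite -(nb_1 nb1); apply: (nb_incr nb1) => //; lra.
have H2 : g1 c <= g1 (right_orbit j).
  move: cy; rewrite le_eqVlt => /predU1P[<-//|cy].
  by apply/ltW/(nb_incr nb1) => //; exact: ltW.
rewrite /right_gap; lra.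
Qed.

Lemma left_gap_cvg0 : left_gap @ \oo --> 0.
Proof.
have H : g2 (left_orbit n) @[n --> \oo] --> g2 0.
  apply: within_cvg_seq (tb_g2_cont tb) _ _ left_orbit_cvg.
    by rewrite /= in_itv/= lexx ler01.
  move=> n; have := left_orbit_bounds n; have := tb_c tb.
  by rewrite /= in_itv/=; lra.
rewrite (_ : 0 = g2 0 - c); last by rewrite (tb_g20 tb) subrr.
exact: cvgB H (cvg_cst c).
Qed.

Lemma right_gap_cvg0 : right_gap @ \oo --> 0.
Proof.
have H : g1 (right_orbit n) @[n --> \oo] --> g1 1.
  apply: within_cvg_seq (nb_cont nb1) _ _ right_orbit_cvg.
    by rewrite /= in_itv/= lexx ler01.
  move=> n; have := right_orbit_bounds n; have := tb_c tb.
  by rewrite /= in_itv/=; lra.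
rewrite (_ : 0 = c - g1 1); last by rewrite (nb_1 nb1) subrr.
exact: cvgB (cvg_cst c) H.
Qed.

Lemma mass1 (k : R) F p n : mass k F p n 1 =
  F 1 - \sum_(0 <= j < n) k * dens k F p j c.
Proof.
elim: n => [|n IH]; first by rewrite big_geq// subr0.
rewrite massS big_nat_recr//= /push (nb_1 nb1) (tb_g21 tb) IH; ring.
Qed.

(** Mass located in [[0, left_orbit i]] was either in [[0, left_orbit i.+1]]
    one step before, or entered from [[c, g2 (left_orbit i)]]. Unrolling [n]
    times sorts the mass by its time of last entry; the last sum is the mass
    removed on the way. *)
Lemma mass_left k F p n i : mass k F p n (left_orbit i) =
  F (left_orbit (n + i)) +
  \sum_(0 <= j < n) (mass k F p (n - j.+1)%N (g2 (left_orbit (i + j)))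
    - mass k F p (n - j.+1)%N c) -
  \sum_(0 <= j < n) k * dens k F p (n - j.+1)%N c * left_orbit (i + j).
Proof.
elim: n i => [|n IH] i; first by rewrite !big_geq// subr0 addr0.
rewrite massS /push -[g1 (left_orbit i)]/(left_orbit i.+1) IH.
rewrite (sum_shift (fun m l => mass k F p m (g2 (left_orbit l)) -
  mass k F p m c)).
rewrite (sum_shift (fun m l => k * dens k F p m c * left_orbit l)) addSnnS.
ring.
Qed.

(** The mirror image of [mass_left]. *)
Lemma mass_right k F p n i :
  mass k F p n 1 - mass k F p n (right_orbit i) =
  F 1 - F (right_orbit (n + i)) +
  \sum_(0 <= j < n) (mass k F p (n - j.+1)%N c -
    mass k F p (n - j.+1)%N (g1 (right_orbit (i + j)))) -
  \sum_(0 <= j < n) k * dens k F p (n - j.+1)%N c * (1 - right_orbit (i + j)).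
Proof.
elim: n i => [|n IH] i; first by rewrite !big_geq// subr0 addr0.
rewrite !massS /push (nb_1 nb1) (tb_g21 tb).
rewrite -[g2 (right_orbit i)]/(right_orbit i.+1).
rewrite (sum_shift (fun m l => mass k F p m c -
  mass k F p m (g1 (right_orbit l)))).
rewrite (sum_shift (fun m l => k * dens k F p m c * (1 - right_orbit l))).
rewrite addSnnS; have := IH i.+1.
set S1 := \sum_(0 <= j < n) _; set S2 := \sum_(0 <= j < n) _ => E.
rewrite (_ : F 1 - F (right_orbit (n + i.+1)) =
  mass k F p n 1 - mass k F p n (right_orbit i.+1) - S1 + S2); last first.
  by rewrite E; ring.
ring.
Qed.

(** The part removed at time [j] evolves freely as a uniform density during the
    remaining [n - j - 1] steps; [push] is linear. *)
Lemma mass_decomposition F p n t : mass 0 F p n t =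
  \sum_(0 <= j < n) kappa * dens kappa F p j c *
    mass 0 id (fun=> 1) (n - j.+1)%N t + mass kappa F p n t.
Proof.
elim: n t => [|n IH] t; first by rewrite big_geq// add0r.
have V0 s : mass 0 id (fun=> 1) 0 s = s by [].
rewrite [LHS]massS massS big_nat_recr//= subnn V0 mul0r mul0r subr0 /push !IH.
have -> : \sum_(0 <= j < n) kappa * dens kappa F p j c *
    mass 0 id (fun=> 1) (n.+1 - j.+1)%N t =
  \sum_(0 <= j < n) kappa * dens kappa F p j c *
    mass 0 id (fun=> 1) (n - j.+1)%N (g1 t) +
  \sum_(0 <= j < n) kappa * dens kappa F p j c *
    mass 0 id (fun=> 1) (n - j.+1)%N (g2 t) -
  \sum_(0 <= j < n) kappa * dens kappa F p j c *
    mass 0 id (fun=> 1) (n - j.+1)%N c.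
  rewrite -big_split -sumrB/=; apply: eq_big_nat => j /andP[_ jn].
  rewrite subSS -subnSK// massS /push mul0r mul0r subr0; ring.
ring.
Qed.

Lemma dens_ge0 (k : R) F p n : 0 <= k <= kappa ->
  (exists dp, regular K F p dp) -> 0 <= dens k F p n c.
Proof.
move=> kk rg; have [dp rgn] := evolve_regular n kk rg.
by apply: (rg_ge0 rgn); exact: (tb_c tb).
Qed.

Lemma mass_ge0 (k t : R) F p n : 0 <= k <= kappa ->
  (exists dp, regular K F p dp) -> 0 <= t <= 1 ->
  0 <= mass k F p n t <= mass k F p n 1.
Proof.
move=> kk rg /andP[t0 t1]; have [dp rgn] := evolve_regular n kk rg.
rewrite -{1}(rg_0 rgn); apply/andP.
by split; apply: (regular_le rgn).
Qed.

Lemma residual_kappa : 0 <= kappa <= kappa.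
Proof. by rewrite lexx ltW. Qed.

Lemma residual_null : (0 : R) <= 0 <= kappa.
Proof. by rewrite lexx ltW. Qed.

Lemma residual_sum_le F p n : (exists dp, regular K F p dp) ->
  \sum_(0 <= j < n) kappa * dens kappa F p j c <= F 1.
Proof.
move=> rg; rewrite -subr_ge0 -mass1.
by have /andP[] := @mass_ge0 kappa 1 F p n residual_kappa rg ltac:(lra).
Qed.

Lemma regular_entry_le : exists2 C : R, 0 <= C & forall F p dp j,
  regular K F p dp ->
  F (g2 (left_orbit j)) - F c <= C * (p c * left_gap j) /\
  F c - F (g1 (right_orbit j)) <= C * (p c * right_gap j).
Proof.
have [B B0 HB] := regular_entry; exists (expR B); first exact: expR_ge0.
move=> F p dp j rg; have c01 := tb_c tb.
have pc0 : 0 <= p c by exact: (rg_ge0 rg).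
have /andP[l0 l1] := left_gap_bounds j; have /andP[r0 r1] := right_gap_bounds j.
have g1c : 0 < g1 c by apply: (nb_gt0 nb1); lra.
have g2c : g2 c < 1 by have := @tb_g2_01 _ _ _ _ _ _ _ _ _ _ tb c; lra.
have g1cc : g1 c <= c by apply: (nb_lec nb1); lra.
have g2cc : c <= g2 c by apply: (tb_g2_ge tb); lra.
split.
  have /andP[_] := HB F p dp c (g2 (left_orbit j)) rg g1cc (lexx _)
    ltac:(by move: l0; rewrite /left_gap; lra) ltac:(by move: l1; rewrite /left_gap; lra).
  move=> /le_trans; apply; rewrite -/(left_gap j) ler_wpM2r//.
    by rewrite mulr_ge0// ltW.
  by rewrite ler_expR ler_piMr//; lra.
have /andP[_] := HB F p dp (g1 (right_orbit j)) c rg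
  ltac:(by move: r1; rewrite /right_gap; lra) ltac:(by move: r0; rewrite /right_gap; lra)
  (lexx _) g2cc.
move=> /le_trans; apply; rewrite -/(right_gap j) ler_wpM2r//.
  by rewrite mulr_ge0// ltW.
by rewrite ler_expR ler_piMr//; lra.
Qed.

(** The amounts removed add up to at most the initial mass, hence are summable
    and the density at the cut is too. By [mass_left] and [mass_right], the
    residual mass is bounded by the initial mass near the two ends and by the
    convolution of this summable sequence with the gaps, which tend to 0. *)
Lemma residual_mass_cvg0 F p : (exists dp, regular K F p dp) ->
  mass kappa F p n 1 @[n --> \oo] --> 0.
Proof.
move=> rg; have [C C0 HC] := regular_entry_le.
have [dp0 rg0] := rg.
have c01 := tb_c tb.
pose a j := kappa * dens kappa F p j c.
have a0 j : 0 <= a j.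
  by rewrite mulr_ge0 ?(ltW kappa0)// dens_ge0 ?residual_kappa.
(* The removed amount is [kappa] times the density at the cut. *)
pose b j := C / kappa * (left_gap j + right_gap j).
pose U n := F (left_orbit n) + (F 1 - F (right_orbit n)) +
  \sum_(0 <= j < n) a (n - j.+1)%N * b j.
have Ucvg : U @ \oo --> 0.
  have -> : (0 : R) = F 0 + (F 1 - F 1) + 0 by rewrite (rg_0 rg0) subrr !addr0.
  apply: cvgD.
    apply: cvgD.
      apply: within_cvg_seq (rg_cont rg0) _ _ left_orbit_cvg.
        by rewrite /= in_itv/= lexx ler01.
      by move=> n; have := left_orbit_bounds n; rewrite /= in_itv/=; lra.
    apply: cvgB; first exact: cvg_cst.
    apply: within_cvg_seq (rg_cont rg0) _ _ right_orbit_cvg.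
      by rewrite /= in_itv/= lexx ler01.
    by move=> n; have := right_orbit_bounds n; rewrite /= in_itv/=; lra.
  apply: (@convolution_cvg0 _ a b (F 1)) => //.
    by move=> n; exact: residual_sum_le.
  have -> : (0 : R) = C / kappa * (0 + 0) by rewrite addr0 mulr0.
  by apply: cvgM; [exact: cvg_cst|apply: cvgD; [exact: left_gap_cvg0|exact: right_gap_cvg0]].
apply: (squeeze_cvgr _ (cvg_cst 0) Ucvg); near=> n.
have /andP[-> _]/= := @mass_ge0 kappa 1 F p n residual_kappa rg ltac:(lra).
have El := mass_left kappa F p n 0; have Er := mass_right kappa F p n 0.
rewrite -[left_orbit 0]/c addn0 in El; rewrite -[right_orbit 0]/c addn0 in Er.
rewrite -[leLHS](subrK (mass kappa F p n c)) Er El /U.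
have Sl : \sum_(0 <= j < n) (mass kappa F p (n - j.+1)%N (g2 (left_orbit (0 + j)))
    - mass kappa F p (n - j.+1)%N c) +
   \sum_(0 <= j < n) (mass kappa F p (n - j.+1)%N c -
    mass kappa F p (n - j.+1)%N (g1 (right_orbit (0 + j)))) <=
   \sum_(0 <= j < n) a (n - j.+1)%N * b j.
  rewrite -big_split/=; apply: ler_sum_nat => j _; rewrite add0n.
  have [dp rgn] := evolve_regular (n - j.+1)%N residual_kappa rg.
  have [H1 H2] := HC _ _ _ j rgn.
  apply: le_trans (lerD H1 H2) _.
  rewrite /a /b le_eqVlt; apply/orP; left; apply/eqP.
  by field; rewrite gt_eqF.
have P1 : 0 <= \sum_(0 <= j < n) kappa * dens kappa F p (n - j.+1)%N c *
    left_orbit (0 + j).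
  apply: sumr_ge0 => j _; apply: mulr_ge0; first exact: a0.
  by have := left_orbit_bounds (0 + j)%N; lra.
have P2 : 0 <= \sum_(0 <= j < n) kappa * dens kappa F p (n - j.+1)%N c *
    (1 - right_orbit (0 + j)).
  apply: sumr_ge0 => j _; apply: mulr_ge0; first exact: a0.
  by have := right_orbit_bounds (0 + j)%N; lra.
lra.
Unshelve. all: by end_near. Qed.

Lemma residual_sum_cvg F p : (exists dp, regular K F p dp) ->
  \sum_(0 <= j < n) kappa * dens kappa F p j c @[n --> \oo] --> F 1.
Proof.
move=> rg.
rewrite (_ : (fun n => _) = fun n => F 1 - mass kappa F p n 1); last first.
  by apply/funext => n; rewrite mass1 subKr.
rewrite -[X in _ --> X]subr0; apply: cvgB; first exact: cvg_cst.
exact: residual_mass_cvg0.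
Qed.

Let V := mass 0 id (fun=> 1).
Let u n := dens 0 id (fun=> 1) n c.

Let u_ge0 n : 0 <= u n.
Proof. by apply: dens_ge0; [exact: residual_null|exact: regular_id]. Qed.

Let V1 n : V n 1 = 1.
Proof. by rewrite /V mass1 big1 ?subr0// => j _; rewrite mul0r. Qed.

Let V01 n (t : R) : 0 <= t <= 1 -> 0 <= V n t <= 1.
Proof.
by move=> t01; have := mass_ge0 n residual_null regular_id t01; rewrite -/V V1.
Qed.

Let Vreg n : exists dp : R -> R, regular K (V n) (dens 0 id (fun=> 1) n) dp.
Proof. by apply: evolve_regular; [exact: residual_null|exact: regular_id]. Qed.

(** For the uniform density, [mass_decomposition] is a renewal equation; its
    first coefficient [kappa] is positive. *)
Lemma uniform_increment_cvg0 (t : R) : 0 <= t <= 1 ->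
  V n.+1 t - V n t @[n --> \oo] --> 0.
Proof.
move=> t01.
apply: (@renewal_increment_cvg0 _ (fun j => kappa * dens kappa id (fun=> 1) j c)
   (fun n => V n t) (fun n => mass kappa id (fun=> 1) n t)).
- move=> j; rewrite mulr_ge0 ?(ltW kappa0)// dens_ge0 ?residual_kappa//.
  exact: regular_id.
- by rewrite /dens/= mulr1.
- by move=> n; apply: residual_sum_le; exact: regular_id.
- by move=> n; have /andP[H1 H2] := V01 n t01; rewrite ger0_norm.
- by move=> n; exact: mass_decomposition.
- apply: (squeeze_cvgr _ (cvg_cst 0) (residual_mass_cvg0 regular_id)).
  by apply: nearW => n; apply: mass_ge0 => //; [exact: residual_kappa|exact: regular_id].
Qed.

Hypothesis left_gap_diverges :
  forall M : R, exists J, M < \sum_(0 <= j < J) left_gap j.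

Let VcE n : V n c = left_orbit n + \sum_(0 <= j < n)
  (V (n - j.+1)%N (g2 (left_orbit j)) - V (n - j.+1)%N c).
Proof.
have := mass_left 0 id (fun=> 1) n 0; rewrite -[left_orbit 0]/c addn0 -/V => ->.
rewrite [X in _ - X]big1 ?subr0// => j _; by rewrite !mul0r.
Qed.

Let VcE' n : 1 - V n c = 1 - right_orbit n + \sum_(0 <= j < n)
  (V (n - j.+1)%N c - V (n - j.+1)%N (g1 (right_orbit j))).
Proof.
have := mass_right 0 id (fun=> 1) n 0; rewrite -[right_orbit 0]/c addn0 -/V V1 => ->.
rewrite [X in _ - X]big1 ?subr0// => j _; by rewrite !mul0r.
Qed.

Let entry_bounds : exists2 B : R, 0 <= B & forall n j,
  expR (- (B * left_gap j)) * (u n * left_gap j) <=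
    V n (g2 (left_orbit j)) - V n c <=
    expR (B * left_gap j) * (u n * left_gap j) /\
  expR (- (B * right_gap j)) * (u n * right_gap j) <=
    V n c - V n (g1 (right_orbit j)) <=
    expR (B * right_gap j) * (u n * right_gap j).
Proof.
have [B B0 HB] := regular_entry; exists B => // n j; have c01 := tb_c tb.
have [dp rg] := Vreg n.
have /andP[l0 l1] := left_gap_bounds j; have /andP[r0 r1] := right_gap_bounds j.
have g1cc : g1 c <= c by apply: (nb_lec nb1); lra.
have g2cc : c <= g2 c by apply: (tb_g2_ge tb); lra.
split.
  by apply: (HB _ _ _ c (g2 (left_orbit j)) rg g1cc (lexx _));
    [move: l0; rewrite /left_gap; lra|move: l1; rewrite /left_gap; lra].
by apply: (HB _ _ _ (g1 (right_orbit j)) c rg _ _ (lexx _) g2cc);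
  [move: r1; rewrite /right_gap; lra|move: r0; rewrite /right_gap; lra].
Qed.

(** The mass [w n] of [[c, g2 c]] is comparable to the density [u n] at the cut,
    and varies slowly since the distribution functions do. The mass entered on the
    left bounds its convolution with the left gaps, which are not summable. *)
Lemma density_at_cut_cvg0 : u @ \oo --> 0.
Proof.
have c01 := tb_c tb.
have [B B0 HB] := entry_bounds.
have := left_gap_bounds 0; set d := left_gap 0 => /andP[d0 d1].
pose w n := V n (g2 c) - V n c.
have wl n : expR (- (B * d)) * (u n * d) <= w n by have [/andP[]] := HB n 0%N.
have wu n : w n <= expR (B * d) * (u n * d) by have [/andP[]] := HB n 0%N.
have g2c : c <= g2 c <= 1.
  have := @tb_g2_01 _ _ _ _ _ _ _ _ _ _ tb c.
  by move: d0; rewrite /d /left_gap /left_orbit/=; lra.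
have w0 : w @ \oo --> 0.
  apply: (@slowly_varying_cvg0 _ w left_gap (expR (B * d) * d * expR B)).
  - by move=> n; apply: le_trans (wl n); rewrite mulr_ge0 ?expR_ge0// mulr_ge0 ?u_ge0// ltW.
  - by move=> j; have /andP[/ltW] := left_gap_bounds j.
  - rewrite (_ : (fun n => _) = fun n =>
        (V n.+1 (g2 c) - V n (g2 c)) - (V n.+1 c - V n c)); last first.
      by apply/funext => n; rewrite /w; ring.
    rewrite -[X in _ --> X]subr0.
    by apply: cvgB; apply: uniform_increment_cvg0; lra.
  - move=> n.
    apply: (@le_trans _ _ (\sum_(0 <= j < n) expR (B * d) * d * expR B *
        (V (n - j.+1)%N (g2 (left_orbit j)) - V (n - j.+1)%N c))).
      apply: ler_sum_nat => j _.
      have /andP[l0 l1] := left_gap_bounds j.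
      have [/andP[H _] _] := HB (n - j.+1)%N j.
      rewrite -mulrA.
      apply: (@le_trans _ _ (expR (B * d) * d * (u (n - j.+1)%N * left_gap j))).
        rewrite [leRHS](_ : _ = expR (B * d) * (u (n - j.+1)%N * d) * left_gap j).
          by rewrite ler_wpM2r// ltW.
        by ring.
      rewrite ler_wpM2l ?mulr_ge0 ?expR_ge0 ?(ltW d0)//.
      rewrite -(ler_pM2l (expR_gt0 (- B))) [leRHS]mulrA [expR (- B) * expR B]mulrC expRxMexpNx_1.
      rewrite mul1r; apply: le_trans H.
      rewrite ler_wpM2r ?mulr_ge0 ?u_ge0 ?(ltW l0)// ler_expR lerN2 ler_piMr//; lra.
    rewrite -mulr_sumr ler_piMr ?mulr_ge0 ?expR_ge0 ?(ltW d0)//.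
    have := VcE n; have := @V01 n c ltac:(lra); have := left_orbit_bounds n; lra.
  - exact: left_gap_diverges.
pose m := expR (- (B * d)) * d.
have m0 : 0 < m by rewrite mulr_gt0// expR_gt0.
have wm : w n / m @[n --> \oo] --> 0.
  by rewrite -[X in _ --> X](mul0r m^-1); apply: cvgM => //; exact: cvg_cst.
apply: (squeeze_cvgr _ (cvg_cst 0) wm); apply: nearW => n.
rewrite u_ge0/= ler_pdivlMr//; apply: le_trans (wl n).
by rewrite /m le_eqVlt; apply/orP; left; apply/eqP; ring.
Qed.

Variable rho : R.
Hypothesis rho_ge0 : 0 <= rho.
Hypothesis gap_ratio : left_gap j / right_gap j @[j --> \oo] --> rho.

(** The [j]-th terms of [mass_left] and [mass_right] are close to
    [u (n - j - 1) * left_gap j] and [u (n - j - 1) * right_gap j], whose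
    quotient tends to [rho]. The relative error [e j] tends to 0 and is averaged
    with weights of bounded sum, each of which tends to 0 because [u] does. *)
Lemma uniform_mass_at_cut_cvg : V n c @[n --> \oo] --> rho / (1 + rho).
Proof.
have c01 := tb_c tb.
have [B B0 HB] := entry_bounds.
pose e j := `|left_gap j / right_gap j - rho| +
  left_gap j / right_gap j * (expR (B * left_gap j) - 1) +
  rho * (expR (B * right_gap j) - 1).
have exp_cvg (s : R^nat) : s @ \oo --> 0 -> expR (B * s j) - 1 @[j --> \oo] --> 0.
  move=> s0; rewrite -[X in _ --> X](subrr 1); apply: cvgB; last exact: cvg_cst.
  rewrite -expR0 -(mulr0 B).
  apply: continuous_cvg; first exact: continuous_expR.
  by apply: cvgM => //; exact: cvg_cst.
have e0 : e @ \oo --> 0.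
  have -> : (0 : R) = `|rho - rho| + rho * 0 + rho * 0.
    by rewrite subrr normr0 mulr0 !addr0.
  apply: cvgD; first apply: cvgD.
  - by apply: cvg_norm; apply: cvgB => //; exact: cvg_cst.
  - by apply: cvgM => //; apply: exp_cvg; exact: left_gap_cvg0.
  - by apply: cvgM; [exact: cvg_cst|apply: exp_cvg; exact: right_gap_cvg0].
pose W n j := u (n - j.+1)%N * right_gap j.
have We : \sum_(0 <= j < n) W n j * e j @[n --> \oo] --> 0.
  apply: (@toeplitz _ W e (expR B)).
  - by move=> n j; rewrite /W mulr_ge0 ?u_ge0// ltW//; have /andP[] := right_gap_bounds j.
  - move=> n; apply: (@le_trans _ _ (\sum_(0 <= j < n) expR B *
        (V (n - j.+1)%N c - V (n - j.+1)%N (g1 (right_orbit j))))).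
      apply: ler_sum_nat => j _.
      have /andP[r0 r1] := right_gap_bounds j.
      have [_ /andP[H _]] := HB (n - j.+1)%N j.
      rewrite -(ler_pM2l (expR_gt0 (- B))) [leRHS]mulrA [expR (- B) * expR _]mulrC.
      rewrite expRxMexpNx_1 mul1r; apply: le_trans H.
      rewrite /W ler_wpM2r ?mulr_ge0 ?u_ge0 ?(ltW r0)// ler_expR lerN2 ler_piMr//.
      have : 0 < g1 c by apply: (nb_gt0 nb1); lra.
      lra.
    rewrite -mulr_sumr ler_piMr ?expR_ge0//.
    have := VcE' n; have := @V01 n c ltac:(lra); have := right_orbit_bounds n; lra.
  - move=> j; rewrite -[X in _ --> X](mul0r (right_gap j)).
    apply: cvgM; last exact: cvg_cst.
    have /cvgrPdist_le u0 := density_at_cut_cvg0.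
    apply/cvgrPdist_le => eps /u0[N _ HN]; exists (N + j.+1)%N => // n /= Nn.
    by apply: HN => /=; lia.
  - exact: e0.
have diff0 : V n c - rho * (1 - V n c) @[n --> \oo] --> 0.
  have orb0 : left_orbit n + rho * (1 - right_orbit n) @[n --> \oo] --> 0.
    have -> : (0 : R) = 0 + rho * (1 - 1) by rewrite subrr mulr0 addr0.
    apply: cvgD; first exact: left_orbit_cvg.
    apply: cvgM; first exact: cvg_cst.
    by apply: cvgB; [exact: cvg_cst|exact: right_orbit_cvg].
  have tot : left_orbit n + rho * (1 - right_orbit n) +
      \sum_(0 <= j < n) W n j * e j @[n --> \oo] --> 0.
    by rewrite -[X in _ --> X]addr0; apply: cvgD.
  apply/cvgr0Pnorm_le => eps eps0.
  have /cvgr0Pnorm_le/(_ _ eps0)[N _ HN] := tot.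
  exists N => // n /HN /=; apply: le_trans.
  have lo := left_orbit_bounds n; have ro := right_orbit_bounds n.
  rewrite [leRHS]ger0_norm; last first.
    apply: addr_ge0; first by apply: addr_ge0; [lra|apply: mulr_ge0 => //; lra].
    apply: sumr_ge0 => j _.
    have /andP[l0 l1] := left_gap_bounds j; have /andP[r0 r1] := right_gap_bounds j.
    rewrite /W mulr_ge0 ?mulr_ge0 ?u_ge0 ?(ltW r0)// /e !addr_ge0//.
      by rewrite mulr_ge0// ?divr_ge0 ?(ltW l0) ?(ltW r0)// subr_ge0 -expR0 ler_expR mulr_ge0// ltW.
    by rewrite mulr_ge0// subr_ge0 -expR0 ler_expR mulr_ge0// ltW.
  rewrite VcE' {1}VcE mulrDr mulr_sumr opprD addrACA -sumrB.
  apply: le_trans (ler_normD _ _) _; apply: lerD.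
    apply: le_trans (ler_normB _ _) _.
    have rr : 0 <= rho * (1 - right_orbit n) by apply: mulr_ge0 => //; lra.
    by rewrite (ger0_norm rr) ger0_norm//; lra.
  apply: le_trans (ler_norm_sum _ _ _) _; apply: ler_sum_nat => j _.
  have /andP[l0 l1] := left_gap_bounds j; have /andP[r0 r1] := right_gap_bounds j.
  have [/andP[A1 A2] /andP[B1 B2]] := HB (n - j.+1)%N j.
  set A := V _ _ - V _ _ in A1 A2 *.
  set A' := V _ _ - V _ _ in B1 B2 *.
  have exp_dev (s v x : R) : 0 <= s -> 0 <= v ->
      expR (- (B * s)) * v <= x -> x <= expR (B * s) * v ->
      `|x - v| <= v * (expR (B * s) - 1).
    move=> s0 v0 H1 H2; rewrite ler_norml; apply/andP; split; last first.
      by move: H2; rewrite mulrBr mulr1 mulrC; lra.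
    have : 2 <= expR (- (B * s)) + expR (B * s).
      have := expR_ge1Dx (- (B * s)); have := expR_ge1Dx (B * s); lra.
    move=> /(ler_wpM2r v0); move: H1.
    move: (expR (B * s)) (expR (- (B * s))) => a b; lra.
  have u0 := u_ge0 (n - j.+1)%N.
  have Al := exp_dev _ _ _ (ltW l0) (mulr_ge0 u0 (ltW l0)) A1 A2.
  have Ar := exp_dev _ _ _ (ltW r0) (mulr_ge0 u0 (ltW r0)) B1 B2.
  have -> : W n j * e j =
      u (n - j.+1)%N * right_gap j * `|left_gap j / right_gap j - rho| +
      u (n - j.+1)%N * left_gap j * (expR (B * left_gap j) - 1) +
      rho * (u (n - j.+1)%N * right_gap j * (expR (B * right_gap j) - 1)).
    by rewrite /W /e; field; rewrite gt_eqF.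
  have -> : A - rho * A' = u (n - j.+1)%N * right_gap j *
      (left_gap j / right_gap j - rho) + (A - u (n - j.+1)%N * left_gap j) -
      rho * (A' - u (n - j.+1)%N * right_gap j).
    by field; rewrite gt_eqF.
  apply: le_trans (ler_normB _ _) _; apply: lerD; last first.
    by rewrite normrM (ger0_norm rho_ge0) ler_wpM2l.
  apply: le_trans (ler_normD _ _) _; apply: lerD => //.
  by rewrite normrM ger0_norm// mulr_ge0// ltW.
rewrite (_ : (fun n => V n c) = fun n =>
    (rho + (V n c - rho * (1 - V n c))) / (1 + rho)); last first.
  apply/funext => n; rewrite [X in X / _](_ : _ = V n c * (1 + rho)); last by ring.
  by rewrite mulfK// gt_eqF// ltr_pwDl.
apply: cvgM; last exact: cvg_cst.
rewrite -[X in _ --> X]addr0; apply: cvgD; first exact: cvg_cst.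
exact: diff0.
Qed.

(** No mass remains between the cut and [t], since the density at the cut
    vanishes in the limit. *)
Lemma uniform_mass_cvg (t : R) : 0 < t < 1 ->
  V n t @[n --> \oo] --> rho / (1 + rho).
Proof.
move=> /andP[t0 t1]; have /andP[c0 c1] := tb_c tb.
have [C C0 HC] : exists2 C : R, 0 <= C & forall n, `|V n t - V n c| <= C * u n.
  have [tc|/ltW ct] := leP t c.
    have [C C0 HC] := regular_mass_le t0 tc c1; exists C => // n.
    have [dp rg] := Vreg n; have := HC _ _ _ rg.
    by rewrite distrC ger0_norm// subr_ge0; apply: (regular_le rg); lra.
  have [C C0 HC] := regular_mass_le c0 ct t1; exists C => // n.
  have [dp rg] := Vreg n; have := HC _ _ _ rg.
  by rewrite ger0_norm// subr_ge0; apply: (regular_le rg); lra.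
rewrite (_ : (fun n => V n t) = fun n => V n c + (V n t - V n c)); last first.
  by apply/funext => n; rewrite addrC subrK.
rewrite -[X in _ --> X]addr0; apply: cvgD; first exact: uniform_mass_at_cut_cvg.
have Cu : C * u n @[n --> \oo] --> 0.
  rewrite -[X in _ --> X](mulr0 C); apply: cvgM; first exact: cvg_cst.
  exact: density_at_cut_cvg0.
apply/cvgr0Pnorm_le => eps eps0.
have /cvgr0Pnorm_le/(_ _ eps0)[N _ HN] := Cu.
exists N => // n /HN /=; rewrite ger0_norm ?mulr_ge0 ?u_ge0//.
exact: le_trans (HC n).
Qed.

(** The superposition of uniform densities inherits their limit, because the
    weights add up to the initial mass. *)
Lemma mass_cvg F p (t : R) : (exists dp, regular K F p dp) -> 0 < t < 1 ->
  mass 0 F p n t @[n --> \oo] --> F 1 * (rho / (1 + rho)).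
Proof.
move=> rg t01; set l := rho / (1 + rho).
pose a j := kappa * dens kappa F p j c.
have a0 j : 0 <= a j.
  by rewrite mulr_ge0 ?(ltW kappa0)// dens_ge0 ?residual_kappa.
rewrite (_ : (fun n => _) = fun n =>
    \sum_(0 <= j < n) a (n - j.+1)%N * (V j t - l) +
    (\sum_(0 <= j < n) a j) * l + mass kappa F p n t); last first.
  apply/funext => n; rewrite mass_decomposition; congr (_ + _).
  rewrite -/V (@convolution_rev _ a (fun m => V m t)) mulr_suml.
  have /= -> := @convolution_rev _ a (fun=> l) n.
  rewrite -big_split/=.
  by apply: eq_bigr => j _; ring.
rewrite -[X in _ --> X]addr0 -[X in _ --> X + _]add0r.
apply: cvgD; last first.
  apply: (squeeze_cvgr _ (cvg_cst 0) (residual_mass_cvg0 rg)).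
  by apply: nearW => n; apply: mass_ge0 => //; [exact: residual_kappa|lra].
apply: cvgD; last first.
  by apply: cvgM; [exact: residual_sum_cvg|exact: cvg_cst].
apply: (@convolution_cvg0 _ a (fun m => V m t - l) (F 1)) => //.
  by move=> n; exact: residual_sum_le.
rewrite -[X in _ --> X](subrr l); apply: cvgB; last exact: cvg_cst.
exact: uniform_mass_cvg.
Qed.

End Evolution.

(** * Asymptotics of neutral orbits *)

Section OrbitAsymptotics.
Context {R : realType}.

Lemma powR_increment_cvg (be : R) (u : R^nat) :
  (forall n, u n != 0) -> u @ \oo --> 0 ->
  (1 - (1 + u n) `^ (- be)) / u n @[n --> \oo] --> be.
Proof.
move=> un0 u0.
have H : is_derive (1 : R) 1 ((@powR R)^~ (- be)) (- be).
  by have := @is_derive1_powR R (- be) 1 ltr01; rewrite powR1 mulr1.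
have /cvgr_dnbhsP : h^-1 *: (((h *: 1 + 1) `^ (- be) : R) - 1 `^ (- be)) @[h --> 0^'] --> - be.
  have [H1 H2] := H; rewrite -[X in _ --> X]H2; exact: H1.
move=> /(_ u) => /(_ (conj un0 u0)) /cvgN; rewrite opprK.
apply: cvg_trans; apply: near_eq_cvg; apply: nearW => n.
rewrite [LHS](_ : _ = - ((u n)^-1 * ((u n * 1 + 1) `^ (- be) - 1 `^ (- be))))//.
by rewrite mulr1 powR1 [u n + 1]addrC; field.
Qed.

(** The increments of [x n `^ (- al^-1)] tend to [b / al], by a first-order
    expansion of the power; by Cesaro, so does this sequence divided by [n]. *)
Lemma neutral_orbit_asymptotics (al b : R) (F : R -> R) (x : R^nat) :
  0 < al -> 0 < b ->
  (F t - t) / (b * t `^ (1 + al^-1)) @[t --> 0^'+] --> (1 : R) ->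
  (forall n, 0 < x n) -> (forall n, F (x n.+1) = x n) -> x @ \oo --> 0 ->
  x n * n%:R `^ al @[n --> \oo] --> (b / al) `^ (- al).
Proof.
move=> al0 b0 asF x0 Fx xc.
pose be := al^-1; have be0 : 0 < be by rewrite invr_gt0.
pose r n := (F (x n.+1) - x n.+1) / (b * x n.+1 `^ (1 + be)).
have xS0 : x n.+1 @[n --> \oo] --> 0 by rewrite (cvg_shiftS x).
have r1 : r @ \oo --> (1 : R).
  by have /cvg_at_rightP := asF; apply.
pose u n := b * x n.+1 `^ be * r n.
have xp n : 0 < x n.+1 `^ be by exact: powR_gt0.
have uE n : x n = x n.+1 * (1 + u n).
  rewrite -[LHS]Fx /u /r -/be powRD; last by rewrite (gt_eqF (x0 _)) implybT.
  rewrite powRr1; last exact: ltW.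
  by field; rewrite !gt_eqF.
have xbe0 : x n.+1 `^ be @[n --> \oo] --> 0.
  by have /cvg_at_rightP := powR_cvg0 be0; apply.
have u0 : u @ \oo --> 0.
  have -> : (0 : R) = b * 0 * 1 by rewrite mulr0 mul0r.
  by apply: cvgM => //; apply: cvgM => //; exact: cvg_cst.
have [N _ HN] : \forall n \near \oo, u n != 0.
  have /cvgrPdist_lt/(_ _ (@ltr01 R))[N _ HN] := r1.
  exists N => // n /HN /=; rewrite ltr_norml => rn.
  have rn0 : 0 < r n by lra.
  by apply: lt0r_neq0; rewrite /u; apply: mulr_gt0 => //; apply: mulr_gt0 => //; exact: xp.
have u1 n : 0 < 1 + u n.
  by rewrite -(pmulr_rgt0 _ (x0 n.+1)) -uE.
pose z n := x n `^ (- be).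
pose d n := z n.+1 - z n.
have dE n : u n != 0 -> d n = b * r n * ((1 - (1 + u n) `^ (- be)) / u n).
  move=> un0; rewrite /d /z [x n]uE powRM; [|exact: ltW|exact: ltW].
  rewrite {1 2}powRN; have rn0 : r n != 0.
    by apply: contra_neq un0 => r0; rewrite /u r0 mulr0.
  by rewrite [X in _ / X]/u; field; rewrite rn0 !gt_eqF.
have dcvg : d @ \oo --> b * be.
  rewrite -(cvg_shiftn N).
  rewrite (_ : (fun n => _) = fun n => b * r (n + N)%N *
      ((1 - (1 + u (n + N)%N) `^ (- be)) / u (n + N)%N)); last first.
    by apply/funext => n; rewrite dE//; apply: HN; rewrite /= leq_addl.
  have -> : b * be = b * 1 * be by rewrite mulr1.
  apply: cvgM.
    by apply: cvgM; [exact: cvg_cst|rewrite (cvg_shiftn N r)].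
  apply: powR_increment_cvg; last by rewrite (cvg_shiftn N u).
  by move=> n; apply: HN; rewrite /= leq_addl.
have zn : z n / n%:R @[n --> \oo] --> b * be.
  rewrite -(cvg_shiftS (fun n => z n / n%:R)).
  have := cesaro dcvg => dm.
  have z0 : z 0%N * n.+1%:R^-1 @[n --> \oo] --> 0.
    rewrite -[X in _ --> X](mulr0 (z 0%N)); apply: cvgM; first exact: cvg_cst.
    exact: cvg_harmonic.
  have H : arithmetic_mean d n + z 0%N * n.+1%:R^-1 @[n --> \oo] --> b * be.
    by rewrite -[X in _ --> X]addr0; apply: cvgD.
  rewrite (_ : [sequence z n.+1 / n.+1%:R]_n =
    fun n => arithmetic_mean d n + z 0%N * n.+1%:R^-1); first exact: H.
  apply/funext => n; rewrite /arithmetic_mean /series/=.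
  by rewrite (telescope_sumr_eq z)//; ring.
have bbe : 0 < b * be by exact: mulr_gt0.
have pc : {for b * be, continuous (@powR R ^~ (- al))}.
  apply: differentiable_continuous; apply/derivable1_diffP.
  by have [] := @is_derive1_powR R (- al) _ bbe.
have H : (z n / n%:R) `^ (- al) @[n --> \oo] --> (b * be) `^ (- al).
  exact: (continuous_cvg _ pc zn).
apply: cvg_trans H; apply: near_eq_cvg.
exists 1%N => // n /= n1.
have n0 : (0 : R) < n%:R by rewrite ltr0n.
rewrite powRM ?powR_ge0 ?invr_ge0 ?ler0n// /z -powRrM mulrNN mulVf ?gt_eqF//.
rewrite powRr1 ?(ltW (x0 _))// -(powR_inv1 (ltW n0)) -powRrM mulrNN mul1r.
by [].
Qed.

(** As [al <= 1], the general term is at least a multiple of [1 / n], and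
    each dyadic block contributes a fixed amount. *)
Lemma harmonic_like_diverges (al L : R) (s : R^nat) : 0 < al <= 1 -> 0 < L ->
  (forall n, 0 <= s n) -> s n * n%:R `^ al @[n --> \oo] --> L ->
  forall M : R, exists J, M < \sum_(0 <= j < J) s j.
Proof.
move=> /andP[al0 al1] L0 s0 sL M.
have [N _ HN] : \forall n \near \oo, L / 2 <= s n * n%:R `^ al.
  have /cvgrPdist_le/(_ (L / 2) ltac:(by rewrite divr_gt0))[N _ HN] := sL.
  by exists N => // n /HN /=; rewrite ler_norml; lra.
have sn n : (N.+1 <= n)%N -> L / 2 / n%:R <= s n.
  move=> Nn; have n0 : (0 : R) < n%:R by rewrite ltr0n (leq_trans _ Nn).
  rewrite ler_pdivrMr//; apply: (le_trans (HN n (ltnW Nn))).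
  rewrite ler_wpM2l//; apply: ler1_powR => //.
  by rewrite ler1n (leq_trans _ Nn).
have block m : (N.+1 <= m)%N -> L / 4 <= \sum_(m <= j < m * 2) s j.
  move=> Nm; have m0 : (0 : R) < m%:R by rewrite ltr0n (leq_trans _ Nm).
  apply: (@le_trans _ _ (\sum_(m <= j < m * 2) L / 4 / m%:R)).
    rewrite sumr_const_nat -[leRHS]mulr_natr (_ : (m * 2 - m = m)%N); last lia.
    by rewrite divfK// gt_eqF.
  apply: ler_sum_nat => j /andP[mj jm]; apply: le_trans (sn j _); last lia.
  have j0 : (0 : R) < j%:R by rewrite ltr0n; lia.
  rewrite ler_pdivrMr// mulrAC ler_pdivlMr//.
  have : (j%:R : R) <= m%:R * 2 by rewrite -natrM ler_nat ltnW.
  move=> /(ler_wpM2l (ltW (divr_gt0 L0 (@ltr0n R 4)))); lra.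
have blocks k : L / 4 * k%:R <= \sum_(0 <= j < N.+1 * 2 ^ k) s j.
  elim: k => [|k IH]; first by rewrite mulr0; exact: sumr_ge0.
  rewrite expnSr mulnA (@big_cat_nat _ _ _ (N.+1 * 2 ^ k))//=; last lia.
  rewrite -[k.+1]addn1 natrD mulrDr mulr1 lerD//; apply: block.
  by rewrite leq_pmulr// expn_gt0.
exists (N.+1 * 2 ^ (Num.trunc (M / (L / 4))).+1)%N.
apply: lt_le_trans (blocks _); rewrite mulrC -ltr_pdivrMr; last by rewrite divr_gt0.
exact: truncnS_gt.
Qed.

End OrbitAsymptotics.

(** * Derivatives relative to an interval *)

Section DerivWithin.
Context {R : realType}.
Implicit Types (A : set R) (f g : R -> R).

Lemma has_deriv_withinP A g (x l : R) : has_deriv_within A g x l <->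
  forall e : R, 0 < e -> exists2 d : R, 0 < d &
    forall y : R, A y -> y != x -> `|y - x| < d ->
      `|(g y - g x) / (y - x) - l| < e.
Proof.
split => [H e e0|H].
  have /cvgrPdist_lt/(_ _ e0) := H.
  rewrite near_withinE near_withinE => -[d /= d0 Hd]; exists d => // y Ay yx xy.
  by rewrite distrC; apply: Hd => //=; rewrite distrC.
apply/cvgrPdist_lt => e e0; have [d d0 Hd] := H e e0.
rewrite near_withinE near_withinE; exists d => // y /= xy yx Ay.
by rewrite distrC; apply: Hd => //; rewrite distrC.
Qed.

Lemma within_dnbhs_proper (a b x : R) : a < b -> a <= x <= b ->
  ProperFilter (within `[a, b]%classic x^').
Proof.
move=> ab xab; apply: Build_ProperFilter; rewrite /not => -[d /= d0 Hd].
have [xb|bx] := ltP x b.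
  pose y := Num.min b (x + d / 2).
  have yP : x < y <= b /\ y <= x + d / 2.
    by rewrite /y lt_min ge_min lexx xb/= ltrDl divr_gt0// ge_min lexx orbT.
  apply: (Hd y); [|by rewrite gt_eqF//; lra|by rewrite /= in_itv/=; lra].
  by rewrite /= ltr_norml; lra.
pose y := Num.max a (x - d / 2).
have yP : a <= y < x /\ x - d / 2 <= y.
  have ax : a < x by lra.
  by rewrite /y gt_max le_max lexx ax/= gtrBl divr_gt0// le_max lexx orbT.
apply: (Hd y); [|by rewrite lt_eqF//; lra|by rewrite /= in_itv/=; lra].
by rewrite /= ltr_norml; lra.
Qed.

Lemma deriv_within_eq g (a b x l : R) : a < b -> a <= x <= b ->
  has_deriv_within `[a, b] g x l -> deriv_within `[a, b] g x = l.
Proof.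
move=> ab xab H; have PF := within_dnbhs_proper ab xab.
by apply: cvg_lim.
Qed.

Lemma has_deriv_within_is_derive g (a b x l : R) : a < x < b ->
  has_deriv_within `[a, b] g x l -> is_derive x 1 g l.
Proof.
move=> xab /has_deriv_withinP H.
have HD : h^-1 *: ((g (h *: 1 + x) : R) - g x) @[h --> 0^'] --> l.
  apply/cvgrPdist_lt => e e0; have [d d0 Hd] := H e e0.
  pose d' := Num.min d (Num.min (x - a) (b - x)).
  have d'0 : 0 < d' by rewrite !lt_min d0 !subr_gt0.
  rewrite near_withinE; exists d' => //= h /=; rewrite sub0r normrN => hd h0.
  have [hd1 hd2 hd3] : [/\ `|h| < d, `|h| < x - a & `|h| < b - x].
    by move: hd; rewrite !lt_min => /and3P[].
  have := Hd (h + x); rewrite addrK => Hh.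
  rewrite distrC /GRing.scale/= mulr1 mulrC; apply: Hh => //.
    by move: hd2 hd3; rewrite !ltr_norml /= in_itv/=; lra.
  by rewrite -subr_eq0 addrK.
by split; [apply/cvg_ex; exists l|exact: cvg_lim HD].
Qed.

Lemma is_derive_has_deriv_within A g (x l : R) : is_derive x 1 g l ->
  has_deriv_within A g x l.
Proof.
move=> [H1 H2]; apply/has_deriv_withinP => e e0.
have HD : h^-1 *: ((g (h *: 1 + x) : R) - g x) @[h --> 0^'] --> l.
  by rewrite -[X in _ --> X]H2; exact: H1.
have /cvgrPdist_lt/(_ _ e0) := HD; rewrite near_withinE => -[d /= d0 Hd].
exists d => // y _ yx yd; have := Hd (y - x).
rewrite /= sub0r normrN subr_eq0 => /(_ yd yx).
by rewrite distrC /GRing.scale/= mulr1 subrK mulrC.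
Qed.

Lemma has_deriv_within_continuous A (g g' : R -> R) :
  (forall x : R, A x -> has_deriv_within A g x (g' x)) -> {within A, continuous g}.
Proof.
move=> H; apply/within_continuousP => x Ax e e0.
have /has_deriv_withinP/(_ 1 ltr01)[d d0 Hd] := H x Ax.
pose C := `|g' x| + 1; have C0 : 0 < C by rewrite ltr_wpDl.
exists (Num.min d (e / C)); first by rewrite lt_min d0 divr_gt0.
move=> y Ay; rewrite lt_min => /andP[yd yC].
have [->|yx] := eqVneq y x; first by rewrite subrr normr0.
have yx0 : y - x != 0 by rewrite subr_eq0.
have H1 : `|(g y - g x) / (y - x)| <= C.
  rewrite -[X in `|X|](subrK (g' x)) (le_trans (ler_normD _ _))// addrC lerD2l ltW//.
  exact: Hd.
rewrite -[g y - g x](divfK yx0) normrM.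
apply: (@le_lt_trans _ _ (C * `|y - x|)); first by rewrite ler_wpM2r.
by rewrite mulrC -ltr_pdivlMr.
Qed.

Lemma has_deriv_within_reflect01 g (a b x l : R) :
  has_deriv_within `[a, b] g x l ->
  has_deriv_within `[1 - b, 1 - a] (reflect01 g) (1 - x) l.
Proof.
move=> /has_deriv_withinP H; apply/has_deriv_withinP => e e0.
have [d d0 Hd] := H e e0; exists d => // y; rewrite /= in_itv/= => yab yx yd.
have := Hd (1 - y); rewrite /= in_itv/=.
have yx' : 1 - y != x by apply: contra_neq yx => <-; rewrite subKr.
have E : 1 - y - x = - (y - (1 - x)) by ring.
rewrite {1 2}E normrN => /(_ ltac:(lra) yx' yd).
rewrite /reflect01 subKr.
rewrite (_ : 1 - g (1 - y) - (1 - g x) = - (g (1 - y) - g x)); last by ring.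
by rewrite invrN mulrN mulNr.
Qed.

End DerivWithin.

(** * Inverting an expanding branch *)

Section NeutralMap.
Context {R : realType}.

(** The expanding branch whose inverse is a [neutral_branch], with one-sided
    derivatives up to the ends of [[0, c]]. *)
Record neutral_map (c : R) (F dF ddF : R -> R) : Prop := {
  nm_c : 0 < c < 1;
  nm_der : forall x : R, 0 <= x <= c -> has_deriv_within `[0, c] F x (dF x);
  nm_der2 : forall x : R, 0 <= x <= c -> has_deriv_within `[0, c] dF x (ddF x);
  nm_cont2 : {within `[0, c], continuous ddF};
  nm_0 : F 0 = 0;
  nm_1 : F c = 1;
  nm_gt1 : forall x : R, 0 < x <= c -> 1 < dF x;
  nm_convex : exists2 e : R, 0 < e &
    forall x y : R, 0 < x -> x <= y -> y < e -> y < c -> dF x <= dF y }.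

Variables (c : R) (F dF ddF g : R -> R).
Hypothesis nm : neutral_map c F dF ddF.
Hypothesis gF : inverse_on `[0, c] `[0, 1] F g.

Lemma nm_g_itv (y : R) : 0 <= y <= 1 -> 0 <= g y <= c.
Proof.
move=> y01; have [_ H _ _] := gF.
by have := H y; rewrite /= !in_itv/=; apply.
Qed.

Lemma nm_gK (y : R) : 0 <= y <= 1 -> F (g y) = y.
Proof. by move=> y01; have [_ _ _ H] := gF; apply: H; rewrite /= in_itv/=. Qed.

Lemma nm_Kg (x : R) : 0 <= x <= c -> g (F x) = x.
Proof. by move=> y01; have [_ _ H _] := gF; apply: H; rewrite /= in_itv/=. Qed.

Lemma nm_is_derive (x : R) : 0 < x < c -> is_derive x 1 F (dF x).
Proof.
move=> xc; apply: (has_deriv_within_is_derive xc); apply: (nm_der nm); lra.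
Qed.

Lemma nm_is_derive2 (x : R) : 0 < x < c -> is_derive x 1 dF (ddF x).
Proof.
move=> xc; apply: (has_deriv_within_is_derive xc); apply: (nm_der2 nm); lra.
Qed.

Lemma nm_cont : {within `[0, c], continuous F}.
Proof.
apply: (@has_deriv_within_continuous _ _ _ dF) => x.
by rewrite /= in_itv/= => xc; exact: (nm_der nm).
Qed.

Lemma nm_cont1 : {within `[0, c], continuous dF}.
Proof.
apply: (@has_deriv_within_continuous _ _ _ ddF) => x.
by rewrite /= in_itv/= => xc; exact: (nm_der2 nm).
Qed.

Lemma nm_expands (x y : R) : 0 <= x -> x <= y -> y <= c -> y - x <= F y - F x.
Proof.
move=> x0; rewrite le_eqVlt => /predU1P[->|xy] yc; first by rewrite !subrr.
have [||z] := @MVT R F dF x y xy.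
- by move=> z; rewrite in_itv/= => xzy; apply: nm_is_derive; lra.
- apply: continuous_subspaceW nm_cont => z /=; rewrite !in_itv/=; lra.
rewrite in_itv/= => xzy ->; rewrite ler_peMl//; first lra.
by apply/ltW/(nm_gt1 nm); lra.
Qed.

(** Expansion makes the inverse 1-Lipschitz; it is increasing for the same
    reason. *)
Lemma nm_g_le (x y : R) : 0 <= x -> x <= y -> y <= 1 -> g x <= g y <= g x + (y - x).
Proof.
move=> x0 xy y1.
have x01 : 0 <= x <= 1 by lra.
have y01 : 0 <= y <= 1 by lra.
have gx := nm_g_itv x01; have gy := nm_g_itv y01.
have gxy : g x <= g y.
  rewrite leNgt; apply/negP => gyx.
  have := @nm_expands (g y) (g x); rewrite !nm_gK//; lra.
have := @nm_expands (g x) (g y); rewrite !nm_gK//; lra.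
Qed.

Lemma nm_g0 : g 0 = 0.
Proof.
have /andP[c0 c1] := nm_c nm.
by rewrite -{1}(nm_0 nm) nm_Kg//; lra.
Qed.

Lemma nm_g1 : g 1 = c.
Proof.
have /andP[c0 c1] := nm_c nm.
by rewrite -(nm_1 nm) nm_Kg//; lra.
Qed.

Lemma nm_g_lt (y : R) : 0 < y < 1 -> 0 < g y < c.
Proof.
move=> y01; have gy := @nm_g_itv y ltac:(lra).
rewrite !lt_neqAle; have /andP[-> ->] := gy; rewrite !andbT.
apply/andP; split; apply/eqP => E.
  by have := @nm_gK y ltac:(lra); rewrite -E (nm_0 nm); lra.
by have := @nm_gK y ltac:(lra); rewrite E (nm_1 nm); lra.
Qed.

Lemma nm_g_cont : {within `[0, 1], continuous g}.
Proof.
apply/within_continuousP => x; rewrite /= in_itv/= => x01 e e0.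
exists e => // y; rewrite /= in_itv/= => y01; rewrite !ltr_norml => yx.
have [xy|yx'] := leP x y.
  have := @nm_g_le x y; lra.
have := @nm_g_le y x; lra.
Qed.

Let dg (y : R) : R := (dF (g y))^-1.

Lemma nm_g_der (y : R) : 0 < y < 1 -> is_derive y 1 g (dg y).
Proof.
move=> y01; have gy := nm_g_lt y01.
have yE : F (g y) = y by apply: nm_gK; lra.
rewrite -{1}yE; apply: is_derive_inverse.
- have : \forall z \near g y, z \in `]0, c[.
    by apply: near_in_itvoo; rewrite in_itv/=.
  by apply: filterS => z; rewrite in_itv/= => zc; apply: nm_Kg; lra.
- have : \forall z \near g y, z \in `]0, c[.
    by apply: near_in_itvoo; rewrite in_itv/=.
  apply: filterS => z; rewrite in_itv/= => zc.
  apply: differentiable_continuous; apply/derivable1_diffP.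
  by have [] := nm_is_derive zc.
- exact: nm_is_derive.
- by rewrite gt_eqF// (lt_trans ltr01)// (nm_gt1 nm)//; lra.
Qed.

(** Compactness of [[0, c]] bounds the second derivative and the derivative
    from above, and the derivative from below by a number larger than 1 away
    from 0. *)
Lemma nm_branch : exists D gam (ddg : R -> R), neutral_branch c D gam g dg ddg.
Proof.
have /andP[c0 c1] := nm_c nm.
have [x1 x1c H1] := EVT_max (ltW c0) nm_cont1.
have [x2 x2c H2] := EVT_max (ltW c0) (nm_cont2 nm).
have [x3 x3c H3] := EVT_min (ltW c0) (nm_cont2 nm).
have dF0 (z : R) : 0 < z <= c -> 0 < dF z.
  by move=> zc; apply: lt_trans ltr01 (nm_gt1 nm zc).
have dFx1 : 0 < dF x1.
  apply: lt_le_trans (H1 c _); first by apply: dF0; lra.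
  by rewrite in_itv/= lexx ltW.
pose D := `|ddF x2| + `|ddF x3|.
have DD (z : R) : 0 <= z <= c -> `|ddF z| <= D.
  move=> zc; have := H2 z; have := H3 z; rewrite in_itv/= => /(_ zc) L3 /(_ zc) L2.
  have := ler_norm (ddF x2); have := ler_norm (- ddF x3); rewrite normrN.
  have := normr_ge0 (ddF x2); have := normr_ge0 (ddF x3).
  rewrite ler_norml /D; lra.
exists D, (dF x1)^-1, (fun y => - (dF (g y)) ^- 2 * (ddF (g y) * dg y)).
have dg0 (y : R) : 0 < y < 1 -> 0 < dg y.
  by move=> y01; rewrite invr_gt0; apply: dF0; have := nm_g_lt y01; lra.
have dg1 (y : R) : 0 < y < 1 -> dg y < 1.
  move=> y01; rewrite invf_lt1; first by apply: (nm_gt1 nm); have := nm_g_lt y01; lra.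
  by apply: dF0; have := nm_g_lt y01; lra.
split.
- by rewrite c0.
- by rewrite addr_ge0.
- exact: nm_g0.
- exact: nm_g1.
- exact: nm_g_cont.
- exact: nm_g_der.
- move=> y y01; have gy := nm_g_lt y01.
  have H := is_derive1_comp (nm_is_derive2 gy) (nm_g_der y01).
  have := is_deriveV _ H; rewrite /=; apply.
  by rewrite gt_eqF// dF0//; lra.
- move=> y y01; have gy := nm_g_lt y01; have g0 := dg0 y y01; have g1 := dg1 y y01.
  have -> : - dF (g y) ^- 2 * (ddF (g y) * dg y) = - (ddF (g y) * (dg y) ^+ 2 * dg y).
    by rewrite /dg exprVn; ring.
  rewrite normrN !normrM (gtr0_norm g0) ler_wpM2r ?(ltW g0)//.
  rewrite ?(gtr0_norm g0); apply: le_trans (DD (g y) _); last lra.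
  by rewrite ler_piMr// mulr_ile1// ltW.
- by rewrite invr_gt0.
- move=> y y01; have gy := nm_g_lt y01.
  rewrite lef_pV2 ?posrE//; last by apply: dF0; lra.
  by apply: H1; rewrite in_itv/=; lra.
- move=> e e0; have [e1|e1] := leP 1 e.
    by exists 0; [rewrite lexx ltr01|move=> x; lra].
  have ge : 0 < g e < c by apply: nm_g_lt; rewrite e0.
  have gec : g e <= c by lra.
  have [x4 x4c H4] : exists2 x4, x4 \in `[g e, c] &
      forall t, t \in `[g e, c] -> dF x4 <= dF t.
    apply: EVT_min gec _; apply: continuous_subspaceW nm_cont1 => z /=.
    by rewrite !in_itv/=; lra.
  rewrite in_itv/= in x4c.
  have d1 : 1 < dF x4 by apply: (nm_gt1 nm); lra.
  have d0 := lt_trans ltr01 d1.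
  exists (dF x4)^-1; first by rewrite invr_ge0 (ltW d0) invf_lt1.
  move=> x ex; have gx := @nm_g_lt x ltac:(lra).
  rewrite lef_pV2 ?posrE//; last by apply: dF0; lra.
  by apply: H4; rewrite in_itv/=; have := @nm_g_le e x; lra.
- have [e e0 He] := nm_convex nm; exists e => // x y x0 xy ye y1.
  have gx := @nm_g_lt x ltac:(lra); have gy := @nm_g_lt y ltac:(lra).
  have gxy := @nm_g_le x y; have gy' := @nm_g_le 0 y; rewrite nm_g0 in gy'.
  rewrite lef_pV2 ?posrE//; try by apply: dF0; lra.
  by apply: He; lra.
Qed.

Lemma nm_g_end_deriv : has_deriv_within `[0, 1] g 1 (dF c)^-1.
Proof.
have /andP[c0 c1] := nm_c nm.
have /has_deriv_withinP H := @nm_der _ _ _ _ nm c ltac:(lra).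
have dc : 1 < dF c by apply: (nm_gt1 nm); lra.
have HV : (g y - c) / (F (g y) - 1) @[y --> within `[0, 1] (1 : R)^'] --> (dF c)^-1.
  have -> : (fun y => (g y - c) / (F (g y) - 1)) =
      (fun y => ((F (g y) - F c) / (g y - c))^-1).
    by apply/funext => y; rewrite invf_div (nm_1 nm).
  apply: cvgV; first by rewrite gt_eqF// (lt_trans ltr01).
  apply/cvgrPdist_lt => e e0; have [d d0 Hd] := H e e0.
  rewrite near_withinE near_withinE; exists d => // y /= xy yx.
  rewrite in_itv/= => y01; rewrite distrC.
  have gy := nm_g_itv y01.
  apply: Hd; first by rewrite /= in_itv/=.
    by apply: contra_neq yx => E; rewrite -[y]nm_gK// E (nm_1 nm).
  have := @nm_g_le y 1; rewrite nm_g1 => H'.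
  apply: le_lt_trans xy; rewrite (@ger0_norm _ (1 - y)); last lra.
  by rewrite distrC ger0_norm; lra.
apply: cvg_trans HV; apply: near_eq_cvg.
rewrite near_withinE near_withinE; near=> y => yx; rewrite /= in_itv/= => y01.
by rewrite nm_gK// nm_g1.
Unshelve. all: by end_near. Qed.

End NeutralMap.

Lemma neutral_branch_weaken (R : realType) (c D D' gam gam' : R)
    (g dg ddg : R -> R) :
  D <= D' -> 0 < gam' <= gam -> neutral_branch c D gam g dg ddg ->
  neutral_branch c D' gam' g dg ddg.
Proof.
move=> DD /andP[g0 gg] [*]; split => //.
- exact: le_trans DD.
- move=> x x01; apply: le_trans (ler_wpM2r _ DD); first by auto.
  by apply: le_trans (_ : gam <= _); [exact: le_trans (ltW g0) gg|auto].
- by move=> x x01; apply: le_trans gg _; auto.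
Qed.

(** * The two branches of a doubly intermittent map *)

Section BranchesOfTheMap.
Context {R : realType}.

Lemma convex_slope (A : set R) (F : R -> R) (x z y : R) :
  convex_function (A : set R^o) F -> A x -> A y -> x < z < y ->
  (F z - F x) * (y - x) <= (F y - F x) * (z - x).
Proof.
move=> cF Ax Ay xzy.
have xy : 0 < y - x by lra.
have t0 : 0 <= (y - z) / (y - x) by rewrite divr_ge0; lra.
have t1 : (y - z) / (y - x) <= 1 by rewrite ler_pdivrMr// mul1r; lra.
have := cF (Itv01 t0 t1) x y; rewrite !inE => /(_ Ax Ay).
have E1 : (y - z) / (y - x) * x + (1 - (y - z) / (y - x)) * y = z.
  by field; rewrite gt_eqF.
have -> : conv (Itv01 t0 t1) (x : convex_lmodType R^o) y = z by exact: E1.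
have -> : conv (Itv01 t0 t1) (F x : R^o) (F y) =
    (y - z) / (y - x) * F x + (1 - (y - z) / (y - x)) * F y by [].
rewrite -(ler_pM2r xy).
have -> : ((y - z) / (y - x) * F x + (1 - (y - z) / (y - x)) * F y) * (y - x) =
    (y - z) * F x + (z - x) * F y by field; rewrite gt_eqF.
lra.
Qed.

(** The slope of the chord between [x] and [y] separates the two derivatives. *)
Lemma convex_deriv_le (c e : R) (F dF : R -> R) : 0 < c ->
  (forall x : R, 0 <= x <= c -> has_deriv_within `[0, c] F x (dF x)) ->
  (forall x z y : R, 0 < x -> x < z < y -> y < e -> y < c ->
     (F z - F x) * (y - x) <= (F y - F x) * (z - x)) ->
  forall x y : R, 0 < x -> x <= y -> y < e -> y < c -> dF x <= dF y.
Proof.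
move=> c0 HF slope x y x0; rewrite le_eqVlt => /predU1P[->//|xy] ye yc.
pose S := (F y - F x) / (y - x).
have yx0 : 0 < y - x by rewrite subr_gt0.
have SE : S * (y - x) = F y - F x by rewrite divfK// gt_eqF.
apply: (@le_trans _ _ S).
  rewrite leNgt; apply/negP => Sx.
  have /has_deriv_withinP/(_ (dF x - S)) := HF x ltac:(lra).
  rewrite subr_gt0 => /(_ Sx)[d d0 Hd].
  pose m := Num.min d (y - x) / 2.
  have [m0 md mxy] : [/\ 0 < m, m < d & m < y - x].
    have H : 0 < Num.min d (y - x) by rewrite lt_min d0.
    have H1 : Num.min d (y - x) <= d by rewrite ge_min lexx.
    have H2 : Num.min d (y - x) <= y - x by rewrite ge_min lexx orbT.
    by rewrite /m; split; lra.
  have := Hd (x + m).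
  have -> : x + m - x = m by ring.
  rewrite gtr0_norm// => /(_ _ _ md) H.
  have {}H : `|(F (x + m) - F x) / m - dF x| < dF x - S.
    by apply: H; [rewrite /= in_itv/=; lra|rewrite gt_eqF//; lra].
  have : (F (x + m) - F x) / m <= S.
    rewrite ler_pdivrMr// /S mulrAC ler_pdivlMr//.
    have := @slope x (x + m) y x0 ltac:(lra) ye yc.
    by have -> : x + m - x = m by ring.
  move: H; rewrite ltr_norml; lra.
rewrite leNgt; apply/negP => Sy.
have /has_deriv_withinP/(_ (S - dF y)) := HF y ltac:(lra).
rewrite subr_gt0 => /(_ Sy)[d d0 Hd].
pose m := Num.min d (y - x) / 2.
have [m0 md mxy] : [/\ 0 < m, m < d & m < y - x].
  have H : 0 < Num.min d (y - x) by rewrite lt_min d0.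
  have H1 : Num.min d (y - x) <= d by rewrite ge_min lexx.
  have H2 : Num.min d (y - x) <= y - x by rewrite ge_min lexx orbT.
  by rewrite /m; split; lra.
have := Hd (y - m).
have -> : y - m - y = - m by ring.
rewrite normrN gtr0_norm// => /(_ _ _ md) H.
have {}H : `|(F (y - m) - F y) / - m - dF y| < S - dF y.
  by apply: H; [rewrite /= in_itv/=; lra|rewrite lt_eqF//; lra].
have : S <= (F (y - m) - F y) / - m.
  rewrite invrN mulrN -mulNr opprB /S ler_pdivlMr// mulrAC ler_pdivrMr//.
  have := @slope x (y - m) y x0 ltac:(lra) ye yc.
  have -> : y - m - x = (y - x) - m by ring.
  lra.
move: H; rewrite ltr_norml; lra.
Qed.

(** An increasing function attains the extrema of its image at the ends. *)
Lemma expanding_endpoints (a b : R) (F dF : R -> R) : a < b ->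
  (forall x : R, a <= x <= b -> has_deriv_within `[a, b] F x (dF x)) ->
  (forall x : R, a < x < b -> 1 < dF x) ->
  F @` `[a, b] = `[0, 1]%classic -> F a = 0 /\ F b = 1.
Proof.
move=> ab HF dF1 im.
have cF : {within `[a, b], continuous F}.
  by apply: (@has_deriv_within_continuous _ _ _ dF) => x; rewrite /= in_itv/=; exact: HF.
have mono x y : a <= x -> x <= y -> y <= b -> F x <= F y.
  move=> ax; rewrite le_eqVlt => /predU1P[->//|xy] yb.
  have [||z] := @MVT R F dF x y xy.
  - move=> z; rewrite in_itv/= => xzy; apply: (@has_deriv_within_is_derive _ _ a b).
      lra.
    by apply: HF; lra.
  - apply: continuous_subspaceW cF => z /=; rewrite !in_itv/=; lra.
  rewrite in_itv/= => xzy E; rewrite -subr_ge0 E mulr_ge0//; last lra.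
  by rewrite (le_trans ler01)// ltW// dF1//; lra.
have F01 x : a <= x <= b -> 0 <= F x <= 1.
  move=> xab; have : `[0, 1]%classic (F x).
    by rewrite -im; exists x => //; rewrite /= in_itv/=.
  by rewrite /= in_itv/=.
have pre y : 0 <= y <= 1 -> exists2 x, a <= x <= b & F x = y.
  move=> y01; have : `[0, 1]%classic y by rewrite /= in_itv/=.
  by rewrite -im => -[x]; rewrite /= in_itv/= => xab <-; exists x.
have [x0 x0ab x0E] := pre 0 ltac:(lra); have [x1 x1ab x1E] := pre 1 ltac:(lra).
have := mono a x0; have := mono x1 b; have := F01 a; have := F01 b.
by rewrite x0E x1E; split; lra.
Qed.

Lemma extension_deriv (a b : R) (f F dF : R -> R) (x : R) :
  (forall x : R, `]a, b[%classic x -> F x = f x) ->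
  (forall x : R, a <= x <= b -> has_deriv_within `[a, b] F x (dF x)) ->
  a < x < b -> derive1 f x = dF x.
Proof.
move=> Ff HF xab.
have H : is_derive x 1 F (dF x).
  by apply: (has_deriv_within_is_derive xab); apply: HF; lra.
have nFf : \forall y \near x, F y = f y.
  have : \forall z \near x, z \in `]a, b[ by apply: near_in_itvoo; rewrite in_itv/=.
  by apply: filterS => z zab; apply: Ff.
have [_ Hv] := near_eq_is_derive nFf H.
by rewrite derive1E.
Qed.

Lemma has_deriv_within_comp_onem g (a b x l : R) :
  has_deriv_within `[a, b] g x l ->
  has_deriv_within `[1 - b, 1 - a] (fun y => g (1 - y)) (1 - x) (- l).
Proof.
move=> /has_deriv_within_reflect01/has_deriv_withinP H.
apply/has_deriv_withinP => e e0; have [d d0 Hd] := H e e0.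
exists d => // y yab yx yd; have := Hd y yab yx yd.
rewrite /reflect01 -normrN.
by congr (`|_| < _); ring.
Qed.

Lemma left_neutral_map (alpha b1 b2 c : R) (f f1 f2 : R -> R) : 0 < c < 1 ->
  doubly_intermittent alpha b1 b2 c f f1 f2 ->
  exists dF ddF : R -> R, neutral_map c f1 dF ddF.
Proof.
move=> /andP[c0 c1] hf.
have [f1f [dF [ddF [HF HdF cddF]]]] := di_ext1 hf.
have {}HF x : 0 <= x <= c -> has_deriv_within `[0, c] f1 x (dF x).
  by move=> xc; apply: HF; rewrite /= in_itv/=.
have {}HdF x : 0 <= x <= c -> has_deriv_within `[0, c] dF x (ddF x).
  by move=> xc; apply: HdF; rewrite /= in_itv/=.
have dF1 x : 0 < x < c -> 1 < dF x.
  move=> xc; rewrite -(extension_deriv f1f HF xc); apply: (di_expanding hf).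
    lra.
  by rewrite lt_eqF//; case/andP: xc.
have [F0 Fc] := expanding_endpoints c0 HF dF1 (di_image1 hf).
exists dF, ddF; split => //; first by rewrite c0.
- move=> x /andP[x0]; rewrite le_eqVlt => /predU1P[->|xc]; last by apply: dF1; rewrite x0.
  have cc : 0 <= c <= c by rewrite lexx ltW.
  by have := di_expanding_c1 hf; rewrite (deriv_within_eq c0 cc (HF c cc)).
- have [e e0 cvx] := di_convex0 hf; exists e => //.
  apply: (@convex_deriv_le c e f1 dF c0 HF) => x z y x0 xzy ye yc.
  rewrite !f1f; try by rewrite /= in_itv/=; lra.
  by apply: (convex_slope cvx) => //; rewrite /= in_itv/=; lra.
Qed.

Lemma right_neutral_map (alpha b1 b2 c : R) (f f1 f2 : R -> R) : 0 < c < 1 ->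
  doubly_intermittent alpha b1 b2 c f f1 f2 ->
  exists dF ddF : R -> R, neutral_map (1 - c) (reflect01 f2) dF ddF.
Proof.
move=> /andP[c0 c1] hf.
have [f2f [dF [ddF [HF HdF cddF]]]] := di_ext2 hf.
have {}HF x : c <= x <= 1 -> has_deriv_within `[c, 1] f2 x (dF x).
  by move=> xc; apply: HF; rewrite /= in_itv/=.
have {}HdF x : c <= x <= 1 -> has_deriv_within `[c, 1] dF x (ddF x).
  by move=> xc; apply: HdF; rewrite /= in_itv/=.
have dF1 x : c < x < 1 -> 1 < dF x.
  move=> xc; rewrite -(extension_deriv f2f HF xc); apply: (di_expanding hf).
    lra.
  by rewrite gt_eqF//; case/andP: xc.
have [Fc F1] := expanding_endpoints c1 HF dF1 (di_image2 hf).
exists (fun x => dF (1 - x)), (fun x => - ddF (1 - x)).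
have HR x : 0 <= x <= 1 - c ->
    has_deriv_within `[0, 1 - c] (reflect01 f2) x (dF (1 - x)).
  move=> xc; have := has_deriv_within_reflect01 (HF (1 - x) ltac:(lra)).
  by rewrite subrr subKr.
split => //.
- lra.
- move=> x xc; have := has_deriv_within_comp_onem (HdF (1 - x) ltac:(lra)).
  by rewrite subrr subKr.
- apply/within_continuousP => x; rewrite /= in_itv/= => xc e e0.
  have [|d d0 Hd] := (iffLR (within_continuousP _ _) cddF) (1 - x) _ e e0.
    by rewrite /= in_itv/=; lra.
  exists d => // y; rewrite /= in_itv/= => yc yx.
  rewrite -opprD normrN -[- ddF _]opprK opprK; apply: Hd.
    by rewrite /= in_itv/=; lra.
  by have -> : 1 - y - (1 - x) = - (y - x); [ring|rewrite normrN].
- by rewrite /reflect01 subr0 F1 subrr.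
- by rewrite /reflect01 subKr Fc subr0.
- move=> x /andP[x0]; rewrite le_eqVlt => /predU1P[->|xc]; last by apply: dF1; lra.
  have cc : c <= c <= 1 by rewrite lexx ltW.
  by have := di_expanding_c2 hf; rewrite subKr (deriv_within_eq c1 cc (HF c cc)).
- have [e e0 cvx] := di_concave1 hf; exists e => //.
  apply: (@convex_deriv_le (1 - c) e _ _ _ HR); first lra.
  move=> x z y x0 xzy ye yc.
  have := @convex_slope _ _ (1 - y) (1 - z) (1 - x) cvx.
  rewrite /= !in_itv/= => /(_ ltac:(lra) ltac:(lra) ltac:(lra)).
  rewrite /reflect01 !f2f; try by rewrite /= in_itv/=; lra.
  lra.
Qed.

Lemma left_orbit_law (alpha b1 b2 c : R) (f f1 f2 g1 : R -> R) : 0 < alpha -> 0 < b1 ->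
  0 < c < 1 -> doubly_intermittent alpha b1 b2 c f f1 f2 ->
  inverse_on `[0, c] `[0, 1] f1 g1 ->
  iter n g1 c * n%:R `^ alpha @[n --> \oo] --> (b1 / alpha) `^ (- alpha).
Proof.
move=> al0 b10 c01 hf hg; have /andP[c0 c1] := c01.
have [dF [ddF nm]] := left_neutral_map c01 hf.
have [D [gam [ddg nb]]] := nm_branch nm hg.
have xb n : 0 < iter n g1 c <= c by apply: (nb_iter_bounds _ nb) => //; exact: ltW.
apply: (@neutral_orbit_asymptotics _ alpha b1 f1 (fun n => iter n g1 c)) => //.
- have := di_asymp0 hf; apply: cvg_trans; apply: near_eq_cvg.
  near=> x; rewrite (proj1 (di_ext1 hf))//.
  rewrite /= in_itv/=; apply/andP; split; near: x; first exact: nbhs_right_gt.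
  exact: nbhs_right_lt.
- by move=> n; have /andP[] := xb n.
- move=> n; rewrite iterS; apply: (nm_gK hg); have := xb n; lra.
- by apply: (nb_iter_cvg0 nb) => //; exact: ltW.
Unshelve. all: by end_near. Qed.

Lemma inverse_on_reflect01 (c : R) (F g : R -> R) :
  inverse_on `[c, 1] `[0, 1] F g ->
  inverse_on `[0, 1 - c] `[0, 1] (reflect01 F) (reflect01 g).
Proof.
move=> [H1 H2 H3 H4]; split.
- move=> x; rewrite /= !in_itv/= /reflect01 => xc.
  by have := H1 (1 - x); rewrite /= !in_itv/=; lra.
- move=> x; rewrite /= !in_itv/= /reflect01 => xc.
  by have := H2 (1 - x); rewrite /= !in_itv/=; lra.
- move=> x; rewrite /= !in_itv/= /reflect01 => xc.
  by rewrite subKr H3 ?subKr//= in_itv/=; lra.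
- move=> x; rewrite /= !in_itv/= /reflect01 => xc.
  by rewrite subKr H4 ?subKr//= in_itv/=; lra.
Qed.

Lemma right_orbit_law (alpha b1 b2 c : R) (f f1 f2 g2 : R -> R) : 0 < alpha -> 0 < b2 ->
  0 < c < 1 -> doubly_intermittent alpha b1 b2 c f f1 f2 ->
  inverse_on `[c, 1] `[0, 1] f2 g2 ->
  iter n (reflect01 g2) (1 - c) * n%:R `^ alpha @[n --> \oo] -->
    (b2 / alpha) `^ (- alpha).
Proof.
move=> al0 b20 c01 hf hg; have /andP[c0 c1] := c01.
have [dF [ddF nm]] := right_neutral_map c01 hf.
have hg' := inverse_on_reflect01 hg.
have [D [gam [ddg nb]]] := nm_branch nm hg'.
have xb n : 0 < iter n (reflect01 g2) (1 - c) <= 1 - c.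
  by apply: (nb_iter_bounds _ nb); lra.
apply: (@neutral_orbit_asymptotics _ alpha b2 (reflect01 f2)
  (fun n => iter n (reflect01 g2) (1 - c))) => //.
- apply/cvgrPdist_lt => e e0.
  have /cvgrPdist_lt/(_ _ e0) := di_asymp1 hf.
  rewrite near_withinE => -[d /= d0 Hd].
  rewrite near_withinE; exists (Num.min d (1 - c)); first by rewrite /= lt_min d0; lra.
  move=> x /=; rewrite sub0r normrN lt_min => /andP[xd xc] x0.
  have := Hd (1 - x); rewrite /= subKr => /(_ xd ltac:(lra)).
  rewrite gtr0_norm// in xc.
  rewrite /reflect01 (proj1 (di_ext2 hf)); last by rewrite /= in_itv/=; lra.
  by rewrite (_ : 1 - f (1 - x) - x = 1 - x - f (1 - x)); last ring.
- by move=> n; have /andP[] := xb n.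
- move=> n; rewrite iterS; apply: (nm_gK hg'); have := xb n; lra.
- by apply: (nb_iter_cvg0 nb); lra.
Qed.

Lemma has_deriv_within_seq (A : set R) (g : R -> R) (x l : R) (u : R^nat) :
  has_deriv_within A g x l -> (forall n, A (u n)) -> (forall n, u n != x) ->
  u @ \oo --> x -> (g (u n) - g x) / (u n - x) @[n --> \oo] --> l.
Proof.
move=> /has_deriv_withinP H Au ux uc; apply/cvgrPdist_lt => e e0.
have [d d0 Hd] := H e e0.
have /cvgrPdist_lt/(_ d d0)[N _ HN] := uc.
by exists N => // n /HN /= H1; rewrite distrC; apply: Hd => //; rewrite distrC.
Qed.

Lemma mass0_iter (c : R) (g1 dg1 g2 dg2 F p : R -> R) n t :
  mass c g1 dg1 g2 dg2 0 F p n t = iter n (push c g1 g2) F t.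
Proof.
elim: n t => [//|n IH] t.
by rewrite massS !mul0r subr0 iterS /push !IH.
Qed.

(** The left gaps are equivalent to [g2'(0) x_j] and the right gaps to
    [g1'(1) y_j], where the two orbits follow the same power law [j^(- alpha)]
    with constants given by [b1] and [b2]. Their quotient therefore converges,
    and they are not summable. The lower bound on [K] is kept in the conclusion
    so that any density with bounded derivative becomes regular after the
    addition of a constant. *)
Theorem iterated_push_cvg (alpha b1 b2 c : R) (f f1 f2 g1 g2 h : R -> R) :
  0 < alpha <= 1 -> 0 < b1 -> 0 < b2 -> 0 < c < 1 ->
  doubly_intermittent alpha b1 b2 c f f1 f2 ->
  inverse_on `[0, c] `[0, 1] f1 g1 -> inverse_on `[c, 1] `[0, 1] f2 g2 ->
  0 < h c ->
  exists2 K : R -> R, (forall x : R, 0 < x < 1 -> 1 <= K x) &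
    forall F p dp, regular K F p dp -> forall t : R, 0 < t < 1 ->
      iter n (push c g1 g2) F t @[n --> \oo] --> F 1 * pbar alpha b1 b2 h g1 g2.
Proof.
move=> al01 b10 b20 c01 hf hg1 hg2 hc; have /andP[al0 al1] := al01.
have /andP[c0 c1] := c01.
have [dF1 [ddF1 nm1]] := left_neutral_map c01 hf.
have [dF2 [ddF2 nm2]] := right_neutral_map c01 hf.
have hg2' := inverse_on_reflect01 hg2.
have [D1 [gam1 [ddg1 nb1]]] := nm_branch nm1 hg1.
have [D2 [gam2 [ddG2 nb2]]] := nm_branch nm2 hg2'.
pose dg1 (y : R) := (dF1 (g1 y))^-1.
pose dG2 (y : R) := (dF2 (reflect01 g2 y))^-1.
pose D := Num.max D1 D2; pose gam := Num.min gam1 gam2.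
have gam0 : 0 < gam by rewrite lt_min (nb_gam nb1) (nb_gam nb2).
have tb : two_neutral_branches c D gam g1 dg1 ddg1
    g2 (fun x => dG2 (1 - x)) (fun x => - ddG2 (1 - x)).
  split.
    by apply: neutral_branch_weaken nb1; rewrite ?gam0 /D /gam ?le_max ?ge_min lexx.
  rewrite (_ : (fun x => dG2 (1 - (1 - x))) = dG2); last by apply/funext => x; rewrite subKr.
  rewrite (_ : (fun x => - - ddG2 (1 - (1 - x))) = ddG2); last first.
    by apply/funext => x; rewrite opprK subKr.
  by apply: neutral_branch_weaken nb2; rewrite ?gam0 /D /gam ?le_max ?ge_min lexx orbT.
have [K [kappa [kappa0 K1 Kbnd step]]] := exists_regular_step tb.
exists K => // F p dp rg t t01.
have A10 : 0 < (b1 / alpha) `^ (- alpha) by rewrite powR_gt0// divr_gt0.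
have A20 : 0 < (b2 / alpha) `^ (- alpha) by rewrite powR_gt0// divr_gt0.
have E1 := nm_g_end_deriv nm1 hg1.
have E2' := nm_g_end_deriv nm2 hg2'.
have E2 : has_deriv_within `[0, 1] g2 0 (dF2 (1 - c))^-1.
  have := has_deriv_within_reflect01 E2'; rewrite subrr subr0.
  by rewrite reflect01K.
have d10 : 0 < (dF1 c)^-1.
  by rewrite invr_gt0 (lt_trans ltr01)// (nm_gt1 nm1)// c0 lexx.
have d20 : 0 < (dF2 (1 - c))^-1.
  by rewrite invr_gt0 (lt_trans ltr01)// (nm_gt1 nm2)//; lra.
have x_law := left_orbit_law al0 b10 c01 hf hg1.
have y_law := right_orbit_law al0 b20 c01 hf hg2.
pose x n := left_orbit c g1 n; pose y n := 1 - right_orbit c g2 n.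
have xb n : 0 < x n <= c by exact: (left_orbit_bounds tb).
have yb n : 0 < y n <= 1 - c by have := right_orbit_bounds tb n; rewrite /y; lra.
have yE n : y n = iter n (reflect01 g2) (1 - c).
  by rewrite /y right_orbitE subKr.
have lg_rate : left_gap c g1 g2 n / x n @[n --> \oo] --> (dF2 (1 - c))^-1.
  have := @has_deriv_within_seq _ _ _ _ x E2.
  rewrite (tb_g20 tb) => H.
  rewrite (_ : (fun n => _) = fun n => (g2 (x n) - c) / (x n - 0)); last first.
    by apply/funext => n; rewrite subr0.
  apply: H.
  - by move=> n; have := xb n; rewrite /= in_itv/=; lra.
  - by move=> n; have /andP[/lt0r_neq0] := xb n.
  - exact: (left_orbit_cvg tb).
have rg_rate : right_gap c g1 g2 n / y n @[n --> \oo] --> (dF1 c)^-1.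
  have := @has_deriv_within_seq _ _ _ _ (right_orbit c g2) E1.
  rewrite (nb_1 nb1) => H.
  rewrite (_ : (fun n => _) = fun n => (g1 (right_orbit c g2 n) - c) /
      (right_orbit c g2 n - 1)); last first.
    apply/funext => n; rewrite /right_gap -[c - _]opprB mulNr -mulrN -invrN /y.
    by rewrite opprB.
  apply: H.
  - by move=> n; have := yb n; rewrite /= in_itv/= /y; lra.
  - by move=> n; have := yb n; rewrite /y => H'; apply/eqP => E; rewrite E in H'; lra.
  - exact: (right_orbit_cvg tb).
have lg_law : left_gap c g1 g2 n * n%:R `^ alpha @[n --> \oo] -->
    (dF2 (1 - c))^-1 * (b1 / alpha) `^ (- alpha).
  rewrite (_ : (fun n => _) = fun n => left_gap c g1 g2 n / x n *
      (x n * n%:R `^ alpha)); last first.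
    by apply/funext => n; have /andP[x0 _] := xb n; field; rewrite gt_eqF.
  exact: cvgM lg_rate x_law.
have rg_law : right_gap c g1 g2 n * n%:R `^ alpha @[n --> \oo] -->
    (dF1 c)^-1 * (b2 / alpha) `^ (- alpha).
  rewrite (_ : (fun n => _) = fun n => right_gap c g1 g2 n / y n *
      (iter n (reflect01 g2) (1 - c) * n%:R `^ alpha)); last first.
    by apply/funext => n; rewrite -yE; have /andP[y0 _] := yb n; field; rewrite gt_eqF.
  exact: cvgM rg_rate y_law.
pose rho := ((dF2 (1 - c))^-1 * (b1 / alpha) `^ (- alpha)) /
  ((dF1 c)^-1 * (b2 / alpha) `^ (- alpha)).
have rho0 : 0 < rho by rewrite divr_gt0// mulr_gt0.
have ratio : left_gap c g1 g2 j / right_gap c g1 g2 j @[j --> \oo] --> rho.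
  have H : (left_gap c g1 g2 n * n%:R `^ alpha) /
      (right_gap c g1 g2 n * n%:R `^ alpha) @[n --> \oo] --> rho.
    apply: cvgM lg_law _; apply: cvgV rg_law.
    by rewrite gt_eqF// mulr_gt0.
  apply: cvg_trans H; apply: near_eq_cvg; exists 1%N => // n /= n1.
  have n0 : (0 : R) < n%:R `^ alpha by rewrite powR_gt0// ltr0n.
  have /andP[r0 _] := right_gap_bounds tb n.
  by field; rewrite !gt_eqF.
have diverges : forall M : R, exists J, M < \sum_(0 <= j < J) left_gap c g1 g2 j.
  apply: (harmonic_like_diverges al01 _ _ lg_law); first by rewrite mulr_gt0.
  by move=> n; have /andP[/ltW] := left_gap_bounds tb n.
have := mass_cvg tb kappa0 K1 Kbnd step diverges (ltW rho0) ratio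
  (ex_intro _ dp rg) t01.
have -> : rho / (1 + rho) = pbar alpha b1 b2 h g1 g2.
  have p1 : (b1 / alpha) `^ (- alpha) = b1 `^ (- alpha) * alpha `^ alpha.
    rewrite powRM ?invr_ge0 ?ltW// -(powR_inv1 (ltW al0)) -powRrM mulrNN mul1r//.
  have p2 : (b2 / alpha) `^ (- alpha) = b2 `^ (- alpha) * alpha `^ alpha.
    rewrite powRM ?invr_ge0 ?ltW// -(powR_inv1 (ltW al0)) -powRrM mulrNN mul1r//.
  rewrite /pbar /const1 /const2 (tb_g20 tb) (nb_1 nb1).
  rewrite (deriv_within_eq ltr01 _ E2) ?lexx ?ler01//.
  rewrite (deriv_within_eq ltr01 _ E1) ?lexx ?ler01//.
  rewrite -p1 -p2 /rho.
  have := d10; have := d20; move: (dF1 c)^-1 (dF2 (1 - c))^-1 A10 A20 hc.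
  move: ((b1 / alpha) `^ (- alpha)) ((b2 / alpha) `^ (- alpha)) (h c).
  move=> a1 a2 hh d1 d2 a10 a20 hh0 d2' d1'.
  have s1 : 0 < d1 * a2 + d2 * a1 by rewrite addr_gt0 ?mulr_gt0.
  have s2 : 0 < a1 * hh * d2 + a2 * hh * d1 by rewrite addr_gt0 ?mulr_gt0.
  by field; rewrite !gt_eqF.
apply: cvg_trans; apply: near_eq_cvg; apply: nearW => n.
by rewrite mass0_iter.
Qed.

End BranchesOfTheMap.

(** * Integrals against densities and two-point measures *)

Section MeasureTools.
Import HBNNSimple.
Context d (T : measurableType d) (R : realType).
Implicit Types (mu : {measure set T -> \bar R}) (D : set T).

Lemma integrable_mul_bounded mu D (f m : T -> R) (C : R) : measurable D ->
  mu.-integrable D (EFin \o f) -> measurable_fun D m ->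
  (forall x, D x -> `|m x| <= C) ->
  mu.-integrable D (EFin \o (fun x => f x * m x)).
Proof.
move=> mD fi mm mC.
have mb : [bounded m x | x in D].
  exists C; split; first exact: num_real.
  by move=> M CM x Dx /=; rewrite (le_trans (mC x Dx))// ltW.
have := integrableMl mD fi mm mb.
by apply: eq_integrable => // x _; rewrite /= EFinM.
Qed.

Lemma norm_Rintegral_mul_le mu D (f m : T -> R) (C : R) : measurable D ->
  mu.-integrable D (EFin \o f) -> measurable_fun D m ->
  (forall x, D x -> `|m x| <= C) ->
  `|\int[mu]_(x in D) (f x * m x)| <= C * \int[mu]_(x in D) `|f x|.
Proof.
move=> mD fi mm mC.
have fmi := integrable_mul_bounded mD fi mm mC.
apply: le_trans (le_normr_Rintegral mD fmi) _.
rewrite -RintegralZl//; last exact: integrable_norm.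
apply: le_Rintegral => //.
- exact: integrable_norm.
- have := integrableZl mD C (integrable_norm fi).
  by apply: eq_integrable => // x _; rewrite /= EFinM.
- by move=> x Dx; rewrite normrM mulrC ler_wpM2r// mC.
Qed.

Lemma RintegralB_mul mu D (f g m : T -> R) (C : R) : measurable D ->
  mu.-integrable D (EFin \o f) -> mu.-integrable D (EFin \o g) ->
  measurable_fun D m -> (forall x, D x -> `|m x| <= C) ->
  \int[mu]_(x in D) ((f x - g x) * m x) =
  \int[mu]_(x in D) (f x * m x) - \int[mu]_(x in D) (g x * m x).
Proof.
move=> mD fi gi mm mC; rewrite -RintegralB//.
- by apply: eq_Rintegral => x _; rewrite mulrBl.
- exact: integrable_mul_bounded mC.
- exact: integrable_mul_bounded mC.
Qed.

(** True for simple functions by linearity, and in general by monotone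
    convergence. *)
Lemma ge0_integral_density mu (nu : {measure set T -> \bar R}) D (g : T -> R)
    (f : T -> \bar R) : measurable D -> measurable_fun D g ->
  (forall x, D x -> 0 <= g x) ->
  (forall A, measurable A -> A `<=` D -> nu A = (\int[mu]_(x in A) (g x)%:E)%E) ->
  measurable_fun D f -> (forall x, D x -> (0 <= f x)%E) ->
  (\int[nu]_(x in D) f x = \int[mu]_(x in D) (f x * (g x)%:E))%E.
Proof.
move=> mD mg g0 nuE mf f0.
pose s n : {nnsfun T >-> R} := nnsfun_approx mD mf n.
have mge : measurable_fun D (EFin \o g) by exact/measurable_EFinP.
have mse n : measurable_fun D (fun x => (s n x)%:E).
  by apply/measurable_EFinP; exact: measurable_funTS.
have sum_indic (n : nat) x : (s n x)%:E =
    (\sum_(y \in range (s n)) (y%:E * (\1_(s n @^-1` [set y]) x)%:E))%E.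
  by rewrite fimfunE -fsumEFin//; under eq_fsbigr do rewrite EFinM.
have y_ge0 n y : y \in range (s n) -> (0 <= y%:E)%E.
  by rewrite inE => -[t _ <-]; rewrite lee_fin.
have mind n y : measurable_fun D (fun x => (\1_(s n @^-1` [set y]) x)%:E : \bar R).
  by apply/measurable_EFinP; exact: measurable_funTS.
have step n : (\int[nu]_(x in D) (s n x)%:E =
    \int[mu]_(x in D) ((s n x)%:E * (g x)%:E))%E.
  transitivity (\sum_(y \in range (s n))
      (y%:E * nu (s n @^-1` [set y] `&` D)))%E.
    under eq_integral do rewrite sum_indic.
    rewrite ge0_integral_fsum//; last 2 first.
    - by move=> y; apply: emeasurable_funM => //; exact: measurable_cst.
    - move=> y x Dx; case: (boolP (y \in range (s n))) => yr.
        by rewrite mule_ge0 ?(y_ge0 n y yr)// lee_fin.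
      rewrite indicE (_ : (x \in _) = false) ?mule0//.
      apply/negbTE; apply: contra yr; rewrite !inE/= => <-.
      by exists x.
    apply: eq_fsbigr => y yr; rewrite ge0_integralZl//.
    - by rewrite integral_indic.
    - exact: (y_ge0 n).
  transitivity (\int[mu]_(x in D) \sum_(y \in range (s n))
      (y%:E * ((\1_(s n @^-1` [set y]) x)%:E * (g x)%:E)))%E; last first.
    apply: eq_integral => x; rewrite inE => Dx; rewrite sum_indic.
    rewrite ge0_mule_fsuml; first by apply: eq_fsbigr => y _; rewrite muleA.
    move=> y; case: (boolP (y \in range (s n))) => yr.
      by rewrite mule_ge0 ?(y_ge0 n y yr)// lee_fin.
    rewrite indicE (_ : (x \in _) = false) ?mule0//.
    apply/negbTE; apply: contra yr; rewrite !inE/= => <-.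
    by exists x.
  rewrite ge0_integral_fsum//; last 2 first.
  - move=> y; apply: emeasurable_funM; first exact: measurable_cst.
    by apply: emeasurable_funM.
  - move=> y x Dx; case: (boolP (y \in range (s n))) => yr.
      by rewrite mule_ge0 ?(y_ge0 n y yr)// mule_ge0 ?lee_fin// g0.
    rewrite indicE (_ : (x \in _) = false) ?mul0e ?mule0//.
    apply/negbTE; apply: contra yr; rewrite !inE/= => <-.
    by exists x.
  apply: eq_fsbigr => y yr; rewrite ge0_integralZl//; first last.
  - exact: (y_ge0 n).
  - by move=> x Dx; rewrite mule_ge0 ?lee_fin// g0.
  - exact: emeasurable_funM.
  congr (_ * _)%E; rewrite nuE//; last exact: measurableI.
  rewrite setIC integral_mkcondr; apply: eq_integral => x _.
  rewrite /patch indicE; case: ifPn => xs; first by rewrite mul1e.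
  by rewrite mul0e.
have fE x : D x -> (s n x)%:E @[n --> \oo] --> f x.
  by move=> Dx; exact: (cvg_nnsfun_approx mD mf f0).
have nds x : D x -> {homo (fun n => (s n x)%:E) : a b / (a <= b)%N >-> (a <= b)%E}.
  by move=> Dx a b ab; rewrite lee_fin; exact/lefP/nd_nnsfun_approx.
have L1 : (\int[nu]_(x in D) f x = limn (fun n => \int[nu]_(x in D) (s n x)%:E))%E.
  rewrite -monotone_convergence//=.
  - apply: eq_integral => x; rewrite inE => Dx.
    by apply/esym/cvg_lim => //; exact: fE.
  - by move=> n x _; rewrite lee_fin.
have L2 : (\int[mu]_(x in D) (f x * (g x)%:E) =
    limn (fun n => \int[mu]_(x in D) ((s n x)%:E * (g x)%:E)))%E.
  rewrite -monotone_convergence//=.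
  - apply: eq_integral => x; rewrite inE => Dx.
    by apply/esym/cvg_lim => //; apply: cvgeZr => //; exact: fE.
  - by move=> n; exact: emeasurable_funM.
  - by move=> n x Dx; rewrite mule_ge0 ?lee_fin// g0.
  - by move=> x Dx a b ab; rewrite lee_wpmul2r ?lee_fin ?g0//; exact: nds.
by rewrite L1 L2; congr (limn _); apply/funext.
Qed.

Lemma integrable_density mu (nu : {measure set T -> \bar R}) D (g f : T -> R) :
  measurable D -> measurable_fun D g -> (forall x, D x -> 0 <= g x) ->
  (forall A, measurable A -> A `<=` D -> nu A = (\int[mu]_(x in A) (g x)%:E)%E) ->
  nu.-integrable D (EFin \o f) ->
  mu.-integrable D (EFin \o (fun x => f x * g x)) /\
  \int[nu]_(x in D) f x = \int[mu]_(x in D) (f x * g x).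
Proof.
move=> mD mg g0 nuE fi.
have /integrableP[mf foo] := fi.
have mfR : measurable_fun D f by exact/measurable_EFinP.
have mfg : measurable_fun D (EFin \o (fun x => f x * g x)).
  by apply/measurable_EFinP; exact: measurable_funM.
split.
  apply/integrableP; split => //.
  rewrite (ge0_integral_density mD mg g0 nuE) in foo; last 2 first.
  - exact: measurableT_comp.
  - by move=> x _; exact: abse_ge0.
  apply: le_lt_trans foo; rewrite le_eqVlt; apply/orP; left; apply/eqP.
  apply: eq_integral => x; rewrite inE => Dx.
  by rewrite /= normrM EFinM [`|g x|]ger0_norm// g0.
rewrite /Rintegral integralE [in RHS]integralE; congr (fine (_ - _)%E).
  rewrite (ge0_integral_density mD mg g0 nuE)//; last exact: measurable_funepos.
  apply: eq_integral => x; rewrite inE => Dx.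
  by rewrite !funeposE /= -!EFin_max -EFinM maxr_pMl ?g0// mul0r.
rewrite (ge0_integral_density mD mg g0 nuE)//; last exact: measurable_funeneg.
apply: eq_integral => x; rewrite inE => Dx.
by rewrite !funenegE /= -!EFin_max -EFinM maxr_pMl ?g0// mul0r mulNr.
Qed.

Lemma integral_two_point_generic (p : R) (a b : T) D (f : T -> R) (C : R) :
  0 <= p <= 1 -> measurable D -> D a -> D b -> measurable_fun D f ->
  (forall x, D x -> `|f x| <= C) ->
  (integral (fun A => p%:E * \d_a A + (1 - p)%:E * \d_b A) D (EFin \o f) =
    (p * f a + (1 - p) * f b)%:E)%E.
Proof.
move=> /andP[p0 p1] mD Da Db mf fC.
have q0 : 0 <= 1 - p by rewrite subr_ge0.
have -> : (fun A => p%:E * \d_a A + (1 - p)%:E * \d_b A)%E =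
    measure_add (mscale (NngNum p0) \d_a) (mscale (NngNum q0) \d_b).
  by apply/funext => A; rewrite measure_addE /mscale/=.
have mfe : measurable_fun D (EFin \o f) by exact/measurable_EFinP.
have mb : [bounded f x | x in D].
  exists C; split; first exact: num_real.
  by move=> M CM x Dx /=; rewrite (le_trans (fC x Dx))// ltW.
have scaled (k : R) (k0 : 0 <= k) (c : T) : D c ->
    ((mscale (NngNum k0) \d_c).-integrable D (EFin \o f) /\
     \int[mscale (NngNum k0) \d_c]_(x in D) (f x)%:E = (k * f c)%:E)%E.
  move=> Dc; split.
    apply: measurable_bounded_integrable => //.
    change (k%:E * \d_c D < +oo)%E.
    by rewrite diracE mem_set// mule1 ltry.
  rewrite integralE !ge0_integral_mscale//; last 2 first.
  - exact: measurable_funeneg.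
  - exact: measurable_funepos.
  rewrite !integral_dirac//; last 2 first.
  - exact: measurable_funeneg.
  - exact: measurable_funepos.
  rewrite diracE mem_set// !mul1e -muleBr//; last first.
    by rewrite fin_num_adde_defr// funeposE /= -EFin_max.
  by rewrite EFinM; congr (_ * _)%E; rewrite [RHS](congr1 (@^~ c) (funeposneg (fun x => (f x)%:E))).
have [ia Ea] := scaled p p0 a Da; have [ib Eb] := scaled (1 - p) q0 b Db.
by rewrite integral_measure_add//= Ea Eb EFinD.
Qed.

End MeasureTools.

(** * Distribution functions of pushed measures *)

Section PushforwardCdf.
Context {R : realType}.
Implicit Types (x y t : R) (psi : R -> R).

Local Notation leb := (@lebesgue_measure R).
Local Notation I01 := (`[0%R, 1%R]%classic : set (measurableTypeR R)).

(** What the evolution of distribution functions retains of the map. The value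
    at the cut is arbitrary, whence the exclusion of [c] in [bm_le]; the fibres
    are finite by [bm_fibre], so that the orbits hitting the cut are negligible. *)
Record two_branch_map (c : R) (f g1 g2 : R -> R) : Prop := {
  bm_c : 0 < c < 1;
  bm_self : forall x : R, 0 <= x <= 1 -> 0 <= f x <= 1;
  bm_meas : measurable_fun I01 (f : measurableTypeR R -> measurableTypeR R);
  bm_g1 : forall x : R, 0 <= x <= 1 -> 0 <= g1 x <= 1;
  bm_g2 : forall x : R, 0 <= x <= 1 -> 0 <= g2 x <= 1;
  bm_le : forall x t : R, 0 <= x <= 1 -> 0 <= t <= 1 -> x != c ->
    (f x <= t)%R%:R = (x <= g1 t)%R%:R + (x <= g2 t)%R%:R - (x <= c)%R%:R :> R;
  bm_fibre : forall x : R, 0 <= x <= 1 -> [\/ x = c, x = g1 (f x) | x = g2 (f x)] }.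

Variables (c : R) (f g1 g2 : R -> R).
Hypothesis bm : two_branch_map c f g1 g2.

Lemma measurable_I01 : measurable I01.
Proof. exact: measurable_itv. Qed.

Lemma iter_self n x : 0 <= x <= 1 -> 0 <= iter n f x <= 1.
Proof. by move=> x01; elim: n => //= n IH; exact: (bm_self bm). Qed.

Lemma iter_meas n :
  measurable_fun I01 (iter n f : measurableTypeR R -> measurableTypeR R).
Proof.
elim: n => [|n IH]; first exact: measurable_id.
apply: (measurable_comp measurable_I01 _ (bm_meas bm) IH) => y [x + <-].
by rewrite /= !in_itv/=; exact: iter_self.
Qed.

Lemma iter_fibre n y : finite_set (I01 `&` iter n f @^-1` [set y]).
Proof.
elim: n y => [|n IH] y.
  by apply: sub_finite_set (finite_set1 y) => x [].
apply: sub_finite_set (_ : finite_set (\bigcup_(z in [set c; g1 y; g2 y])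
    (I01 `&` iter n f @^-1` [set z]))); last first.
  by apply: bigcup_finite => //; apply: finite_set3.
move=> x [x01 /= fx]; exists (iter n f x) => //.
have := bm_fibre bm (@iter_self n x _); rewrite fx; move: x01.
by rewrite /= in_itv/= => x01 /(_ x01) []; [left; left|left; right|right].
Qed.

Definition push_cdf psi n t : R :=
  \int[leb]_(x in I01) (psi x * (iter n f x <= t)%R%:R).

Lemma measurable_below n t :
  measurable_fun I01 (fun x => (iter n f x <= t)%R%:R : R).
Proof.
have -> : (fun x => (iter n f x <= t)%R%:R : R) =
    (\1_(`]-oo, t] : set R) : R -> R) \o iter n f.
  by apply/funext => x; rewrite /= indicE mem_setE in_itv.
apply: (measurable_comp (F := setT)) (iter_meas n) => //.
Qed.

Lemma below_le1 n t x : `|(iter n f x <= t)%R%:R : R| <= 1.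
Proof. by case: (iter n f x <= t); rewrite /= ?normr1 ?normr0. Qed.

(** The identity [bm_le] at the point [iter n f x] holds outside a finite fibre
    of [iter n f]. *)
Lemma push_cdfS psi n t : leb.-integrable I01 (EFin \o psi) -> 0 <= t <= 1 ->
  push_cdf psi n.+1 t =
  push_cdf psi n (g1 t) + push_cdf psi n (g2 t) - push_cdf psi n c.
Proof.
move=> psii t01.
have int s k := integrable_mul_bounded measurable_I01 psii
  (measurable_below k s) (fun x _ => below_le1 k s x).
have i1 := int (g1 t) n; have i2 := int (g2 t) n; have i3 := int c n.
rewrite /push_cdf -RintegralD// -RintegralB//; last first.
  have := integrableD measurable_I01 i1 i2.
  by apply: eq_integrable => // x _; rewrite /= EFinD.
rewrite /Rintegral; congr fine; apply: ae_eq_integral => //.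
- by have /integrableP[] := int t n.+1.
- have /integrableP[m _] := integrableB measurable_I01
    (integrableD measurable_I01 i1 i2) i3.
  by apply: eq_measurable_fun m => x _.
exists (I01 `&` iter n f @^-1` [set c]); split.
- apply: countable_measurable => //; apply: finite_set_countable.
  exact: iter_fibre.
- apply: countable_lebesgue_measure0; apply: finite_set_countable.
  exact: iter_fibre.
move=> x /= H; apply: contrapT => nx; apply: H => x01.
congr EFin; rewrite -mulrDr -mulrBr; congr (_ * _).
apply: (bm_le bm) => //.
  by apply: iter_self; move: x01; rewrite /= in_itv.
by apply/eqP => E; apply: nx; split.
Qed.

Lemma push_cdf_iter psi n t : leb.-integrable I01 (EFin \o psi) -> 0 <= t <= 1 ->
  push_cdf psi n t = iter n (push c g1 g2) (push_cdf psi 0) t.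
Proof.
move=> psii; elim: n t => // n IH t t01; rewrite push_cdfS//= /push !IH//.
- by have := bm_c bm; lra.
- exact: (bm_g2 bm).
- exact: (bm_g1 bm).
Qed.

End PushforwardCdf.

(** * From smooth densities to integrable ones *)

Section EquidistributionOfCdf.
Context {R : realType}.
Implicit Types (x y t : R) (psi : R -> R).

Local Notation leb := (@lebesgue_measure R).
Local Notation I01 := (`[0%R, 1%R]%classic : set (measurableTypeR R)).

Lemma exists_primitive (g : R -> R) (a b : R) : a < b ->
  (forall x : R, a <= x <= b -> {for x, continuous g}) ->
  exists G : R -> R, forall x : R, a < x < b -> is_derive x 1 G (g x).
Proof.
move=> ab gc.
have gi : leb.-integrable `[a, b] (EFin \o g).
  apply: continuous_compact_integrable; first exact: segment_compact.
  apply: continuous_in_subspaceT => x; rewrite inE/= in_itv/=; exact: gc.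
exists (fun x : R => \int[leb]_(t in `[a, x]) g t) => x /andP[ax xb].
have [|dG GE] := continuous_FTC1_closed xb gi ax.
  by apply: gc; rewrite !ltW.
by rewrite -GE derive1E; exact: DeriveDef.
Qed.

Lemma integrable_of_continuous (g : R -> R) :
  {within `[0, 1], continuous g} -> leb.-integrable I01 (EFin \o g).
Proof.
move=> cg; apply: continuous_compact_integrable => //; exact: segment_compact.
Qed.

Lemma continuous_on01_bounded (g : R -> R) : {within `[0, 1], continuous g} ->
  exists2 C : R, 0 <= C & forall x : R, 0 <= x <= 1 -> `|g x| <= C.
Proof.
move=> cg; have cng : {within `[0, 1], continuous (fun x => `|g x|)}.
  by move=> x; apply: continuous_comp (cg x) _; exact: norm_continuous.
have [z z01 zmax] := EVT_max ler01 cng.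
by exists `|g z| => // x x01; apply: zmax; rewrite in_itv.
Qed.

Lemma Rintegral_ftc (F p : R -> R) (a b : R) : a <= b ->
  {within `[a, b], continuous p} ->
  (forall x : R, a <= x <= b -> is_derive x 1 F (p x)) ->
  \int[leb]_(x in `[a, b]) p x = F b - F a.
Proof.
rewrite le_eqVlt => /predU1P[->|ab] cp dF.
  by rewrite set_itv1 Rintegral_set1 subrr.
have cF x : a <= x <= b -> {for x, continuous F}.
  move=> xab; apply: differentiable_continuous; apply/derivable1_diffP.
  by have [] := dF x xab.
rewrite /Rintegral (@continuous_FTC2 _ p F)//.
- split.
  + by move=> x; rewrite in_itv/= => xab; have [] := dF x ltac:(lra).
  + by apply: cvg_at_right_filter; apply: cF; lra.
  + by apply: cvg_at_left_filter; apply: cF; lra.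
- move=> x; rewrite in_itv/= => xab; rewrite derive1E.
  by have [_ ->] := dF x ltac:(lra).
Qed.

Definition diff_quot (u : R -> R) (a x : R) : R := a^-1 * (u (x + a) - u x).

Lemma diff_quot_derive (u du : R -> R) (a x : R) :
  is_derive x 1 u (du x) -> is_derive (x + a) 1 u (du (x + a)) ->
  is_derive x 1 (diff_quot u a) (diff_quot du a x).
Proof.
move=> d1 d2.
have d3 : is_derive x 1 (fun y : R => y + a) 1.
  have := is_deriveD (is_derive_id x 1) (is_derive_cst a x 1).
  by rewrite addr0.
have d4 := @is_derive1_comp _ u (fun y : R => y + a) x _ _ d2 d3.
rewrite mulr1 in d4.
exact: is_deriveZ (is_deriveB d4 d1).
Qed.

Lemma diff_quot_mvt (u du : R -> R) (a x : R) : 0 < a ->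
  (forall y : R, x <= y <= x + a -> is_derive y 1 u (du y)) ->
  exists2 y : R, x <= y <= x + a & diff_quot u a x = du y.
Proof.
move=> a0 du_; have [|y|y|y y01 E] := @MVT_segment _ u du x (x + a).
- by rewrite lerDl ltW.
- by rewrite in_itv/= => y01; apply: du_; lra.
- apply: continuous_in_subspaceT => z; rewrite inE/= in_itv/= => zx.
  apply: differentiable_continuous; apply/derivable1_diffP.
  by have [] := du_ z zx.
exists y; first by move: y01; rewrite in_itv.
by rewrite /diff_quot E; field; rewrite gt_eqF.
Qed.

Variables (c L : R) (f g1 g2 K : R -> R).
Hypothesis bm : two_branch_map c f g1 g2.
Hypothesis K1 : forall x : R, 0 < x < 1 -> 1 <= K x.
Hypothesis regular_limit : forall F p dp, regular K F p dp ->
  forall t : R, 0 < t < 1 ->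
    iter n (push c g1 g2) F t @[n --> \oo] --> F 1 * L.

Lemma iter_push_eq (F F' : R -> R) n t :
  (forall x : R, 0 <= x <= 1 -> F x = F' x) -> 0 <= t <= 1 ->
  iter n (push c g1 g2) F t = iter n (push c g1 g2) F' t.
Proof.
move=> FF'; elim: n t => [|n IH] t t01; first exact: FF'.
rewrite /= /push !IH//; first by have := bm_c bm; lra.
- exact: (bm_g2 bm).
- exact: (bm_g1 bm).
Qed.

Lemma iter_pushB (F F' : R -> R) n t :
  iter n (push c g1 g2) (fun x => F x - F' x) t =
  iter n (push c g1 g2) F t - iter n (push c g1 g2) F' t.
Proof. by elim: n t => //= n IH t; rewrite /push !IH; ring. Qed.

(** Adding the constant [C + C] to [p] makes it at least [C], hence regular
    because [K >= 1]; constants are regular, and the evolution is linear. *)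
Lemma smooth_cdf_cvg (F p dp : R -> R) (C : R) t : 
  (forall x : R, 0 <= x <= 1 -> is_derive x 1 F (p x)) ->
  (forall x : R, 0 <= x <= 1 -> is_derive x 1 p (dp x)) ->
  (forall x : R, 0 <= x <= 1 -> `|p x| <= C /\ `|dp x| <= C) -> 0 < t < 1 ->
  push_cdf f p n t @[n --> \oo] --> \int[leb]_(x in I01) p x * L.
Proof.
move=> dF dp_ bnd t01.
have cont (u du : R -> R) : (forall x : R, 0 <= x <= 1 -> is_derive x 1 u (du x)) ->
    {within `[0, 1], continuous u}.
  move=> du_; apply: derivable_within_continuous => x; rewrite in_itv/= => x01.
  by have [] := du_ x x01.
have cp := cont _ _ dp_.
have C0 : 0 <= C.
  by have [H _] := bnd 0 ltac:(lra); apply: le_trans H.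
have der_lin (x a : R) : is_derive x 1 (fun y : R => a * y) a.
  have := @is_deriveZ _ _ _ id a x 1 1 (is_derive_id x 1).
  by rewrite [a *: 1]mulr1.
pose E (x : R) := F x - F 0 + (C + C) * x.
have dE (x : R) : 0 <= x <= 1 -> is_derive x 1 E (p x + (C + C)).
  move=> x01; have d1 := dF x x01.
  have d2 := is_deriveB d1 (is_derive_cst (F 0) x 1).
  have := is_deriveD d2 (der_lin x (C + C)).
  by rewrite subr0.
have rE : regular K E (fun x => p x + (C + C)) dp.
  split.
  - by rewrite /E subrr mulr0 addr0.
  - exact: (cont _ _ dE).
  - by move=> x x01; apply: dE; lra.
  - move=> x x01; have d1 := dp_ x ltac:(lra).
    by have := is_deriveD d1 (is_derive_cst (C + C) x 1); rewrite addr0.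
  - by move=> x x01; have [+ _] := bnd x ltac:(lra); rewrite ler_norml; lra.
  - move=> x x01; have [+ +] := bnd x ltac:(lra); have := K1 x01.
    move: (K x) => k k1; rewrite !ler_norml => /andP[p1 p2] /andP[d1 d2].
    have : C <= k * (p x + (C + C)) by nra.
    lra.
have rL : regular K (fun x : R => (C + C) * x) (fun=> C + C) (fun=> 0).
  split.
  - by rewrite mulr0.
  - by apply: (cont _ (fun=> C + C)).
  - by move=> x _; exact: der_lin.
  - by move=> x _; exact: is_derive_cst.
  - by move=> x _; lra.
  - by move=> x x01; rewrite normr0 mulr_ge0//; [have := K1 x01; lra|lra].
have J0 x : 0 <= x <= 1 -> push_cdf f p 0 x = E x - (C + C) * x.
  move=> x01; rewrite /push_cdf /= Rintegral_mkcond.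
  transitivity (\int[leb]_(y in `[0, x]) p y).
    rewrite [RHS]Rintegral_mkcond; apply: eq_Rintegral => y _.
    rewrite /patch !mem_setE !in_itv/=.
    case: (leP y x) => yx; rewrite ?mulr1 ?mulr0 ?andbT ?andbF//.
      have y1 : y <= 1 by apply: le_trans yx _; lra.
      by rewrite y1 andbT.
    by case: ifP.
  rewrite (_ : E x - _ = F x - F 0); last by rewrite /E; ring.
  apply: Rintegral_ftc.
  - lra.
  - by apply: continuous_subspaceW cp => y /=; rewrite !in_itv/=; lra.
  - by move=> y y01; apply: dF; lra.
have pE : \int[leb]_(x in I01) p x = E 1 - (C + C) * 1.
  by rewrite (Rintegral_ftc ler01 cp dF) /E; ring.
rewrite pE mulrBl.
rewrite (_ : (fun n => _) = fun n => iter n (push c g1 g2) E t -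
    iter n (push c g1 g2) (fun x => (C + C) * x) t).
  by apply: cvgB; [exact: regular_limit rE _ t01|exact: regular_limit rL _ t01].
apply/funext => n; rewrite (push_cdf_iter bm)//; last 2 first.
- exact: integrable_of_continuous.
- lra.
rewrite -iter_pushB; apply: iter_push_eq; [exact: J0|lra].
Qed.

(** Distribution functions at time [n] depend on [psi] in a 1-Lipschitz way
    for the L^1 distance, whatever [n]. *)
Lemma push_cdf_closed psi t : leb.-integrable I01 (EFin \o psi) ->
  (forall e : R, 0 < e -> exists psi',
    [/\ leb.-integrable I01 (EFin \o psi'),
        \int[leb]_(x in I01) `|psi x - psi' x| <= e &
        push_cdf f psi' n t @[n --> \oo] --> \int[leb]_(x in I01) psi' x * L]) ->
  push_cdf f psi n t @[n --> \oo] --> \int[leb]_(x in I01) psi x * L.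
Proof.
move=> psii H; apply/cvgrPdist_le => e e0.
pose k := 2 + `|L|; have k0 : 0 < k by have := normr_ge0 L; rewrite /k; lra.
have ek0 : 0 < e / k by rewrite divr_gt0.
have [psi' [psi'i dist]] := H _ ek0.
move=> /cvgrPdist_le/(_ _ ek0); apply: filterS => n Hn.
have dint : leb.-integrable I01 (EFin \o (fun x => psi x - psi' x)).
  have := integrableB (measurable_I01 (R := R)) psii psi'i.
  by apply: eq_integrable => // x _; rewrite /= EFinB.
have d1 : `|push_cdf f psi n t - push_cdf f psi' n t| <= e / k.
  rewrite /push_cdf -(RintegralB_mul (C := 1))//.
  - apply: le_trans dist; rewrite -[leRHS]mul1r.
    apply: norm_Rintegral_mul_le => //.
    + exact: (measurable_below bm).
    + by move=> x _; exact: below_le1.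
  - exact: (measurable_below bm).
  - by move=> x _; exact: below_le1.
have d2 : `|\int[leb]_(x in I01) psi x - \int[leb]_(x in I01) psi' x| <= e / k.
  rewrite -RintegralB//; apply: le_trans dist.
  exact: le_normr_Rintegral.
have -> : e = e / k * k by rewrite mulfVK// gt_eqF.
move: (e / k) d1 d2 Hn => q d1 d2 Hn.
have d3 : `|(\int[leb]_(x in I01) psi x - \int[leb]_(x in I01) psi' x) * L| <= q * `|L|.
  by rewrite normrM ler_wpM2r.
move: d1 d3 Hn; rewrite mulrBl /k mulrDr !ler_norml.
move: (q * `|L|) (_ * L) (_ * L) (push_cdf _ _ _ _) (push_cdf _ _ _ _) => *; lra.
Qed.

(** The difference quotients of a primitive [G] of [g] are of class C^1, have
    as primitives the difference quotients of a primitive of [G], and converge to [g]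
    boundedly, hence in L^1. *)
Lemma continuous_cdf_cvg (g : R -> R) t : continuous g -> 0 < t < 1 ->
  push_cdf f g n t @[n --> \oo] --> \int[leb]_(x in I01) g x * L.
Proof.
move=> cg t01.
have gi : leb.-integrable I01 (EFin \o g).
  by apply: integrable_of_continuous; exact: continuous_subspaceT.
apply: push_cdf_closed => // e e0.
(* Nested margins: the difference quotients on [0, 1] use [G] and [H] up to 2. *)
have [G dG] : exists G : R -> R, forall x : R, - 2 < x < 4 -> is_derive x 1 G (g x).
  by apply: exists_primitive => [|x _]; [lra|exact: cg].
have cG (x : R) : - 2 < x < 4 -> {for x, continuous G}.
  move=> x24; apply: differentiable_continuous; apply/derivable1_diffP.
  by have [] := dG x x24.
have [H dH] : exists H : R -> R, forall x : R, - 1 < x < 3 -> is_derive x 1 H (G x).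
  by apply: exists_primitive => [|x x13]; [lra|apply: cG; lra].
have [z z02 zmax] : exists2 z : R, z \in `[0, 2] &
    forall x : R, x \in `[0, 2] -> `|g x| <= `|g z|.
  apply: EVT_max; first by lra.
  move=> x; apply: continuous_comp; last exact: norm_continuous.
  by apply: continuous_subspaceT.
pose C := `|g z|.
have gC (x : R) : 0 <= x <= 2 -> `|g x| <= C.
  by move=> x02; apply: zmax; rewrite in_itv.
have C0 : 0 <= C by exact: normr_ge0.
have [a a01 a0] : exists2 a : R^nat, (forall n, 0 < a n <= 1) &
    a n @[n --> \oo] --> (0 : R).
  exists harmonic; last exact: cvg_harmonic.
  by move=> n; rewrite harmonic_gt0/= invf_le1 ?ltr0n// ler1n.
have quotC n (x : R) : 0 <= x <= 1 -> `|diff_quot G (a n) x| <= C.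
  move=> x01; move: (a n) (a01 n) => b b01.
  have [||y y01 ->] := @diff_quot_mvt G g b x; first lra.
    by move=> y y01; apply: dG; lra.
  by apply: gC; lra.
have quot_cvg x : 0 <= x <= 1 -> diff_quot G (a n) x @[n --> \oo] --> g x.
  move=> x01; have dGx := dG x ltac:(lra).
  have to_x : x + a n @[n --> \oo] --> x.
    by rewrite -[X in _ --> X]addr0; apply: cvgD => //; exact: cvg_cst.
  have H' := has_deriv_within_seq (is_derive_has_deriv_within setT dGx)
    (fun=> I) _ to_x.
  have : (G (x + a n) - G x) / (x + a n - x) @[n --> \oo] --> g x.
    apply: H' => n; rewrite -subr_eq0 addrAC subrr add0r gt_eqF//.
    by have /andP[] := a01 n.
  apply: cvg_trans; apply: near_eq_cvg; apply: nearW => n.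
  by rewrite /diff_quot [x + a n - x]addrAC subrr add0r mulrC.
have dquot (u du : R -> R) n (x : R) : 0 <= x <= 1 ->
    (forall y : R, 0 <= y <= 2 -> is_derive y 1 u (du y)) ->
    is_derive x 1 (diff_quot u (a n)) (diff_quot du (a n) x).
  move=> x01 du_; move: (a n) (a01 n) => b b01.
  by apply: diff_quot_derive; apply: du_; lra.
have qi n : leb.-integrable I01 (EFin \o diff_quot G (a n)).
  apply: integrable_of_continuous; apply: derivable_within_continuous => x.
  rewrite in_itv/= => x01.
  have dG' (y : R) : 0 <= y <= 2 -> is_derive y 1 G (g y).
    by move=> y02; apply: dG; lra.
  by have [] := dquot G g n x x01 dG'.
have dom : (\int[leb]_(x in I01) `|(diff_quot G (a n) x)%:E - (g x)%:E|)%E @[n --> \oo] --> 0%E.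
  have [|||||_ Hd _] := @dominated_convergence _ _ R leb I01 (measurable_I01 (R := R))
    (fun n x => (diff_quot G (a n) x)%:E) (EFin \o g) (fun=> C%:E).
  - by move=> n; have /integrableP[] := qi n.
  - by have /integrableP[] := gi.
  - apply: aeW => x; rewrite /= in_itv/= => x01.
    by apply: cvg_EFin; [exact: nearW|exact: quot_cvg].
  - apply: integrable_of_continuous (fun=> C) _.
    by apply: continuous_subspaceT => x; exact: cvg_cst.
  - by apply: aeW => x /= n; rewrite in_itv/= => x01; rewrite lee_fin quotC.
  exact: Hd.
have [n Hn] : exists n, \int[leb]_(x in I01) `|g x - diff_quot G (a n) x| <= e.
  have /fine_cvgP[_ /cvgrPdist_le/(_ _ e0)[N _ /(_ N (leqnn _))]] := dom.
  rewrite sub0r normrN => HN; exists N; apply: le_trans HN.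
  apply: le_trans (ler_norm _); rewrite /Rintegral le_eqVlt; apply/orP; left.
  apply/eqP; congr fine; apply: eq_integral => x _.
  by rewrite distrC -EFinB.
exists (diff_quot G (a n)); split => //.
have [C' C'0 HC'] : exists2 C' : R, 0 <= C' &
    forall x : R, 0 <= x <= 1 -> `|diff_quot g (a n) x| <= C'.
  apply: continuous_on01_bounded; apply: continuous_subspaceT => x.
  apply: cvgM; first exact: cvg_cst.
  apply: cvgB; last exact: cg.
  apply: continuous_comp; last exact: cg.
  by apply: cvgD; [exact: cvg_id|exact: cvg_cst].
apply: (@smooth_cdf_cvg (diff_quot H (a n)) _ (diff_quot g (a n)) (C + C')) => //.
- by move=> x x01; apply: dquot => // y y02; apply: dH; lra.
- by move=> x x01; apply: dquot => // y y02; apply: dG; lra.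
- by move=> x x01; split; [have := quotC n x x01; lra|have := HC' x x01; lra].
Qed.

Lemma integrable_cdf_cvg psi t : leb.-integrable I01 (EFin \o psi) -> 0 < t < 1 ->
  push_cdf f psi n t @[n --> \oo] --> \int[leb]_(x in I01) psi x * L.
Proof.
move=> psii t01; apply: push_cdf_closed => // e e0.
have [|g [cg gi dom]] := approximation_continuous_integrable
  (measurable_I01 (R := R)) _ psii.
  by apply: compact_finite_measure; exact: segment_compact.
have /fine_cvgP[_ /cvgrPdist_le/(_ _ e0)[N _ /(_ N (leqnn _))]] := dom.
rewrite sub0r normrN => HN; exists (g N); split => //.
  by apply: le_trans HN; exact: ler_norm.
exact: continuous_cdf_cvg.
Qed.

End EquidistributionOfCdf.

(** * Observables continuous at the fixed points *)

Section BoundedObservables.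
Context {R : realType}.
Implicit Types (x y t : R) (psi phi : R -> R).

Local Notation leb := (@lebesgue_measure R).
Local Notation I01 := (`[0%R, 1%R]%classic : set (measurableTypeR R)).

Variables (c L : R) (f g1 g2 : R -> R).
Hypothesis bm : two_branch_map c f g1 g2.
Hypothesis cdf_cvg : forall psi t, leb.-integrable I01 (EFin \o psi) ->
  0 < t < 1 -> push_cdf f psi n t @[n --> \oo] --> \int[leb]_(x in I01) psi x * L.

(** [L] is the limit of the distribution functions of probability measures. *)
Lemma limit_weight01 : 0 <= L <= 1.
Proof.
have onei : leb.-integrable I01 (EFin \o (fun=> 1 : R)).
  by apply: integrable_of_continuous; apply: continuous_subspaceT => x; exact: cvg_cst.
have one : \int[leb]_(x in I01) (fun=> 1) x = 1 :> R.
  have c1 : {within `[0, 1], continuous ((fun=> 1) : R -> R)}.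
    by apply: continuous_subspaceT => x; exact: cvg_cst.
  have d1 (x : R) : 0 <= x <= 1 -> is_derive x 1 (@id R) 1.
    by move=> _; exact: is_derive_id.
  by rewrite (Rintegral_ftc ler01 c1 d1) subr0.
have := cdf_cvg (t := 2^-1) onei; rewrite one mul1r => /(_ ltac:(lra)) H.
have bnd n : 0 <= push_cdf f (fun=> 1) n 2^-1 <= 1.
  have int := integrable_mul_bounded (measurable_I01 (R := R)) onei
    (measurable_below bm n 2^-1) (fun x _ => below_le1 f n 2^-1 x).
  apply/andP; split.
    apply: Rintegral_ge0 => x _; first by rewrite mul1r.
  rewrite -[leRHS]one; apply: le_Rintegral => // x _.
  by rewrite mul1r; case: (iter n f x <= 2^-1).
apply/andP; split.
  by apply: (ler_cvg_to (cvg_cst _) H); apply: nearW => n; have /andP[] := bnd n.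
by apply: (ler_cvg_to H (cvg_cst _)); apply: nearW => n; have /andP[] := bnd n.
Qed.

Lemma Rintegral_two_steps psi n (a b k s t : R) :
  leb.-integrable I01 (EFin \o psi) ->
  leb.-integrable I01 (EFin \o (fun x => psi x *
    (a * (iter n f x <= s)%R%:R + b * (iter n f x <= t)%R%:R + k))) /\
  \int[leb]_(x in I01) (psi x *
    (a * (iter n f x <= s)%R%:R + b * (iter n f x <= t)%R%:R + k)) =
  a * push_cdf f psi n s + b * push_cdf f psi n t + k * \int[leb]_(x in I01) psi x.
Proof.
move=> psii; have mI := measurable_I01 (R := R).
have int r := integrable_mul_bounded mI psii
  (measurable_below bm n r) (fun x _ => below_le1 f n r x).
have intZ q (u : R -> R) : leb.-integrable I01 (EFin \o u) ->
    leb.-integrable I01 (EFin \o (fun x => q * u x)).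
  by move=> ui; have := integrableZl mI q ui; apply: eq_integrable.
have intD (u v : R -> R) : leb.-integrable I01 (EFin \o u) ->
    leb.-integrable I01 (EFin \o v) ->
    leb.-integrable I01 (EFin \o (fun x => u x + v x)).
  by move=> ui vi; have := integrableD mI ui vi; apply: eq_integrable.
have i1 := intZ a _ (int s); have i2 := intZ b _ (int t); have i3 := intZ k _ psii.
have E : (fun x => psi x *
    (a * (iter n f x <= s)%R%:R + b * (iter n f x <= t)%R%:R + k)) =
  (fun x => a * (psi x * (iter n f x <= s)%R%:R) +
    b * (psi x * (iter n f x <= t)%R%:R) + k * psi x).
  by apply/funext => x; ring.
rewrite E; split; first exact: (intD _ _ (intD _ _ i1 i2) i3).
rewrite RintegralD//; last exact: intD.
by rewrite RintegralD// !RintegralZl.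
Qed.

Lemma observable_measurable phi n :
  measurable_fun I01 (phi : measurableTypeR R -> measurableTypeR R) ->
  measurable_fun I01 (fun x => phi (iter n f x)).
Proof.
move=> mphi.
apply: (measurable_comp (F := I01)) mphi (iter_meas bm n).
  exact: measurable_I01.
by move=> y [x + <-]; rewrite /= !in_itv/=; exact: (iter_self bm).
Qed.

(** Up to [q], the observable is [phi 0] on [[0, d]] and [phi 1] on ]1 - d, 1];
    between, where it is only bounded, there is no mass in the limit. So it is
    compared with the step function [s], and the error [w] integrates to a
    multiple of [q] in the limit. *)
Lemma observable_cvg psi phi (C : R) :
  leb.-integrable I01 (EFin \o psi) ->
  measurable_fun I01 (phi : measurableTypeR R -> measurableTypeR R) ->
  (forall x : R, 0 <= x <= 1 -> `|phi x| <= C) ->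
  phi x @[x --> 0^'+] --> phi 0 -> phi x @[x --> 1^'-] --> phi 1 ->
  \int[leb]_(x in I01) (psi x * phi (iter n f x)) @[n --> \oo] -->
  \int[leb]_(x in I01) psi x * (L * phi 0 + (1 - L) * phi 1).
Proof.
move=> psii mphi phiC phi0 phi1; have mI := measurable_I01 (R := R).
have C0 : 0 <= C by apply: le_trans (phiC 0 _); [exact: normr_ge0|lra].
have apsii : leb.-integrable I01 (EFin \o (fun x => `|psi x|)).
  exact: integrable_norm.
have mphin n := observable_measurable n mphi.
have phinC n x : I01 x -> `|phi (iter n f x)| <= C.
  by rewrite /= in_itv/= => x01; apply: phiC; exact: (iter_self bm).
have intphi n := integrable_mul_bounded mI psii (mphin n) (phinC n).
apply/cvgrPdist_le => e e0.
pose M := \int[leb]_(x in I01) `|psi x|.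
have M0 : 0 <= M by apply: Rintegral_ge0.
(* [q * M] bounds the error made with [w], and [q] each of the two limits. *)
pose q := e / (M + 2); have q0 : 0 < q by rewrite divr_gt0//; lra.
have qe : q * (M + 2) = e by rewrite /q divfK// gt_eqF//; lra.
have [r0 r00 Hr0] : exists2 r : R, 0 < r &
    forall y : R, 0 <= y <= 1 -> y < r -> `|phi y - phi 0| <= q.
  have /cvgrPdist_le/(_ _ q0)[r /= r_gt0 Hr] := phi0.
  exists r => // y y01 yr; have [->|y_neq0] := eqVneq y 0.
    by rewrite subrr normr0 ltW.
  have y0 : 0 < y by rewrite lt_neqAle eq_sym y_neq0; case/andP: y01.
  by rewrite distrC; apply: Hr => //=; rewrite sub0r normrN gtr0_norm.
have [r1 r10 Hr1] : exists2 r : R, 0 < r &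
    forall y : R, 0 <= y <= 1 -> 1 - r < y -> `|phi y - phi 1| <= q.
  have /cvgrPdist_le/(_ _ q0)[r /= r_gt0 Hr] := phi1.
  exists r => // y y01 yr; have [->|y_neq1] := eqVneq y 1.
    by rewrite subrr normr0 ltW.
  have y1 : y < 1 by rewrite lt_neqAle y_neq1; case/andP: y01.
  by rewrite distrC; apply: Hr => //=; rewrite gtr0_norm; lra.
have [d d0 [d2 dr0 dr1]] : exists2 d : R, 0 < d & [/\ d < 2^-1, d < r0 & d < r1].
  exists (Num.min (2^-1) (Num.min r0 r1) / 2).
    by rewrite divr_gt0// !lt_min r00 r10; lra.
  have : Num.min (2^-1) (Num.min r0 r1) <= 2^-1 by rewrite ge_min lexx.
  have : Num.min (2^-1) (Num.min r0 r1) <= r0 by rewrite !ge_min lexx orbT.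
  have : Num.min (2^-1) (Num.min r0 r1) <= r1 by rewrite !ge_min lexx !orbT.
  by move: (Num.min _ _) => w *; split; lra.
pose s n x : R := phi 0 * (iter n f x <= d)%R%:R +
  - phi 1 * (iter n f x <= 1 - d)%R%:R + phi 1.
pose w n x : R := - C * (iter n f x <= d)%R%:R + C * (iter n f x <= 1 - d)%R%:R + q.
have sw n x : I01 x -> `|phi (iter n f x) - s n x| <= w n x.
  rewrite /= in_itv/= => x01; have := iter_self bm n x01; rewrite /s /w.
  move: (iter n f x) => y y01.
  have [yd|yd] := leP y d.
    have -> : y <= 1 - d by lra.
    have := Hr0 y y01 ltac:(lra).
    by rewrite !mulr1 subrK addNr add0r.
  have [yd'|yd'] := leP y (1 - d).
    have := phiC y y01; rewrite !mulr1 !mulr0 add0r addNr subr0; lra.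
  have := Hr1 y y01 ltac:(lra).
  by rewrite !mulr0 !add0r; lra.
have key n : `|\int[leb]_(x in I01) (psi x * phi (iter n f x)) -
    (phi 0 * push_cdf f psi n d + - phi 1 * push_cdf f psi n (1 - d) +
     phi 1 * \int[leb]_(x in I01) psi x)| <=
    - C * push_cdf f (fun x => `|psi x|) n d +
    C * push_cdf f (fun x => `|psi x|) n (1 - d) + q * M.
  have [i1 <-] := Rintegral_two_steps n (phi 0) (- phi 1) (phi 1) d (1 - d) psii.
  have [i2 <-] := Rintegral_two_steps n (- C) C q d (1 - d) apsii.
  have i3 : leb.-integrable I01 (EFin \o (fun x =>
      psi x * phi (iter n f x) - psi x * s n x)).
    by have := integrableB mI (intphi n) i1; apply: eq_integrable.
  rewrite -RintegralB//; apply: le_trans (le_normr_Rintegral mI i3) _.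
  apply: le_Rintegral => //; first exact: integrable_norm.
  move=> x Ix; rewrite -mulrBr normrM ler_wpM2l//; exact: sw.
have d01 : 0 < d < 1 by lra.
have d'01 : 0 < 1 - d < 1 by lra.
have lim1 : phi 0 * push_cdf f psi n d + - phi 1 * push_cdf f psi n (1 - d) +
     phi 1 * \int[leb]_(x in I01) psi x @[n --> \oo] -->
    \int[leb]_(x in I01) psi x * (L * phi 0 + (1 - L) * phi 1).
  have -> : \int[leb]_(x in I01) psi x * (L * phi 0 + (1 - L) * phi 1) =
    phi 0 * (\int[leb]_(x in I01) psi x * L) +
    - phi 1 * (\int[leb]_(x in I01) psi x * L) + phi 1 * \int[leb]_(x in I01) psi x.
    by ring.
  apply: cvgD; last exact: cvg_cst.
  by apply: cvgD; apply: cvgMr; exact: cdf_cvg.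
have lim2 : - C * push_cdf f (fun x => `|psi x|) n d +
    C * push_cdf f (fun x => `|psi x|) n (1 - d) @[n --> \oo] --> (0 : R).
  have -> : (0 : R) = - C * (\int[leb]_(x in I01) `|psi x| * L) +
      C * (\int[leb]_(x in I01) `|psi x| * L) by ring.
  by apply: cvgD; apply: cvgMr; exact: cdf_cvg.
move/cvgrPdist_le/(_ _ q0): lim1; move/cvgrPdist_le/(_ _ q0): lim2.
apply: filterS2 => n; have := key n.
rewrite sub0r normrN.
move: (\int[leb]_(x in I01) (psi x * phi (iter n f x))) (phi 0 * _ + _ + _)
  (- C * _ + _) (_ * (L * phi 0 + _)) => a b k l.
rewrite mulrDr in qe; move: (q * M) qe => qM qe.
by rewrite !ler_norml; lra.
Qed.

End BoundedObservables.

(** * The map and its invariant density *)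

Section FromMapToBranches.
Context {R : realType}.

Local Notation leb := (@lebesgue_measure R).
Local Notation I01 := (`[0%R, 1%R]%classic : set (measurableTypeR R)).

Lemma nm_le_iff (c : R) (F dF ddF g : R -> R) (x t : R) :
  neutral_map c F dF ddF -> inverse_on `[0, c] `[0, 1] F g ->
  0 <= x <= c -> 0 <= t <= 1 ->
  (F x <= t) = (x <= g t) /\ (t <= F x) = (g t <= x).
Proof.
move=> nm gF xc t01; have gt := nm_g_itv gF t01; have Fg := nm_gK gF t01.
have E1 : x <= g t -> F x <= t.
  by move=> xg; have := @nm_expands _ _ _ _ _ nm x (g t); lra.
have E2 : g t <= x -> t <= F x.
  by move=> xg; have := @nm_expands _ _ _ _ _ nm (g t) x; lra.
split; apply/idP/idP => // H; rewrite leNgt; apply/negP => H'.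
  by have := @nm_expands _ _ _ _ _ nm (g t) x; lra.
by have := @nm_expands _ _ _ _ _ nm x (g t); lra.
Qed.

Lemma measurable_on_three (A B : set (measurableTypeR R)) (p : R)
    (u : measurableTypeR R -> measurableTypeR R) :
  measurable A -> measurable B -> I01 = A `|` [set p] `|` B ->
  measurable_fun A u -> measurable_fun B u -> measurable_fun I01 u.
Proof.
move=> mA mB -> mAu mBu.
apply/measurable_funU => //; first exact: measurableU.
split => //; apply/measurable_funU => //; split => //.
exact: measurable_fun_set1.
Qed.

(** The map agrees with its extended branches at 0 and 1 too, because it fixes
    these points. *)
Lemma doubly_intermittent_two_branch (alpha b1 b2 c : R) (f f1 f2 g1 g2 : R -> R) :
  0 < c < 1 -> doubly_intermittent alpha b1 b2 c f f1 f2 ->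
  inverse_on `[0, c] `[0, 1] f1 g1 -> inverse_on `[c, 1] `[0, 1] f2 g2 ->
  two_branch_map c f g1 g2.
Proof.
move=> c01 hf hg1 hg2.
have [dF1 [ddF1 nm1]] := left_neutral_map c01 hf.
have [dF2 [ddF2 nm2]] := right_neutral_map c01 hf.
have hg2' := inverse_on_reflect01 hg2.
have f1E x : 0 <= x < c -> f x = f1 x.
  have [-> _|x0 xc] := eqVneq x 0; first by rewrite (di_fix0 hf) (nm_0 nm1).
  have [E _] := di_ext1 hf; rewrite E//= in_itv/=.
  by rewrite lt_neqAle eq_sym x0.
have f21 : f2 1 = 1.
  by have := nm_0 nm2; rewrite /reflect01 subr0; lra.
have f2E x : c < x <= 1 -> f x = f2 x.
  have [-> _|x1 xc] := eqVneq x 1; first by rewrite (di_fix1 hf) f21.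
  have [E _] := di_ext2 hf; rewrite E//= in_itv/=.
  by rewrite [x < 1]lt_neqAle x1.
have refl x : f2 x = 1 - reflect01 f2 (1 - x) by rewrite /reflect01 !subKr.
have g1I x : 0 <= x <= 1 -> 0 <= g1 x <= c by exact: (nm_g_itv hg1).
have g2I x : 0 <= x <= 1 -> c <= g2 x <= 1.
  move=> x01; have := @nm_g_itv _ _ _ _ hg2' (1 - x) ltac:(lra).
  by rewrite /reflect01 subKr; lra.
split => //.
- move=> x x01; have := di_self_map hf; move=> /(_ x).
  by rewrite /= !in_itv/=; exact.
- apply: (@measurable_on_three `[0, c[%classic `]c, 1]%classic c).
  + exact: measurable_itv.
  + exact: measurable_itv.
  + apply/seteqP; split => x /=; rewrite !in_itv/=.
      move=> x01; have [xc|xc|->] := ltgtP x c; [left; left|right|left; right => //].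
        lra.
      lra.
    by case=> [[|->]|]; lra.
  + apply: (@eq_measurable_fun _ _ _ _ _ f1).
      by move=> x; rewrite inE/= in_itv/= => xc; rewrite f1E.
    apply: (@measurable_funS _ _ _ _ `[0, c]%classic); first exact: measurable_itv.
      by move=> x /=; rewrite !in_itv/=; lra.
    apply: subspace_continuous_measurable_fun; first exact: measurable_itv.
    exact: nm_cont nm1.
  + apply: (@eq_measurable_fun _ _ _ _ _ f2).
      by move=> x; rewrite inE/= in_itv/= => xc; rewrite f2E.
    apply: (@measurable_funS _ _ _ _ `[c, 1]%classic); first exact: measurable_itv.
      by move=> x /=; rewrite !in_itv/=; lra.
    apply: subspace_continuous_measurable_fun; first exact: measurable_itv.
    have [_ [dF [ddF [HF _ _]]]] := di_ext2 hf.
    exact: has_deriv_within_continuous HF.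
- by move=> x x01; have := g1I x x01; lra.
- by move=> x x01; have := g2I x x01; lra.
- move=> x t x01 t01 xc; have G1 := g1I t t01; have G2 := g2I t t01.
  have [xltc|xgtc|E] := ltgtP x c; last by rewrite E eqxx in xc.
    rewrite f1E; last lra.
    have [-> _] := @nm_le_iff c _ _ _ _ x t nm1 hg1 ltac:(lra) t01.
    have -> : x <= g2 t by lra.
    by rewrite addrK.
  rewrite f2E; last lra.
  have [_ E] := @nm_le_iff _ _ _ _ _ (1 - x) (1 - t) nm2 hg2' ltac:(lra) ltac:(lra).
  have -> : (x <= g1 t) = false by apply/negbTE; rewrite -ltNge; lra.
  rewrite add0r subr0; congr (_%:R); congr nat_of_bool.
  by move: E; rewrite /reflect01 !subKr !lerD2l !lerN2.
- move=> x x01; have [xltc|xgtc|->] := ltgtP x c; last by constructor 1.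
    constructor 2; rewrite f1E; last lra.
    by rewrite (nm_Kg hg1)//; lra.
  constructor 3; rewrite f2E; last lra.
  by have [_ _ -> //] := hg2; rewrite /= in_itv/=; lra.
Qed.

Lemma density_measurable (h : R -> R) : {in `]0, 1[, continuous h} ->
  measurable_fun I01 (h : measurableTypeR R -> measurableTypeR R).
Proof.
move=> hc; apply: (@measurable_on_three [set 0] (`]0, 1[%classic `|` [set 1]) 0) => //.
- by apply: measurableU => //; exact: measurable_itv.
- apply/seteqP; split => x /=; rewrite !in_itv/=.
    move=> x01; have [->|x0] := eqVneq x 0; first by left; left.
    have [->|x1] := eqVneq x 1; first by right; right.
    by right; left; rewrite !lt_neqAle x1 eq_sym x0.
  by case=> [[->|->]|[|->]]; lra.
- exact: measurable_fun_set1.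
- apply/measurable_funU => //; split; last exact: measurable_fun_set1.
  apply: open_continuous_measurable_fun; first exact: interval_open.
  by move=> x; rewrite inE => x01; apply: hc.
Qed.

(** The values of [h] at 0 and 1 are arbitrary, possibly negative; the absolute
    value changes [h] on a null set only. *)
Lemma nonneg_density (f : R -> R) (mu : {measure set (measurableTypeR R) -> \bar R})
    (h : R -> R) : acim_with_density f mu h ->
  exists h' : R -> R, [/\ measurable_fun I01 (h' : measurableTypeR R -> measurableTypeR R),
    (forall x : R, 0 <= h' x) &
    forall A : set (measurableTypeR R), measurable A -> A `<=` I01 ->
      mu A = (\int[leb]_(x in A) (h' x)%:E)%E].
Proof.
move=> hmu; have mh := density_measurable (acim_continuous hmu).
exists (fun x => `|h x|).
have mh' : measurable_fun I01 (fun x => `|h x| : measurableTypeR R).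
  exact: measurableT_comp.
split => // A mA AI; rewrite (acim_density hmu)//.
apply: ae_eq_integral => //.
- by apply/measurable_EFinP; exact: measurable_funS mh.
- by apply/measurable_EFinP; exact: measurable_funS mh'.
exists [set 0; 1]; split.
- by apply: countable_measurable => //; apply: finite_set_countable; exact: finite_set2.
- by apply: countable_lebesgue_measure0; apply: finite_set_countable; exact: finite_set2.
move=> x /= H; apply: contrapT => nx; apply: H => Ax; congr EFin.
have := AI _ Ax; rewrite /= in_itv/= => x01.
rewrite ger0_norm//; apply/ltW/(acim_positive hmu).
have [E|x0] := eqVneq x 0; first by case: nx; left.
have [E|x1] := eqVneq x 1; first by case: nx; right.
by rewrite !lt_neqAle x1 eq_sym x0.
Qed.

End FromMapToBranches.

Theorem corollary1p3 (R : realType) (alpha b1 b2 c : R) (f f1 f2 : R -> R)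
    (g1 g2 : R -> R) (mu : {measure set (measurableTypeR R) -> \bar R})
    (h : R -> R) (phi : R -> R)
    (halpha : 0 < alpha <= 1) (hb1 : 0 < b1) (hb2 : 0 < b2) (hc : 0 < c < 1)
    (hf : doubly_intermittent alpha b1 b2 c f f1 f2)
    (hg1 : inverse_on `[0, c] `[0, 1] f1 g1)
    (hg2 : inverse_on `[c, 1] `[0, 1] f2 g2)
    (hmu : acim_with_density f mu h)
    (phi_bounded : [bounded phi x | x in `[0, 1]%classic])
    (phi_measurable :
      measurable_fun (`[0, 1]%classic : set (measurableTypeR R))
        (phi : measurableTypeR R -> measurableTypeR R))
    (phi_cont0 : phi x @[x --> 0^'+] --> phi 0)
    (phi_cont1 : phi x @[x --> 1^'-] --> phi 1) :
  let leb := @lebesgue_measure R in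
  let phi_mean : R :=
    fine (\int[two_point (pbar alpha b1 b2 h g1 g2)]_(x in `[0%R, 1%R])
            (phi x)%:E)%E in
  (forall psi : R -> R, leb.-integrable `[0, 1] (EFin \o psi) ->
     \int[leb]_(x in `[0, 1]) (psi x * phi (iter n f x)) @[n --> \oo] -->
     \int[leb]_(x in `[0, 1]) psi x * phi_mean) /\
  (forall psi : R -> R, mu.-integrable `[0, 1] (EFin \o psi) ->
     \int[mu]_(x in `[0, 1]) (psi x * phi (iter n f x)) @[n --> \oo] -->
     \int[mu]_(x in `[0, 1]) psi x * phi_mean).
Proof.
have bm := doubly_intermittent_two_branch hc hf hg1 hg2.
have [K K1 Klim] := iterated_push_cvg halpha hb1 hb2 hc hf hg1 hg2
  (acim_positive hmu hc).
have cdf_lim := integrable_cdf_cvg bm K1 Klim.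
have [C phiC] : exists C : R, forall x : R, 0 <= x <= 1 -> `|phi x| <= C.
  have [M [_ /(_ (M + 1))]] := phi_bounded; rewrite ltrDl ltr01 => /(_ isT) H.
  by exists (M + 1) => x x01; apply: H; rewrite /= in_itv.
move=> leb phi_mean.
have mI := measurable_I01 (R := R).
have phi_meanE : phi_mean = pbar alpha b1 b2 h g1 g2 * phi 0 +
    (1 - pbar alpha b1 b2 h g1 g2) * phi 1.
  have I0 : (`[0, 1]%classic : set (measurableTypeR R)) 0.
    by rewrite /= in_itv/= lexx ler01.
  have I1 : (`[0, 1]%classic : set (measurableTypeR R)) 1.
    by rewrite /= in_itv/= lexx ler01.
  have phiC' (x : measurableTypeR R) : `[0, 1]%classic x -> `|phi x| <= C.
    by rewrite /= in_itv/=; exact: phiC.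
  have H := integral_two_point_generic (limit_weight01 bm cdf_lim) mI I0 I1
    phi_measurable phiC'.
  rewrite /phi_mean.
  rewrite -[RHS]/(fine (_ %:E)) -H.
  by congr fine.
have part1 psi : leb.-integrable `[0, 1] (EFin \o psi) ->
    \int[leb]_(x in `[0, 1]) (psi x * phi (iter n f x)) @[n --> \oo] -->
    \int[leb]_(x in `[0, 1]) psi x * phi_mean.
  move=> psii; rewrite phi_meanE.
  exact: (observable_cvg bm cdf_lim psii phi_measurable phiC).
split=> // psi psii.
have [h' [mh' h'0 muE]] := nonneg_density hmu.
have h'0I x : (`[0, 1]%classic : set (measurableTypeR R)) x -> 0 <= h' x by [].
have [psih' ->] := integrable_density mI mh' h'0I muE psii.
have int_mu n : \int[mu]_(x in `[0, 1]) (psi x * phi (iter n f x)) =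
    \int[leb]_(x in `[0, 1]) (psi x * h' x * phi (iter n f x)).
  have i : mu.-integrable `[0, 1] (EFin \o (fun x => psi x * phi (iter n f x))).
    apply: (integrable_mul_bounded (C := C)) => //.
      exact: (observable_measurable bm).
    by move=> x; rewrite /= in_itv/= => x01; apply: phiC; exact: (iter_self bm).
  have [_ ->] := integrable_density mI mh' h'0I muE i.
  by apply: eq_Rintegral => x _; rewrite mulrAC.
rewrite (_ : (fun n => _) = fun n =>
    \int[leb]_(x in `[0, 1]) (psi x * h' x * phi (iter n f x))).
  exact: (part1 (fun x => psi x * h' x)).
by apply/funext.
Qed.
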